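(* Orthogonal families of (compound) Wishart random matrices are asymptotically free of second order. Precisely: let $\{X_N\}_N$ be a sequence of $N\times N$ complex Gaussian random matrices, let $\{D_1^{(N)},\dots,D_p^{(N)}\}_N$ be a sequence of $N\times N$ complex (non-random) matrices which converges in distribution to $(d_1,\dots,d_p)$ in $(\mathcal D,\psi)$, where $\mathcal D$ is a unital $*$-algebra with tracial state $\psi$, and let $P_N(D_i)=X_N^*D_i^{(N)}X_N$. Then $\{P_N(D_1),\dots,P_N(D_p)\}_N$ has a second order limit distribution, given by $(\mathcal A(\mathcal D),\varphi,\rho)$ and the elements $p(d_1),\dots,p(d_p)\in\mathcal A(\mathcal D)$, where $\varphi(a)=\langle a\Omega,\Omega\rangle$ and $\rho(a_1,a_2)=\langle\mathbf c\,a_1\Omega,\mathbf c\,a_2^*\Omega\rangle_{\mathrm{cyc}}$. Moreover, if $d_id_j=0$ for all $i\ne j$ and $\mathcal A_i$ is the unital algebra generated by $p(d_i)$, then $\mathcal A_1,\dots,\mathcal A_p$ are free with respect to $(\varphi,\rho)$; that is, $P_N(D_1),\dots,P_N(D_p)$ are asymptotically free of second order.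
   Context: Random matrices: the entries of $X_N$ are independent centered (circularly symmetric) complex Gaussians with variance $1/N$. Convergence in distribution of $\{D_1^{(N)},\dots,D_p^{(N)}\}_N$ to $(d_1,\dots,d_p)$ means $\lim_N\mathrm{tr}[D_{i_1}^{(N)}\cdots D_{i_k}^{(N)}]=\psi(d_{i_1}\cdots d_{i_k})$ for all $i_1,\dots,i_k$. $\mathrm{Tr}$ is the un-normalized trace, $\mathrm{tr}=\frac1N\mathrm{Tr}$, and $k_r$ is the $r$-th classical (multilinear) cumulant. Second order probability spaces: $(\mathcal A,\varphi,\rho)$ with $\mathcal A$ a unital complex algebra, $\varphi:\mathcal A\to\mathbb C$ tracial linear with $\varphi(1)=1$, $\rho:\mathcal A\times\mathcal A\to\mathbb C$ bilinear, tracial in each argument, with $\rho(a,1)=0=\rho(1,b)$. Given unital subalgebras $\mathcal A_1,\dots,\mathcal A_r$, a tuple $(a_1,\dots,a_n)$, $n\ge1$, is cyclically alternating if for each $k$ there is $i(k)$ with $a_k\in\mathcal A_{i(k)}$ and, if $n\ge2$, $i(k)\ne i(k+1)$ for $k=1,\dots,n$ (indices mod $n$); centered if $\varphi(a_k)=0$ for all $k$. The subalgebras are free with respect to $(\varphi,\rho)$ if they are free with respect to $\varphi$ and for all centered, cyclically alternating $(a_1,\dots,a_n)$, $(b_1,\dots,b_m)$: (i) $\rho(a_1\cdots a_n,b_1\cdots b_m)=0$ for $n\ne m$; (ii) $\rho(a,b)=0$ for $a\in\mathcal A_i$, $b\in\mathcal A_j$, $i\ne j$; (iii) if $n=m\ge2$,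 $\rho(a_1\cdots a_n,b_1\cdots b_n)=\sum_{k=0}^{n-1}\varphi(a_1b_{n+k})\varphi(a_2b_{(n-1)+k})\cdots\varphi(a_nb_{1+k})$ (indices of $b$ mod $n$). A sequence $\{A_1,\dots,A_s\}_N$ of $N\times N$ random matrices has second order limit distribution given by $(\mathcal A,\varphi,\rho)$ and $a_1,\dots,a_s\in\mathcal A$ if for all polynomials $p_1,p_2,\dots$ in $s$ non-commuting indeterminates: $\lim_Nk_1\{\mathrm{tr}[p_1(A_1,\dots,A_s)]\}=\varphi(p_1(a_1,\dots,a_s))$; $\lim_Nk_2\{\mathrm{Tr}[p_1(A_1,\dots,A_s)],\mathrm{Tr}[p_2(A_1,\dots,A_s)]\}=\rho(p_1(a_1,\dots,a_s),p_2(a_1,\dots,a_s))$; and for $r\ge3$, $\lim_Nk_r\{\mathrm{Tr}[p_1(A_1,\dots,A_s)],\dots,\mathrm{Tr}[p_r(A_1,\dots,A_s)]\}=0$. The matrices are asymptotically free of second order if such a limit exists and the unital algebras generated by the individual limit elements are free with respect to $(\varphi,\rho)$. Fock space: on $\mathcal D$ put $\langle d,d'\rangle=\psi(d'^*d)$. On $\mathcal F_{\mathrm{lin}}(\mathcal D)=\mathbb C\Omega\oplus\bigoplus_{n\ge1}\mathcal D^{\otimes n}$ (algebraic) define for $d\in\mathcal D$: $l(d)\Omega=d$, $l(d)f_1\otimes\cdots\otimes f_n=d\otimes f_1\otimes\cdots\otimes f_n$; $l^*(d)\Omega=0$, $l^*(d)f_1\otimes\cdots\otimes f_n=\langle f_1,d\rangle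 f_2\otimes\cdots\otimes f_n$; $\Lambda(d)\Omega=0$, $\Lambda(d)f_1\otimes\cdots\otimes f_n=(df_1)\otimes f_2\otimes\cdots\otimes f_n$; and $p(d)=l(d)+l^*(d^* )+\Lambda(d)+\psi(d)1$. $\mathcal A(\mathcal D)$ is the unital $*$-algebra generated by all $p(d)$, $d\in\mathcal D$ (with $p(d)^*=p(d^* )$). Cyclic Fock space: $\mathcal F_{\mathrm{cyc}}(\mathcal D)=\bigoplus_{n\ge0}\mathcal D^{\otimes n}_{\mathrm{cyc}}$ (algebraic), $\mathcal D^{\otimes n}_{\mathrm{cyc}}$ being spanned by circular tensors $[d_1\otimes\cdots\otimes d_n]$ (multilinear, invariant under cyclic rotation), with (semi-)inner product determined by $\langle[d_1\otimes\cdots\otimes d_n],[e_1\otimes\cdots\otimes e_m]\rangle_{\mathrm{cyc}}=\delta_{nm}\sum_{k=0}^{n-1}\langle d_1,e_{1+k}\rangle\cdots\langle d_n,e_{n+k}\rangle$ (indices of $e$ mod $n$). The linear map $\mathbf c:\mathcal F_{\mathrm{lin}}(\mathcal D)\to\mathcal F_{\mathrm{cyc}}(\mathcal D)$ is given by $\mathbf c\,\Omega=0$, $\mathbf c(d)=[d]$, and for $n\ge2$, $\mathbf c(d_1\otimes\cdots\otimes d_n)=[d_1\otimes\cdots\otimes d_n]+[d_nd_1\otimes d_2\otimes\cdots\otimes d_{n-1}]+\psi(d_1d_n)\,\mathbf c(d_2\otimes\cdots\otimes d_{n-1})$ (empty tensor $=\Omega$). *)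

(* Defs.v *)
From HB Require Import structures.
From mathcomp Require Import all_boot all_order all_algebra.
From mathcomp Require Import complex.
From mathcomp Require Import all_classical all_reals all_analysis.

Set Implicit Arguments.
Unset Strict Implicit.
Unset Printing Implicit Defensive.

Import Order.TTheory GRing.Theory Num.Theory numFieldNormedType.Exports.

Local Open Scope classical_set_scope.
Local Open Scope ring_scope.
Local Open Scope quotient_scope.

HB.mixin Record hasStar (R : rcfType) A of GRing.Algebra R[i] A := {
  star : A -> A;
  starK : involutive star;
  starD : {morph star : x y / x + y};
  starZ : forall (a : R[i]) x, star (a *: x) = a^* *: star x;
  starM : forall x y, star (x * y) = star y * star x
}.

#[short(type="starAlgType")]
HB.structure Definition StarAlgebra (R : rcfType) :=
  {A of hasStar R A & GRing.Algebra R[i] A}.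

Record tracial_state (R : rcfType) (D : starAlgType R) := TracialState {
  state_fun :> {scalar D};
  state1 : state_fun 1 = 1;
  state_ge0 : forall d, 0 <= state_fun (star d * d);
  state_tracial : forall x y, state_fun (x * y) = state_fun (y * x)
}.

Inductive subalg_gen (K : pzRingType) (A : algType K) (S : set A) : set A :=
| subalg_gen_in a : S a -> subalg_gen S a
| subalg_gen1 : subalg_gen S 1
| subalg_genD a b : subalg_gen S a -> subalg_gen S b -> subalg_gen S (a + b)
| subalg_genZ k a : subalg_gen S a -> subalg_gen S (k *: a)
| subalg_genM a b : subalg_gen S a -> subalg_gen S b -> subalg_gen S (a * b).

(** [:: (c1, w1); ...; (cn, wn)] stands for c1 w1 + ... + cn wn. *)
Definition fcomb (K X : Type) := seq (K * seq X).

Definition fcomb_eval (K : pzRingType) (X : Type) (W : lmodType K)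
  (M : seq X -> W) (u : fcomb K X) : W := \sum_(t <- u) t.1 *: M t.2.

(** Polynomials in s non-commuting indeterminates: formal combinations of
    words in the letters 0, ..., s - 1, evaluated at a tuple of algebra
    elements. *)
Definition ncpoly (K : Type) (s : nat) := fcomb K 'I_s.

Definition nceval (K : pzRingType) (A : algType K) (s : nat) (a : 'I_s -> A)
  (q : ncpoly K s) : A := fcomb_eval (fun w => \prod_(i <- w) a i) q.

Section FcombTheory.
Variables (K : pzRingType) (X : Type).
Implicit Types (W : lmodType K) (u v : fcomb K X).

Lemma fcomb_eval_nil W (M : seq X -> W) : fcomb_eval M [::] = 0.
Proof. by rewrite /fcomb_eval big_nil. Qed.

Lemma fcomb_eval_cons W (M : seq X -> W) t u :
  fcomb_eval M (t :: u) = t.1 *: M t.2 + fcomb_eval M u.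
Proof. by rewrite /fcomb_eval big_cons. Qed.

Lemma fcomb_eval_cat W (M : seq X -> W) u v :
  fcomb_eval M (u ++ v) = fcomb_eval M u + fcomb_eval M v.
Proof. by rewrite /fcomb_eval big_cat. Qed.

Lemma fcomb_eval_scale W (M : seq X -> W) (k : K) u :
  fcomb_eval M [seq (k * t.1, t.2) | t <- u] = k *: fcomb_eval M u.
Proof.
rewrite /fcomb_eval big_map scaler_sumr.
by apply: eq_bigr => t _; rewrite scalerA.
Qed.

Lemma fcomb_eval1 W (M : seq X -> W) w : fcomb_eval M [:: (1, w)] = M w.
Proof. by rewrite /fcomb_eval big_seq1 scale1r. Qed.

End FcombTheory.

(** [wspace adm] is the vector space spanned by the words in D that is
    universal for the maps M : seq D -> W satisfying [adm]: two formal
    combinations are identified iff every such M takes the same value on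
    them.  The direct sum of the D^{(x) n} and its cyclic version are
    obtained by taking for [adm] the maps that are multilinear (resp.
    multilinear and invariant under rotation) on words of each length. *)
Section WordSpace.
Variables (K : nzRingType) (D : lmodType K).
Variable adm : forall W : lmodType K, (seq D -> W) -> Prop.

Definition weq : rel (fcomb K D) := fun u v =>
  `[< forall (W : lmodType K) (M : seq D -> W), adm M ->
      fcomb_eval M u = fcomb_eval M v >].

Lemma weq_equiv : equiv_class_of weq.
Proof.
split=> [u|u v|v u w /asboolP uv /asboolP vw]; first exact/asboolP.
  by apply/asboolP/asboolP => uv W M aM; rewrite uv.
by apply/asboolP => W M aM; rewrite uv// vw.
Qed.

Canonical weq_equiv_rel := EquivRelPack weq_equiv.

Definition wspace := {eq_quot weq_equiv_rel}.

HB.instance Definition _ := Choice.on wspace.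

(** The linear map out of [wspace] induced by M, for M satisfying [adm]. *)
Definition wlift (W : lmodType K) (M : seq D -> W) (x : wspace) : W :=
  fcomb_eval M (repr x).

Definition wcls (u : fcomb K D) : wspace := \pi_wspace u.

Definition wvec (w : seq D) : wspace := wcls [:: (1, w)].

Lemma wlift_cls (W : lmodType K) (M : seq D -> W) u :
  adm M -> wlift M (wcls u) = fcomb_eval M u.
Proof.
move=> aM; rewrite /wlift.
have /eqmodP/asboolP/(_ W M aM)// : repr (wcls u) = u %[mod wspace].
by rewrite reprK.
Qed.

Lemma wspace_eqP (x y : wspace) :
  (forall (W : lmodType K) (M : seq D -> W), adm M -> wlift M x = wlift M y) ->
  x = y.
Proof.
by move=> xy; rewrite -[x]reprK -[y]reprK; apply/eqmodP/asboolP => W M /xy.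
Qed.

Let wadd (x y : wspace) := wcls (repr x ++ repr y).
Let wscale (k : K) (x : wspace) := wcls [seq (k * t.1, t.2) | t <- repr x].
Let wopp (x : wspace) := wscale (-1) x.
Let wzero := wcls [::].

Let wliftA (W : lmodType K) (M : seq D -> W) x y :
  adm M -> wlift M (wadd x y) = wlift M x + wlift M y.
Proof. by move=> aM; rewrite wlift_cls// fcomb_eval_cat. Qed.

Let wliftZ (W : lmodType K) (M : seq D -> W) k x :
  adm M -> wlift M (wscale k x) = k *: wlift M x.
Proof. by move=> aM; rewrite wlift_cls// fcomb_eval_scale. Qed.

Let wlift0 (W : lmodType K) (M : seq D -> W) : adm M -> wlift M wzero = 0.
Proof. by move=> aM; rewrite wlift_cls// fcomb_eval_nil. Qed.

Let waddA : associative wadd.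
Proof. by move=> x y z; apply: wspace_eqP => W M aM; rewrite !wliftA// addrA. Qed.
Let waddC : commutative wadd.
Proof. by move=> x y; apply: wspace_eqP => W M aM; rewrite !wliftA// addrC. Qed.
Let wadd0 : left_id wzero wadd.
Proof. by move=> x; apply: wspace_eqP => W M aM; rewrite !wliftA// wlift0// add0r. Qed.
Let waddN : left_inverse wzero wopp wadd.
Proof.
move=> x; apply: wspace_eqP => W M aM.
by rewrite wliftA// wliftZ// wlift0// scaleN1r addNr.
Qed.

HB.instance Definition _ := GRing.isZmodule.Build wspace waddA waddC wadd0 waddN.

Let wscaleA a b x : wscale a (wscale b x) = wscale (a * b) x.
Proof. by apply: wspace_eqP => W M aM; rewrite !wliftZ// scalerA. Qed.
Let wscale1 : left_id 1 wscale.
Proof. by move=> x; apply: wspace_eqP => W M aM; rewrite !wliftZ// scale1r. Qed.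
Let wscaleDr : right_distributive wscale +%R.
Proof.
move=> a x y; apply: wspace_eqP => W M aM.
by rewrite wliftZ// !wliftA// !wliftZ// scalerDr.
Qed.
Let wscaleDl x : {morph wscale^~ x : a b / a + b}.
Proof.
move=> a b; apply: wspace_eqP => W M aM.
by rewrite wliftZ// wliftA// !wliftZ// scalerDl.
Qed.

HB.instance Definition _ :=
  GRing.Zmodule_isLmodule.Build K wspace wscaleA wscale1 wscaleDr wscaleDl.

Lemma wlift_is_linear (W : lmodType K) (M : seq D -> W) : adm M -> linear (wlift M).
Proof. by move=> aM k x y; rewrite wliftA// wliftZ. Qed.

Lemma wlift_vec (W : lmodType K) (M : seq D -> W) w : adm M -> wlift M (wvec w) = M w.
Proof. by move=> aM; rewrite wlift_cls// fcomb_eval1. Qed.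

Lemma wlift_sum (W : lmodType K) (M : seq D -> W) I (r : seq I) (F : I -> wspace) :
  adm M -> wlift M (\sum_(i <- r) F i) = \sum_(i <- r) wlift M (F i).
Proof.
move=> aM; pose f : {linear wspace -> W} :=
  HB.pack (wlift M) (GRing.isLinear.Build _ _ _ _ _ (wlift_is_linear aM)).
exact: (raddf_sum f).
Qed.

Lemma wcls_eval u : wcls u = fcomb_eval wvec u.
Proof.
apply: wspace_eqP => W M aM; rewrite wlift_cls// wlift_sum//.
by apply: eq_bigr => t _; rewrite wliftZ// wlift_vec.
Qed.

Lemma wspace_span (x : wspace) : x = fcomb_eval wvec (repr x).
Proof. by rewrite -wcls_eval /wcls reprK. Qed.

Lemma wlift_unique (W : lmodType K) (f g : {linear wspace -> W}) :
  (forall w, f (wvec w) = g (wvec w)) -> f =1 g.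
Proof.
move=> fg x; rewrite (wspace_span x) !linear_sum.
by apply: eq_bigr => t _; rewrite !linearZ fg.
Qed.

End WordSpace.

Section Tensor.
Variables (K : nzRingType) (D : lmodType K).

(** M is multilinear on D^n for every n. *)
Definition multilinear (W : lmodType K) (M : seq D -> W) : Prop :=
  forall w1 w2 a d d', M (w1 ++ (a *: d + d') :: w2) =
    a *: M (w1 ++ d :: w2) + M (w1 ++ d' :: w2).

Definition cyclic_multilinear (W : lmodType K) (M : seq D -> W) : Prop :=
  multilinear M /\ forall w, M (rot 1 w) = M w.

(** The algebraic direct sum of the D^{(x) n}, n >= 0. *)
Definition flin := wspace (@multilinear).
HB.instance Definition _ := GRing.Lmodule.on flin.

Definition tens (w : seq D) : flin := wvec (@multilinear) w.
Definition vacuum : flin := tens [::].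

(** The algebraic direct sum of the cyclic D^{(x) n}, n >= 0. *)
Definition fcyc := wspace (@cyclic_multilinear).
HB.instance Definition _ := GRing.Lmodule.on fcyc.

Definition cyc (w : seq D) : fcyc := wvec (@cyclic_multilinear) w.

Definition flin_lift (W : lmodType K) (M : seq D -> W) : flin -> W := wlift M.
Definition fcyc_lift (W : lmodType K) (M : seq D -> W) : fcyc -> W := wlift M.

Lemma flin_lift_tens (W : lmodType K) (M : seq D -> W) w :
  multilinear M -> flin_lift M (tens w) = M w.
Proof. exact: wlift_vec. Qed.

Lemma fcyc_lift_cyc (W : lmodType K) (M : seq D -> W) w :
  cyclic_multilinear M -> fcyc_lift M (cyc w) = M w.
Proof. exact: wlift_vec. Qed.

Lemma flin_lift_linear (W : lmodType K) (M : seq D -> W) :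
  multilinear M -> linear (flin_lift M).
Proof. exact: wlift_is_linear. Qed.

Lemma fcyc_lift_linear (W : lmodType K) (M : seq D -> W) :
  cyclic_multilinear M -> linear (fcyc_lift M).
Proof. exact: wlift_is_linear. Qed.

Lemma tens_multilinear : multilinear tens.
Proof.
move=> w1 w2 a d d'; apply: wspace_eqP => W M aM.
by rewrite (wlift_is_linear aM) !wlift_vec.
Qed.

Lemma cyc_multilinear : cyclic_multilinear cyc.
Proof.
split=> [w1 w2 a d d'|w]; apply: wspace_eqP => W M aM.
  by rewrite (wlift_is_linear aM) !wlift_vec//; case: aM.
by rewrite !wlift_vec//; case: aM.
Qed.

Lemma vacuum_neq0 : vacuum != 0.
Proof.
pose M (w : seq D) : K^o := (w == [::])%:R.
have aM : multilinear M.
  by case=> [|x w1] w2 a d d'; rewrite /M /= scaler0 addr0.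
apply/eqP => /(congr1 (flin_lift M)); rewrite flin_lift_tens//.
pose f : {linear flin -> K^o} := HB.pack (flin_lift M)
  (GRing.isLinear.Build _ _ _ _ _ (flin_lift_linear aM)).
have -> : flin_lift M 0 = 0 by exact: (linear0 f).
by rewrite /M eqxx => /eqP; rewrite oner_eq0.
Qed.

End Tensor.

Arguments vacuum {K D}.
Arguments vacuum_neq0 {K D}.

Section Operators.
Variables (K : comNzRingType) (D : lmodType K).
Local Notation F := (flin D).

Definition linear_op : {pred F -> F} := fun f => `[< linear f >].

Let linear_op_submod : submod_closed linear_op.
Proof.
split.
  have z t : (0 : F -> F) t = 0 by [].
  by apply/asboolP => k x y; rewrite !z scaler0 addr0.
move=> a f g /asboolP lf /asboolP lg; apply/asboolP => k x y.
have e t : (a *: f + g : F -> F) t = a *: f t + g t by [].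
rewrite !e lf lg !scalerDr !scalerA (mulrC k a) !addrA; congr (_ + _).
by rewrite -!addrA; congr (_ + _); rewrite addrC.
Qed.
HB.instance Definition _ :=
  GRing.isSubmodClosed.Build K (F -> F) linear_op linear_op_submod.

Record fock_op := FockOp { fock_fun :> F -> F; _ : fock_fun \in linear_op }.
HB.instance Definition _ := [isSub for fock_fun].
HB.instance Definition _ := [Choice of fock_op by <:].
HB.instance Definition _ := [SubChoice_isSubLmodule of fock_op by <:].

Lemma fock_op_linear (a : fock_op) : linear a.
Proof. by case: a => f lf; exact/asboolP. Qed.

HB.instance Definition _ (a : fock_op) :=
  GRing.isLinear.Build K F F *:%R a (fock_op_linear a).

Lemma fock_opP (a b : fock_op) : a =1 b -> a = b.
Proof. by move=> ab; apply/val_inj/funext. Qed.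

Lemma fock_addE (a b : fock_op) x : (a + b) x = a x + b x.
Proof. by []. Qed.
Lemma fock_oppE (a : fock_op) x : (- a) x = - a x.
Proof. by []. Qed.
Lemma fock_0E x : (0 : fock_op) x = 0. Proof. by []. Qed.
Lemma fock_scaleE k (a : fock_op) x : (k *: a) x = k *: a x.
Proof. by []. Qed.

Let id_op : linear (@idfun F). Proof. by []. Qed.
Let mul_op (a b : fock_op) : linear (a \o b).
Proof. by move=> k x y /=; rewrite !linearP. Qed.

Definition fock_one : fock_op := FockOp (asboolT id_op).
Definition fock_mul (a b : fock_op) : fock_op := FockOp (asboolT (mul_op a b)).

Let fock_mulA : associative fock_mul. Proof. by move=> a b c; exact: fock_opP. Qed.
Let fock_mul1 : left_id fock_one fock_mul. Proof. by move=> a; exact: fock_opP. Qed.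
Let fock_mulr1 : right_id fock_one fock_mul. Proof. by move=> a; exact: fock_opP. Qed.
Let fock_mulDl : left_distributive fock_mul +%R.
Proof. by move=> a b c; exact: fock_opP. Qed.
Let fock_mulDr : right_distributive fock_mul +%R.
Proof. by move=> a b c; apply: fock_opP => x /=; rewrite linearD. Qed.
Let fock_1neq0 : fock_one != 0.
Proof.
apply/eqP => /(congr1 (fun a : fock_op => a vacuum)) /= /eqP.
by rewrite (negbTE vacuum_neq0).
Qed.

HB.instance Definition _ := GRing.Zmodule_isNzRing.Build fock_op
  fock_mulA fock_mul1 fock_mulr1 fock_mulDl fock_mulDr fock_1neq0.

Lemma fock_1E x : (1 : fock_op) x = x. Proof. by []. Qed.
Lemma fock_mulE (a b : fock_op) x : (a * b) x = a (b x). Proof. by []. Qed.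

Let fock_scaleAl k (a b : fock_op) : k *: (a * b) = k *: a * b.
Proof. exact: fock_opP. Qed.
HB.instance Definition _ := GRing.Lmodule_isLalgebra.Build K fock_op fock_scaleAl.

Let fock_scaleAr k (a b : fock_op) : k *: (a * b) = a * (k *: b).
Proof. by apply: fock_opP => x; rewrite !fock_mulE !fock_scaleE linearZ. Qed.
HB.instance Definition _ := GRing.Lalgebra_isAlgebra.Build K fock_op fock_scaleAr.

End Operators.

Section FockSpace.
Variables (R : rcfType) (D : starAlgType R) (psi : tracial_state D).
Local Notation C := R[i].
Local Notation F := (flin D).

Definition inner (d e : D) : C := psi (star e * d).

Lemma inner_linear e : scalar (inner^~ e).
Proof. by move=> a x y; rewrite /inner mulrDr -scalerAr linearP. Qed.

Lemma inner_antilinear d a e e' :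
  inner d (a *: e + e') = a^* * inner d e + inner d e'.
Proof. by rewrite /inner starD starZ mulrDl -scalerAl linearP. Qed.

Definition creation_word (d : D) (w : seq D) : F := tens (d :: w).

Definition annihilation_word (d : D) (w : seq D) : F :=
  if w is f :: w' then inner f d *: tens w' else 0.

Definition preservation_word (d : D) (w : seq D) : F :=
  if w is f :: w' then tens (d * f :: w') else 0.

Lemma creation_multilinear d : multilinear (creation_word d).
Proof. by move=> w1 w2 a x y; rewrite /creation_word -!cat_cons tens_multilinear. Qed.

Lemma annihilation_multilinear d : multilinear (annihilation_word d).
Proof.
case=> [|f w1] w2 a x y /=; first by rewrite inner_linear scalerDl scalerA.
by rewrite tens_multilinear scalerDr !scalerA mulrC.
Qed.

Lemma preservation_multilinear d : multilinear (preservation_word d).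
Proof.
case=> [|f w1] w2 a x y /=; last by rewrite -!cat_cons tens_multilinear.
by rewrite mulrDr -scalerAr (tens_multilinear [::]).
Qed.

(** l(d), l^*(d) and Lambda(d). *)
Definition creation (d : D) : fock_op D :=
  FockOp (asboolT (flin_lift_linear (creation_multilinear d))).
Definition annihilation (d : D) : fock_op D :=
  FockOp (asboolT (flin_lift_linear (annihilation_multilinear d))).
Definition preservation (d : D) : fock_op D :=
  FockOp (asboolT (flin_lift_linear (preservation_multilinear d))).

Definition poisson_op (d : D) : fock_op D :=
  creation d + annihilation (star d) + preservation d + psi d *: 1.

Lemma creationE d w : creation d (tens w) = tens (d :: w).
Proof. exact: flin_lift_tens (creation_multilinear d). Qed.
Lemma annihilation_vacuum d : annihilation d vacuum = 0.
Proof. exact: flin_lift_tens (annihilation_multilinear d). Qed.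
Lemma annihilationE d f w : annihilation d (tens (f :: w)) = inner f d *: tens w.
Proof. exact: flin_lift_tens (annihilation_multilinear d). Qed.
Lemma preservation_vacuum d : preservation d vacuum = 0.
Proof. exact: flin_lift_tens (preservation_multilinear d). Qed.
Lemma preservationE d f w : preservation d (tens (f :: w)) = tens (d * f :: w).
Proof. exact: flin_lift_tens (preservation_multilinear d). Qed.

Fixpoint word_inner (ds es : seq D) : C :=
  match ds, es with
  | [::], [::] => 1
  | d :: ds', e :: es' => inner d e * word_inner ds' es'
  | _, _ => 0
  end.

(** Zero on words of different lengths, since [word_inner] is.  In length 0
    the sum over rotations is empty; this value plays no role, the map [c]
    having no component in degree 0. *)
Definition cyc_word_inner (ds es : seq D) : C :=
  \sum_(k < size es) word_inner ds (rot k es).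

(** Sesquilinear extension, conjugate linear in the second argument, of a
    function on pairs of words. *)
Definition sesq_ext adm (g : seq D -> seq D -> C) (x y : wspace (D := D) adm) : C :=
  \sum_(s <- repr x) \sum_(t <- repr y) s.1 * t.1^* * g s.2 t.2.

Definition flin_inner : F -> F -> C := sesq_ext word_inner.
Definition fcyc_inner : fcyc D -> fcyc D -> C := sesq_ext cyc_word_inner.

Section SesqExt.
Variable adm : forall W : lmodType C, (seq D -> W) -> Prop.
Variable g : seq D -> seq D -> C.
Hypothesis gl : forall es, adm ((g^~ es) : seq D -> C^o).
Hypothesis gr : forall ds, adm ((fun es => (g ds es)^*) : seq D -> C^o).

Lemma sesq_ext_liftr x y :
  sesq_ext (adm := adm) g x y =
  \sum_(s <- repr x)
    s.1 * (wlift ((fun es => (g s.2 es)^*) : seq D -> C^o) y : C)^*.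
Proof.
rewrite /sesq_ext; apply: eq_bigr => s _.
rewrite /wlift /fcomb_eval rmorph_sum mulr_sumr; apply: eq_bigr => t _.
by rewrite -mulrA; congr (_ * _); rewrite rmorphM /= conjCK.
Qed.

Lemma sesq_ext_liftl x y :
  sesq_ext (adm := adm) g x y =
  \sum_(t <- repr y) t.1^* * (wlift ((g^~ t.2) : seq D -> C^o) x : C).
Proof.
rewrite /sesq_ext exchange_big; apply: eq_bigr => t _.
rewrite /wlift /fcomb_eval mulr_sumr; apply: eq_bigr => s _.
by rewrite mulrCA mulrA.
Qed.

Lemma sesq_ext_linear y : scalar (fun x => sesq_ext (adm := adm) g x y).
Proof.
move=> a x x'; rewrite !sesq_ext_liftl mulr_sumr -big_split.
apply: eq_bigr => t _ /=; rewrite (wlift_is_linear (gl t.2)).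
by rewrite mulrDr mulrCA.
Qed.

Lemma sesq_ext_antilinear x a y y' :
  sesq_ext (adm := adm) g x (a *: y + y') =
  a^* * sesq_ext g x y + sesq_ext g x y'.
Proof.
rewrite !sesq_ext_liftr mulr_sumr -big_split.
apply: eq_bigr => s _ /=; rewrite (wlift_is_linear (gr s.2)).
by rewrite rmorphD rmorphM mulrDr mulrCA.
Qed.

Lemma sesq_ext_vec ds es : sesq_ext (adm := adm) g (wvec adm ds) (wvec adm es) = g ds es.
Proof.
rewrite sesq_ext_liftr.
transitivity (wlift ((g^~ es) : seq D -> C^o) (wvec adm ds)); last first.
  exact: (wlift_vec _ (gl es)).
apply: eq_bigr => s _; congr (_ * _).
by rewrite (wlift_vec _ (gr s.2)) conjCK.
Qed.

End SesqExt.

Lemma word_inner_linear es : multilinear ((word_inner^~ es) : seq D -> C^o).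
Proof.
move=> w1; elim: w1 es => [|x w1 IH] [|e es] w2 a d d' /=.
- by rewrite scaler0 addr0.
- by rewrite inner_linear mulrDl scalerAl.
- by rewrite scaler0 addr0.
- by rewrite IH mulrDr scalerAr.
Qed.

Lemma word_inner_antilinear ds :
  multilinear ((fun es => (word_inner ds es)^*) : seq D -> C^o).
Proof.
move=> w1; elim: w1 ds => [|x w1 IH] [|e ds] w2 a d d' /=.
- by rewrite conjC0 scaler0 addr0.
- by rewrite inner_antilinear mulrDl rmorphD -mulrA rmorphM /= conjCK.
- by rewrite conjC0 scaler0 addr0.
- by rewrite !rmorphM /= IH mulrDr scalerAr.
Qed.

Lemma word_inner_rot1 ds es :
  size ds = size es -> word_inner (rot 1 ds) (rot 1 es) = word_inner ds es.
Proof.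
have rc x y : size x = size y -> forall d e,
    word_inner (rcons x d) (rcons y e) = word_inner x y * inner d e.
  elim: x y => [|a x IH] [|b y]// sxy d e /=; first by rewrite mulrC.
  by rewrite IH ?mulrA//; case: sxy.
case: ds es => [|d ds] [|e es]// [sde].
by rewrite !rot1_cons rc// mulrC.
Qed.

Lemma word_inner_size ds es : size ds != size es -> word_inner ds es = 0.
Proof.
elim: ds es => [|d ds IH] [|e es]//= s.
by rewrite IH ?mulr0.
Qed.

Lemma cyc_word_inner_rotl ds es : cyc_word_inner (rot 1 ds) es = cyc_word_inner ds es.
Proof.
have [sde|sde] := eqVneq (size ds) (size es); last first.
  by rewrite /cyc_word_inner !big1// => k _; rewrite word_inner_size// !size_rot.
rewrite /cyc_word_inner.
case: es sde => [|e es] sde; first by rewrite !big_ord0.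
set v := e :: es in sde *; set n := size es.
rewrite [LHS](@big_ord_recl _ _ _ n) [RHS](@big_ord_recr _ _ _ n) /= addrC.
congr (_ + _).
  have -> : rot 0 v = rot 1 (rot n v) by rewrite -rotS// rot0 (rot_size v).
  by rewrite word_inner_rot1// size_rot.
apply: eq_bigr => k _; rewrite /bump add1n (@rotS _ k v).
  by rewrite word_inner_rot1// size_rot.
by rewrite /= ltnS ltnW.
Qed.

Lemma cyc_word_inner_rotr ds es : cyc_word_inner ds (rot 1 es) = cyc_word_inner ds es.
Proof.
rewrite /cyc_word_inner size_rot.
case: es => [|e es]; first by rewrite !big_ord0.
set v := e :: es; set n := size es.
rewrite [RHS](@big_ord_recl _ _ _ n) [LHS](@big_ord_recr _ _ _ n) /= addrC.
have rotC k : (k < size v)%N -> rot k (rot 1 v) = rot k.+1 v.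
  by move=> kv; rewrite (@rotS _ k v)// rot_rot.
congr (_ + _); first by rewrite rotC// (rot_size v : rot n.+1 v = v) rot0.
by apply: eq_bigr => k _; rewrite /bump add1n rotC//= ltnS ltnW.
Qed.

Lemma rot_cat_cons k (w1 w2 : seq D) : exists v1 v2,
  forall x, rot k (w1 ++ x :: w2) = v1 ++ x :: v2.
Proof.
elim: k => [|k [v1 [v2 IH]]]; first by exists w1, w2 => x; rewrite rot0.
have [kw|wk] := ltnP k (size (w1 ++ 0 :: w2)); last first.
  by exists w1, w2 => x; rewrite rot_oversize//; move: wk; rewrite !size_cat /= => /leqW.
case: v1 IH => [|y v1] IH.
  exists v2, [::] => x; rewrite rotS ?IH /= ?rot1_cons -?cats1//.
  by move: kw; rewrite !size_cat.
exists v1, (rcons v2 y) => x; rewrite rotS ?IH /= ?rot1_cons ?rcons_cat//.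
by move: kw; rewrite !size_cat.
Qed.

Lemma multilinear_rot (W : lmodType C) (M : seq D -> W) k :
  multilinear M -> multilinear (M \o rot k).
Proof.
move=> mM w1 w2 a d d'; have [v1 [v2 rE]] := rot_cat_cons k w1 w2.
by rewrite /= !rE mM.
Qed.

Lemma cyc_word_inner_linear es :
  cyclic_multilinear ((cyc_word_inner^~ es) : seq D -> C^o).
Proof.
split=> [w1 w2 a d d'|w]; last exact: cyc_word_inner_rotl.
rewrite /cyc_word_inner scaler_sumr -big_split; apply: eq_bigr => k _ /=.
exact: word_inner_linear.
Qed.

Lemma cyc_word_inner_antilinear ds :
  cyclic_multilinear ((fun es => (cyc_word_inner ds es)^*) : seq D -> C^o).
Proof.
split=> [w1 w2 a d d'|w]; last by rewrite cyc_word_inner_rotr.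
rewrite /cyc_word_inner !rmorph_sum !size_cat /= scaler_sumr -big_split.
apply: eq_bigr => k _ /=.
exact: (multilinear_rot k (word_inner_antilinear ds)).
Qed.

Lemma flin_inner_tens ds es : flin_inner (tens ds) (tens es) = word_inner ds es.
Proof.
by apply: sesq_ext_vec; [exact: word_inner_linear|exact: word_inner_antilinear].
Qed.

Lemma fcyc_inner_cyc ds es : fcyc_inner (cyc ds) (cyc es) = cyc_word_inner ds es.
Proof.
by apply: sesq_ext_vec;
  [exact: cyc_word_inner_linear|exact: cyc_word_inner_antilinear].
Qed.

Lemma flin_inner_linear y : scalar (flin_inner^~ y).
Proof. exact: sesq_ext_linear word_inner_linear y. Qed.

Lemma flin_inner_antilinear x a y y' :
  flin_inner x (a *: y + y') = a^* * flin_inner x y + flin_inner x y'.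
Proof. exact: sesq_ext_antilinear word_inner_antilinear x a y y'. Qed.

Lemma fcyc_inner_linear y : scalar (fcyc_inner^~ y).
Proof. exact: sesq_ext_linear cyc_word_inner_linear y. Qed.

Lemma fcyc_inner_antilinear x a y y' :
  fcyc_inner x (a *: y + y') = a^* * fcyc_inner x y + fcyc_inner x y'.
Proof. exact: sesq_ext_antilinear cyc_word_inner_antilinear x a y y'. Qed.

(** The map [c] on words; the first argument bounds the number of recursive
    calls and any value >= size w gives the same result. *)
Fixpoint cword_rec (n : nat) (w : seq D) : fcyc D :=
  if n is n'.+1 then
    match w with
    | [::] => 0
    | [:: d] => cyc [:: d]
    | d1 :: d2 :: w' =>
        let dn := last d2 w' in
        let mid := belast d2 w' in
        cyc w + cyc (dn * d1 :: mid) + psi (d1 * dn) *: cword_rec n' mid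
    end
  else 0.

Definition cmap : F -> fcyc D := flin_lift (fun w => cword_rec (size w) w).

Lemma cword_rec_rcons n d1 dn mid :
  cword_rec n.+1 (d1 :: rcons mid dn) =
  cyc (d1 :: rcons mid dn) + cyc (dn * d1 :: mid) +
  psi (d1 * dn) *: cword_rec n mid.
Proof. by case: mid => [|x mid] //=; rewrite last_rcons belast_rcons. Qed.

Lemma cword_rec_nil n : cword_rec n [::] = 0.
Proof. by case: n. Qed.

Lemma cword_rec_multilinear n : multilinear (cword_rec n).
Proof.
have [cm _] := @cyc_multilinear _ D.
have cm0 (a : C) (x y : D) w : cyc (a *: x + y :: w) = a *: cyc (x :: w) + cyc (y :: w).
  exact: (cm [::] w a x y).
have mix (V : lmodType C) (a : C) (u u' v v' t t' : V) :
    a *: u + u' + (a *: v + v') + (a *: t + t') =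
    a *: (u + v + t) + (u' + v' + t').
  by rewrite !scalerDr (addrACA _ u') (addrACA _ (u' + v')).
elim: n => [|n IH] w1 w2 a d d'; first by rewrite /= scaler0 addr0.
case: w1 w2 => [|y w1] w2; case/lastP: w2 => [|w2 z].
- exact: cm0.
- rewrite !cat0s !cword_rec_rcons cm0 mulrDr -scalerAr cm0 mulrDl -scalerAl.
  by rewrite linearP scalerDl -scalerA mix.
- rewrite !cat_cons !cats1 !cword_rec_rcons -!cats1 -!cat_cons cm.
  rewrite mulrDl -scalerAl cm0 mulrDr -scalerAr.
  by rewrite linearP scalerDl -scalerA mix.
- rewrite !cat_cons -!rcons_cons -!rcons_cat !cword_rec_rcons IH.
  rewrite !rcons_cat !rcons_cons -!cat_cons !cm.
  by rewrite scalerDr !scalerA mulrC -scalerA mix.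
Qed.

Lemma cword_rec_stable n m w :
  (size w <= n)%N -> (size w <= m)%N -> cword_rec n w = cword_rec m w.
Proof.
elim: n m w => [|n IH] [|m] w; rewrite ?leqn0.
- by [].
- by move=> /nilP ->; rewrite cword_rec_nil.
- by move=> _ /nilP ->; rewrite cword_rec_nil.
case: w => [|d1 w]; first by [].
case/lastP: w => [|w dn]; first by [].
rewrite !cword_rec_rcons /= size_rcons !ltnS => wn wm.
by rewrite (IH m w) ?(ltnW wn) ?(ltnW wm).
Qed.

Lemma cword_multilinear : multilinear (fun w => cword_rec (size w) w).
Proof. by move=> w1 w2 a d d'; rewrite cword_rec_multilinear !size_cat. Qed.

Lemma cmap_linear : linear cmap.
Proof. exact: flin_lift_linear cword_multilinear. Qed.
HB.instance Definition _ := GRing.isLinear.Build C F (fcyc D) *:%R cmap cmap_linear.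

Lemma cmap_tensE w : cmap (tens w) = cword_rec (size w) w.
Proof. exact: flin_lift_tens cword_multilinear. Qed.

Lemma cmap_vacuum : cmap vacuum = 0.
Proof. by rewrite cmap_tensE. Qed.

Lemma cmap_tens1 d : cmap (tens [:: d]) = cyc [:: d].
Proof. by rewrite cmap_tensE. Qed.

Lemma cmap_tens d1 mid dn :
  cmap (tens (d1 :: rcons mid dn)) =
  cyc (d1 :: rcons mid dn) + cyc (dn * d1 :: mid) +
  psi (d1 * dn) *: cmap (tens mid).
Proof.
rewrite !cmap_tensE.
have -> : size (d1 :: rcons mid dn) = (size mid).+2 by rewrite /= size_rcons.
rewrite cword_rec_rcons; congr (_ + _ *: _).
exact: cword_rec_stable.
Qed.

End FockSpace.

Section FockAlgebra.
Variables (R : rcfType) (D : starAlgType R) (psi : tracial_state D).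
Local Notation C := R[i].
Local Notation F := (flin D).

(** As p(d)^* = p(d^* ), the unital *-algebra generated by the p(d) is the
    unital algebra they generate. *)
Definition fock_alg_pred : {pred fock_op D} :=
  fun a => `[< subalg_gen (range (poisson_op psi)) a >].

Let fock_alg_subalg : subalg_closed fock_alg_pred.
Proof.
split; first by apply/asboolP; exact: subalg_gen1.
- move=> k a b /asboolP ga /asboolP gb; apply/asboolP.
  by apply: subalg_genD => //; exact: subalg_genZ.
- by move=> a b /asboolP ga /asboolP gb; apply/asboolP; exact: subalg_genM.
Qed.
HB.instance Definition _ :=
  GRing.isSubalgClosed.Build C (fock_op D) fock_alg_pred fock_alg_subalg.

Record fock_alg := FockAlg {
  fock_alg_op :> fock_op D;
  _ : fock_alg_op \in fock_alg_pred
}.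
HB.instance Definition _ := [isSub for fock_alg_op].
HB.instance Definition _ := [Choice of fock_alg by <:].
HB.instance Definition _ := [SubChoice_isSubAlgebra of fock_alg by <:].

Lemma poisson_in d : poisson_op psi d \in fock_alg_pred.
Proof. by apply/asboolP/subalg_gen_in; exists d. Qed.

(** p(d) as an element of A(D). *)
Definition poisson (d : D) : fock_alg := FockAlg (poisson_in d).

(** [adjoint_rel a b]: b is the adjoint of a.  The inner product of the full
    tensor space may be degenerate, so the involution of A(D) is specified by
    its values p(d)^* = p(d^* ) on the generators and the *-algebra axioms. *)
Inductive adjoint_rel : fock_alg -> fock_alg -> Prop :=
| adjoint1 : adjoint_rel 1 1
| adjoint_poisson d : adjoint_rel (poisson d) (poisson (star d))
| adjointD a a' b b' :
    adjoint_rel a a' -> adjoint_rel b b' -> adjoint_rel (a + b) (a' + b')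
| adjointZ (k : C) a a' : adjoint_rel a a' -> adjoint_rel (k *: a) (k^* *: a')
| adjointM a a' b b' :
    adjoint_rel a a' -> adjoint_rel b b' -> adjoint_rel (a * b) (b' * a').

Definition fock_star (a : fock_alg) : fock_alg := xget 0 (adjoint_rel a).

(* The remainder of the section proves that each a has exactly one adjoint. *)

Lemma fock_op_ext (a b : fock_op D) :
  (forall w, a (tens w) = b (tens w)) -> a = b.
Proof. by move=> ab; apply/fock_opP/wlift_unique. Qed.

Let fockD (a : fock_op D) x y : a (x + y) = a x + a y.
Proof. exact: (linearD a). Qed.
Let fockZ (a : fock_op D) k x : a (k *: x) = k *: a x.
Proof. by rewrite linearZ. Qed.
Let fock0 (a : fock_op D) : a 0 = 0.
Proof. exact: (linear0 a). Qed.

Lemma poisson_opE d x : poisson_op psi d x =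
  creation d x + annihilation psi (star d) x + preservation d x + psi d *: x.
Proof. by []. Qed.

Lemma poisson_op_linear : linear (poisson_op psi).
Proof.
move=> k x y; apply: fock_op_ext => w.
rewrite poisson_opE [RHS]fock_addE fock_scaleE !poisson_opE !creationE.
rewrite (@tens_multilinear _ _ [::]) linearP scalerDl -scalerA.
have mix (a b c d a' b' c' d' : F) :
    k *: a + a' + (k *: b + b') + (k *: c + c') + (k *: d + d') =
    k *: (a + b + c + d) + (a' + b' + c' + d').
  rewrite !scalerDr (addrACA _ a') (addrACA _ (a' + b')).
  by rewrite (addrACA _ (a' + b' + c')).
rewrite -mix; congr (_ + _ + _ + _).
- case: w => [|f w]; first by rewrite !annihilation_vacuum scaler0 addr0.
  rewrite !annihilationE starD starZ inner_antilinear scalerDl -scalerA.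
  by rewrite conjCK.
- case: w => [|f w]; first by rewrite !preservation_vacuum scaler0 addr0.
  by rewrite !preservationE mulrDl -scalerAl (@tens_multilinear _ _ [::]).
Qed.

Lemma poisson_linear : linear poisson.
Proof. by move=> k x y; apply/val_inj; exact: poisson_op_linear. Qed.

Definition pword (w : seq D) : fock_alg := \prod_(d <- w) poisson d.

Lemma pword_cat v w : pword (v ++ w) = pword v * pword w.
Proof. by rewrite /pword big_cat. Qed.

Lemma pword_multilinear : multilinear pword.
Proof.
move=> w1 w2 a d d'; rewrite !pword_cat /pword !big_cons poisson_linear.
by rewrite mulrDl mulrDr -scalerAl -scalerAr.
Qed.

Definition component_word n (w : seq D) : F := if size w == n then tens w else 0.
Lemma component_multilinear n : multilinear (component_word n).
Proof.
move=> w1 w2 a d d'; rewrite /component_word !size_cat /=.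
by case: ifP => _; [exact: tens_multilinear|rewrite scaler0 addr0].
Qed.
Definition component n : fock_op D :=
  FockOp (asboolT (flin_lift_linear (component_multilinear n))).

Lemma componentE n w : component n (tens w) = if size w == n then tens w else 0.
Proof. exact: flin_lift_tens (component_multilinear n). Qed.

Lemma component_poisson n d x : component n.+1 (poisson d x) =
  creation d (component n x) + annihilation psi (star d) (component n.+2 x) +
  preservation d (component n.+1 x) + psi d *: component n.+1 x.
Proof.
suff /(congr1 (fun a : fock_op D => a x)) :
  component n.+1 * poisson d =
  creation d * component n + annihilation psi (star d) * component n.+2 +
  preservation d * component n.+1 + psi d *: component n.+1 by [].
apply: fock_op_ext => w.
rewrite !fock_addE fock_scaleE !fock_mulE poisson_opE !fockD fockZ.
have szE f w' : size (f :: w' : seq D) = (size w').+1 by [].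
have sz0 m : (size ([::] : seq D) == m.+1) = false by [].
congr (_ + _ + _ + _).
- rewrite creationE !componentE szE eqSS; case: ifP => _; rewrite ?fock0//.
  by rewrite creationE.
- case: w => [|f w]; first by rewrite annihilation_vacuum componentE sz0 !fock0.
  rewrite annihilationE fockZ !componentE szE eqSS.
  by case: ifP => _; rewrite ?fock0 ?scaler0// annihilationE.
- case: w => [|f w]; first by rewrite preservation_vacuum componentE sz0 !fock0.
  rewrite preservationE !componentE !szE.
  by case: ifP => _; rewrite ?fock0// preservationE.
Qed.

Lemma component_pword n w : (size w <= n)%N ->
  component n (pword w vacuum) = if size w == n then tens w else 0.
Proof.
elim: w n => [|d w IH] n wn; first by rewrite /pword big_nil componentE.
case: n wn => [|n] // wn.
have -> : pword (d :: w) vacuum = poisson d (pword w vacuum).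
  by rewrite /pword big_cons.
have {}wn : (size w <= n)%N by [].
have wn1 : (size w < n.+1)%N by [].
have wn2 : (size w < n.+2)%N by exact: ltnW.
rewrite component_poisson !IH ?(ltnW wn1) ?(ltnW wn2)//.
rewrite (ltn_eqF wn1) (ltn_eqF wn2).
rewrite !fock0 scaler0 !addr0 -[size (d :: w)]/(size w).+1 eqSS.
by case: ifP => _; rewrite ?fock0// creationE.
Qed.

Lemma pword_inj (u : fcomb C D) :
  fcomb_eval pword u = 0 -> wcls (@multilinear _ D) u = 0.
Proof.
have [n] : exists n, all (fun t => size t.2 < n)%N u.
  elim: u => [|t u [n un]]; first by exists 0%N.
  exists (maxn (size t.2).+1 n) => /=; rewrite leq_maxl /=.
  by apply: sub_all un => s sn; rewrite leq_max sn orbT.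
elim: n u => [|n IH] u un u0.
  case: u un {u0} => // _; by rewrite wcls_eval fcomb_eval_nil.
have splitE (W : lmodType C) (M : seq D -> W) : fcomb_eval M u =
    fcomb_eval M [seq t <- u | size t.2 == n] +
    fcomb_eval M [seq t <- u | size t.2 != n].
  by rewrite /fcomb_eval !big_filter [LHS](bigID (fun t => size t.2 == n)).
have evalE (W : lmodType C) (f : {linear fock_alg -> W}) v :
    f (fcomb_eval pword v) = fcomb_eval (f \o pword) v.
  by rewrite /fcomb_eval linear_sum; apply: eq_bigr => t _; rewrite linearZ.
have un0 : wcls (@multilinear _ D) [seq t <- u | size t.2 == n] = 0.
  have ev_lin : linear (fun a : fock_alg => component n (a vacuum)).
    move=> k a b; have -> : (k *: a + b) vacuum = k *: a vacuum + b vacuum by [].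
    by rewrite fockD fockZ.
  pose f : {linear fock_alg -> F} := HB.pack
    (fun a : fock_alg => component n (a vacuum)) (GRing.isLinear.Build _ _ _ _ _ ev_lin).
  have fu := evalE _ f u; rewrite u0 linear0 in fu.
  transitivity (fcomb_eval (f \o pword) u); last exact: esym.
  rewrite wcls_eval /fcomb_eval big_filter big_mkcond.
  elim: u un {u0 splitE fu} => [|t u IHu]; first by rewrite !big_nil.
  move=> /andP[tn un]; rewrite !big_cons -IHu//.
  have -> : (f \o pword) t.2 = if size t.2 == n then tens t.2 else 0.
    by rewrite -component_pword// -ltnS.
  by case: ifP => _; rewrite ?scaler0.
have uN0 : wcls (@multilinear _ D) [seq t <- u | size t.2 != n] = 0.
  apply: IH.
    rewrite all_filter; apply: sub_all un => t /=.
    by rewrite ltnS leq_eqVlt; case: eqP.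
  have /(congr1 (flin_lift pword)) := un0.
  rewrite /flin_lift wlift_cls; last exact: pword_multilinear.
  move=> un'; move: u0; rewrite splitE un'.
  have -> : wlift pword (0 : F) = 0.
    have := wlift_cls [::] pword_multilinear.
    by rewrite wcls_eval !fcomb_eval_nil.
  by rewrite add0r.
by rewrite wcls_eval splitE -!wcls_eval un0 uN0 addr0.
Qed.

(** W with the conjugate scalar action. *)
Definition conj_mod (W : lmodType C) : Type := W.

Section ConjMod.
Variable W : lmodType C.
HB.instance Definition _ := GRing.Zmodule.on (conj_mod W).
Let cscale (k : C) (x : conj_mod W) : conj_mod W := k^* *: (x : W).
Let cscaleA a b x : cscale a (cscale b x) = cscale (a * b) x.
Proof. by rewrite /cscale scalerA rmorphM. Qed.
Let cscale1 : left_id 1 cscale.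
Proof. by move=> x; rewrite /cscale conjC1 scale1r. Qed.
Let cscaleDr : right_distributive cscale +%R.
Proof. by move=> a x y; exact: scalerDr. Qed.
Let cscaleDl x : {morph cscale^~ x : a b / a + b}.
Proof. by move=> a b; rewrite /cscale rmorphD scalerDl. Qed.
HB.instance Definition _ := GRing.Zmodule_isLmodule.Build C (conj_mod W)
  cscaleA cscale1 cscaleDr cscaleDl.
End ConjMod.

Definition word_star (w : seq D) : seq D := rev (map star w).

Definition fcomb_star (u : fcomb C D) : fcomb C D :=
  [seq (t.1^*, word_star t.2) | t <- u].

Definition fcomb_mul (u v : fcomb C D) : fcomb C D :=
  [seq (s.1 * t.1, s.2 ++ t.2) | s <- u, t <- v].

Lemma fcomb_eval_star_eq0 u :
  fcomb_eval pword u = 0 -> fcomb_eval pword (fcomb_star u) = 0.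
Proof.
move=> /pword_inj u0.
pose M : seq D -> conj_mod fock_alg := fun w => pword (word_star w).
have mM : multilinear M.
  move=> w1 w2 a d d'; rewrite /M /word_star !map_cat !rev_cat /= !rev_cons.
  rewrite -!cats1 starD starZ -!catA /=.
  exact: pword_multilinear.
have /(congr1 (flin_lift M)) := u0.
rewrite /flin_lift wlift_cls//.
have -> : wlift M (0 : F) = 0.
  have := wlift_cls [::] mM.
  by rewrite wcls_eval !fcomb_eval_nil.
by move=> <-; rewrite /fcomb_eval big_map.
Qed.

Lemma word_starK : involutive word_star.
Proof. by move=> w; rewrite /word_star map_rev revK mapK//; exact: starK. Qed.

Lemma fcomb_starK : involutive fcomb_star.
Proof.
move=> u; rewrite /fcomb_star -map_comp -[RHS]map_id; apply: eq_map => -[a w] /=.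
by rewrite conjCK word_starK.
Qed.

Lemma fcomb_eval_mul u v :
  fcomb_eval pword (fcomb_mul u v) = fcomb_eval pword u * fcomb_eval pword v.
Proof.
rewrite /fcomb_eval /fcomb_mul big_allpairs_dep mulr_suml; apply: eq_bigr => s _.
rewrite mulr_sumr; apply: eq_bigr => t _ /=.
by rewrite pword_cat -scalerAl -scalerAr scalerA.
Qed.

Lemma fcomb_eval_star_mul u v :
  fcomb_eval pword (fcomb_star (fcomb_mul u v)) =
  fcomb_eval pword (fcomb_star v) * fcomb_eval pword (fcomb_star u).
Proof.
rewrite /fcomb_eval /fcomb_star big_map /fcomb_mul big_allpairs_dep exchange_big.
rewrite !big_map mulr_suml; apply: eq_bigr => t _.
rewrite mulr_sumr; apply: eq_bigr => s _ /=.
rewrite /word_star map_cat rev_cat pword_cat -scalerAl -scalerAr scalerA.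
by rewrite rmorphM mulrC.
Qed.

Lemma adjoint_relP a b : adjoint_rel a b <->
  exists u, a = fcomb_eval pword u /\ b = fcomb_eval pword (fcomb_star u).
Proof.
have pw1 : pword [::] = 1 by rewrite /pword big_nil.
split.
  elim=> [|d|a0 a1 b0 b1 _ [u [-> ->]] _ [v [-> ->]]|k a0 a1 _ [u [-> ->]]
         |a0 a1 b0 b1 _ [u [-> ->]] _ [v [-> ->]]].
  - by exists [:: (1, [::])]; rewrite /fcomb_star /= conjC1 !fcomb_eval1 pw1.
  - exists [:: (1, [:: d])]; rewrite /fcomb_star /= conjC1 !fcomb_eval1.
    by rewrite /pword /word_star /= !big_seq1.
  - by exists (u ++ v); rewrite /fcomb_star map_cat !fcomb_eval_cat.
  - exists [seq (k * t.1, t.2) | t <- u]; rewrite fcomb_eval_scale; split=> //.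
    rewrite -fcomb_eval_scale /fcomb_star -!map_comp; congr fcomb_eval.
    by apply: eq_map => t /=; rewrite rmorphM.
  - by exists (fcomb_mul u v); rewrite fcomb_eval_mul fcomb_eval_star_mul.
move=> [u [-> ->]]; elim: u => [|t u IH].
  rewrite !fcomb_eval_nil -[X in adjoint_rel X](scale0r 1).
  rewrite -[X in adjoint_rel _ X](scale0r 1) -[X in adjoint_rel _ (X *: _)]conjC0.
  exact/adjointZ/adjoint1.
rewrite !fcomb_eval_cons; apply: adjointD => //; apply: adjointZ => /=.
elim: t.2 => [|d w IHw]; first by rewrite /word_star pw1; exact: adjoint1.
rewrite /word_star /= rev_cons -cats1 pword_cat /pword big_cons big_seq1.
exact: adjointM (adjoint_poisson d) IHw.
Qed.

Lemma adjoint_unique a b b' : adjoint_rel a b -> adjoint_rel a b' -> b = b'.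
Proof.
move=> /adjoint_relP[u [au ->]] /adjoint_relP[v [av ->]].
pose v' : fcomb C D := [seq (-1 * t.1, t.2) | t <- v].
have /fcomb_eval_star_eq0 : fcomb_eval pword (u ++ v') = 0.
  by rewrite fcomb_eval_cat fcomb_eval_scale -au -av scaleN1r subrr.
rewrite /fcomb_star map_cat fcomb_eval_cat -/(fcomb_star u).
have -> : [seq (t.1^*, word_star t.2) | t <- v'] =
    [seq (-1 * t.1, t.2) | t <- fcomb_star v].
  rewrite /v' /fcomb_star -!map_comp; apply: eq_map => t /=.
  by rewrite rmorphM rmorphN /= conjC1.
by rewrite fcomb_eval_scale scaleN1r => /subr0_eq.
Qed.

Lemma fock_alg_span (a : fock_alg) : exists u, a = fcomb_eval pword u.
Proof.
case: a => a ga; have /asboolP := ga.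
suff gen b : subalg_gen (range (poisson_op psi)) b ->
    exists u, b = (fcomb_eval pword u : fock_alg).
  by move=> /gen[u au]; exists u; exact/val_inj.
elim=> [_ [d _ <-]||b0 b1 _ [u ->] _ [v ->]|k b0 _ [u ->]|b0 b1 _ [u ->] _ [v ->]].
- by exists [:: (1, [:: d])]; rewrite fcomb_eval1 /pword big_seq1.
- by exists [:: (1, [::])]; rewrite fcomb_eval1 /pword big_nil.
- by exists (u ++ v); rewrite fcomb_eval_cat.
- by exists [seq (k * t.1, t.2) | t <- u]; rewrite fcomb_eval_scale.
- by exists (fcomb_mul u v); rewrite fcomb_eval_mul.
Qed.

Lemma fock_starP a : adjoint_rel a (fock_star a).
Proof.
have [u au] := fock_alg_span a.
have : adjoint_rel a (fcomb_eval pword (fcomb_star u)).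
  by apply/adjoint_relP; exists u.
by move=> ab; apply: (xgetPex 0); exists (fcomb_eval pword (fcomb_star u)).
Qed.

Lemma fock_starE a b : adjoint_rel a b -> fock_star a = b.
Proof. exact: adjoint_unique (fock_starP a). Qed.

Lemma adjoint_sym a b : adjoint_rel a b -> adjoint_rel b a.
Proof.
move=> /adjoint_relP[u [-> ->]]; apply/adjoint_relP.
by exists (fcomb_star u); rewrite fcomb_starK.
Qed.

Let fock_starK : involutive fock_star.
Proof. by move=> a; apply/fock_starE/adjoint_sym/fock_starP. Qed.
Let fock_starD : {morph fock_star : x y / x + y}.
Proof. by move=> a b; apply/fock_starE/adjointD; exact: fock_starP. Qed.
Let fock_starZ (k : C) a : fock_star (k *: a) = k^* *: fock_star a.
Proof. exact/fock_starE/adjointZ/fock_starP. Qed.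
Let fock_starM a b : fock_star (a * b) = fock_star b * fock_star a.
Proof. by apply/fock_starE/adjointM; exact: fock_starP. Qed.

HB.instance Definition _ := hasStar.Build R fock_alg
  fock_starK fock_starD fock_starZ fock_starM.

Lemma star_poisson d : star (poisson d) = poisson (star d).
Proof. exact/fock_starE/adjoint_poisson. Qed.

Definition fock_phi (a : fock_alg) : C := flin_inner psi (a vacuum) vacuum.

Definition fock_rho (a b : fock_alg) : C :=
  fcyc_inner psi (cmap psi (a vacuum)) (cmap psi (star b vacuum)).

End FockAlgebra.

Arguments fock_phi {R D} psi a.
Arguments fock_rho {R D} psi a b.

Section SecondOrder.
Variables (R : rcfType) (A : algType R[i]).
Local Notation C := R[i].
Variables (phi : A -> C) (rho : A -> A -> C).

Record second_order_space : Prop := SecondOrderSpace {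
  so_phi_linear : scalar phi;
  so_phi1 : phi 1 = 1;
  so_phi_tracial : forall a b, phi (a * b) = phi (b * a);
  so_rho_linearl : forall b, scalar (rho^~ b);
  so_rho_linearr : forall a, scalar (rho a);
  so_rho_traciall : forall a b c, rho (a * b) c = rho (b * a) c;
  so_rho_tracialr : forall a b c, rho c (a * b) = rho c (b * a);
  so_rho_1r : forall a, rho a 1 = 0;
  so_rho_1l : forall b, rho 1 b = 0
}.

Variables (I : eqType) (B : I -> set A).

Definition centered n (a : 'I_n -> A) : Prop := forall k, phi (a k) = 0.

Definition alternating n (a : 'I_n -> A) : Prop :=
  exists i : 'I_n -> I, (forall k, B (i k) (a k)) /\
    (forall k l : 'I_n, l = k.+1 :> nat -> i k != i l).

(** [ordS k] is k + 1 modulo n. *)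
Definition cyclically_alternating n (a : 'I_n -> A) : Prop :=
  exists i : 'I_n -> I, (forall k, B (i k) (a k)) /\
    ((2 <= n)%N -> forall k : 'I_n, i k != i (ordS k)).

Definition free_first_order : Prop :=
  forall n (a : 'I_n.+1 -> A), centered a -> alternating a ->
    phi (\prod_(k < n.+1) a k) = 0.

(** With indices running from 0 to n, the j-th factor a_{j+1} b_{(n+1)-j+k}
    of the paired product has index n - j + k modulo n + 1 for b. *)
Definition free_second_order : Prop :=
  [/\ free_first_order,
      forall n m (a : 'I_n.+1 -> A) (b : 'I_m.+1 -> A),
        centered a -> cyclically_alternating a ->
        centered b -> cyclically_alternating b -> n != m ->
        rho (\prod_(k < n.+1) a k) (\prod_(k < m.+1) b k) = 0,
      forall i j a b, i != j -> B i a -> B j b -> rho a b = 0 &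
      forall n (a b : 'I_n.+1 -> A), (1 <= n)%N ->
        centered a -> cyclically_alternating a ->
        centered b -> cyclically_alternating b ->
        rho (\prod_(k < n.+1) a k) (\prod_(k < n.+1) b k) =
        \sum_(k < n.+1) \prod_(j < n.+1) phi (a j * b (inord ((n - j + k) %% n.+1)))].

End SecondOrder.

Section RandomVariables.
Variables (R : realType) (d : measure_display) (T : measurableType d).
Variable P : probability T R.
Local Notation C := R[i].

(** Only meaningful for integrable Z, as [fine] sends infinities to 0; the
    entries of Gaussian matrices have moments of all orders. *)
Definition complex_expectation (Z : T -> C) : C :=
  (fine 'E_P[fun t => complex.Re (Z t)] +i* fine 'E_P[fun t => complex.Im (Z t)])%C.

(** The r-th classical cumulant, by Moebius inversion on set partitions:
    k_r(Z_1, ..., Z_r) = sum over the partitions pi of {1, ..., r} of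
    (-1)^{|pi|-1} (|pi|-1)! prod_{V in pi} E[prod_{i in V} Z_i]. *)
Definition cumulant (r : nat) (Z : r.-tuple (T -> C)) : C :=
  \sum_(pi : {set {set 'I_r}} | finset.partition pi [set: 'I_r]%SET)
    (-1) ^+ #|pi|.-1 * (#|pi|.-1)`!%:R *
    \prod_(V in pi) complex_expectation (fun t => \prod_(i in V) tnth Z i t).

Definition re_im (Z : T -> C) (t : T) : R * R :=
  (complex.Re (Z t), complex.Im (Z t)).

(** Centered circularly symmetric Gaussian of variance v = E|Z|^2: the real
    and imaginary parts are independent, each with law N(0, v/2); the second
    parameter of [normal_prob] is the standard deviation. *)
Definition complex_gaussian (v : R) (Z : T -> C) : Prop :=
  measurable_fun setT (re_im Z) /\
  forall B : set (R * R), measurable B ->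
    P (re_im Z @^-1` B) =
    (normal_prob 0 (Num.sqrt (v / 2)) \x normal_prob 0 (Num.sqrt (v / 2)))%E B.

(** Taking B i = setT for some i gives the product rule for subfamilies. *)
Definition independent_family (I : finType) (Z : I -> T -> C) : Prop :=
  forall B : I -> set (R * R), (forall i, measurable (B i)) ->
    P [set t | forall i, B i (re_im (Z i) t)] =
    (\prod_(i : I) P (re_im (Z i) @^-1` B i))%E.

Definition gaussian_random_matrix (n : nat) (X : T -> 'M[C]_n) : Prop :=
  (forall i j, complex_gaussian (n%:R^-1) (fun t => X t i j)) /\
  independent_family (fun (ij : 'I_n * 'I_n) t => X t ij.1 ij.2).

End RandomVariables.

(** A sequence of matrices has size N.+1 at rank N; limits in C are for the
    norm topology. *)
Section Limits.
Variable R : realType.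
Local Notation C := R[i].

Definition ccvg (u : nat -> C) (l : C) : Prop :=
  (u : nat -> C^o) N @[N --> \oo] --> (l : C^o).

Definition ntr (N : nat) (M : 'M[C]_N.+1) : C := N.+1%:R^-1 * \tr M.

Definition converges_in_distribution (D : algType C) (psi : D -> C) (s : nat)
  (M : forall N, 'I_s -> 'M[C]_N.+1) (a : 'I_s -> D) : Prop :=
  forall w : seq 'I_s,
    ccvg (fun N => ntr (\prod_(i <- w) M N i)) (psi (\prod_(i <- w) a i)).

Variable disp : nat -> measure_display.
Variable T : forall N, measurableType (disp N).
Variable P : forall N, probability (T N) R.

Definition second_order_limit (s : nat)
  (M : forall N, 'I_s -> T N -> 'M[C]_N.+1)
  (A : algType C) (phi : A -> C) (rho : A -> A -> C) (a : 'I_s -> A) : Prop :=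
  let q_of N (q : ncpoly C s) (t : T N) := nceval (fun i => M N i t) q in
  [/\ second_order_space phi rho,
      forall q : ncpoly C s,
        ccvg (fun N => cumulant (P N) [tuple (fun t => ntr (q_of N q t))])
             (phi (nceval a q)),
      forall q1 q2 : ncpoly C s,
        ccvg (fun N => cumulant (P N)
                [tuple (fun t => \tr (q_of N q1 t)); (fun t => \tr (q_of N q2 t))])
             (rho (nceval a q1) (nceval a q2)) &
      forall (r : nat) (q : r.-tuple (ncpoly C s)), (3 <= r)%N ->
        ccvg (fun N => cumulant (P N) (map_tuple (fun q' t => \tr (q_of N q' t)) q))
             0].

Definition generated_subalgs (s : nat) (A : algType C) (a : 'I_s -> A)
  (i : 'I_s) : set A := subalg_gen [set a i].

Definition asymptotically_free_second_order (s : nat)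
  (M : forall N, 'I_s -> T N -> 'M[C]_N.+1) : Prop :=
  exists (A : algType C) (phi : A -> C) (rho : A -> A -> C) (a : 'I_s -> A),
    second_order_limit M phi rho a /\
    free_second_order phi rho (generated_subalgs a).

End Limits.

Definition compound_wishart (R : rcfType) (T : Type) (n : nat)
  (X : T -> 'M[R[i]]_n) (M : 'M[R[i]]_n) (t : T) : 'M[R[i]]_n :=
  (map_mx Num.conj (X t))^T *m M *m X t.

(* Main.v *)
Require Import Defs.
From mathcomp Require Import all_boot all_order all_algebra.
From mathcomp Require Import complex.
From mathcomp Require Import all_classical all_reals all_analysis measurable_realfun.
From mathcomp Require Import zify ring.
From HB Require Import structures.
Set Implicit Arguments.
Unset Strict Implicit.
Unset Printing Implicit Defensive.
Import Order.TTheory GRing.Theory Num.Theory numFieldNormedType.Exports.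
Local Open Scope classical_set_scope.
Local Open Scope ring_scope.

(** The cumulants of the traces Tr P_N(w), for words w in the matrices
    X^* D X, satisfy a recursion that survives in the limit and coincides with
    the recursion for the vacuum state and the covariance on the Fock space.

    On the random matrix side, Gaussian integration by parts removes a matrix X
    and expresses n E[Tr P_N(l w) ...] through moments of products of traces
    with one letter less: the letter l is closed by its trace, or it is merged
    with a letter of the same trace, which then splits into two, or with a
    letter of another trace, which then joins the first
    ([trace_moment_loop]).  Moments are the convolution of cumulants with
    moments ([moment_cumulant]), so the moments cancel and the cumulants satisfy
    a similar recursion ([trace_cumulant_loop]).  Rescaled by n^(r - 2), the
    cumulant of r traces converges, by induction on the number of letters
    ([scaled_cumulant_ccvg]); hence the cumulants of three or more traces vanish
    in the limit.  Integration by parts follows from Stein's identity for the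
    normal law and from the independence of the real and imaginary parts of the
    entries ([stein], [integral_prod], [integration_by_parts]).

    On the Fock space side, let xi(w) = p(d_1) ... p(d_n) Omega for a word
    w = (d_1, ..., d_n).  Expanding p(d) on the left gives the recursion
    [wphi_cons] for <xi(dw), Omega>.  The covariance is governed by c xi(w): its
    image under the adjoint of the projection onto cyclic tensors is the sum
    over the rotations of w of the vectors whose first letter stays open
    ([rotsum_cxi]).  This makes c xi(w) invariant under rotations of w, hence the
    covariance tracial ([cxi_catC], [fock_second_order_space]), and yields the
    recursion [wrho_cons].  The limits of the cumulants of one and of two traces
    are thus the vacuum state and the covariance ([limit_cumulant1],
    [limit_cumulant2]), and multilinearity extends this to polynomials.

    If d_i d_j = 0 for i <> j, then the vectors a Omega of centered elements a of
    the algebras A_i are combinations of tensors of powers of one d_i, and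
    alternating products of such elements act by concatenation; the conditions
    of freeness reduce to an inner product of words that are cut into runs of
    equal colours ([fock_free]). *)

(** * Sums over the ways of cutting a word at a letter *)

Section SplitSum.
Variable X : Type.
Implicit Types w u v : seq X.

Fixpoint split_sum (V : nmodType) (F : seq X -> X -> seq X -> V) w : V :=
  if w is y :: w' then F [::] y w' + split_sum (fun u => F (y :: u)) w' else 0.

Lemma eq_split_sum_in (V : nmodType) (F G : seq X -> X -> seq X -> V) w :
  (forall u y v, w = u ++ y :: v -> F u y v = G u y v) ->
  split_sum F w = split_sum G w.
Proof.
elim: w F G => //= y w IH F G FG; rewrite (FG [::])//; congr (_ + _).
by apply: IH => u z v wE; apply: FG; rewrite wE.
Qed.

Lemma eq_split_sum (V : nmodType) (F G : seq X -> X -> seq X -> V) w :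
  (forall u y v, F u y v = G u y v) -> split_sum F w = split_sum G w.
Proof. by move=> FG; apply: eq_split_sum_in => u y v _. Qed.

Lemma split_sum0 (V : nmodType) w : split_sum (fun _ _ _ => 0 : V) w = 0.
Proof. by elim: w => //= y w ->; rewrite addr0. Qed.

Lemma split_sum_const (V : nmodType) (x : V) w :
  split_sum (fun _ _ _ => x) w = x *+ size w.
Proof. by elim: w => //= y w ->; rewrite mulrS. Qed.

Lemma split_sumD (V : nmodType) (F G : seq X -> X -> seq X -> V) w :
  split_sum (fun u y v => F u y v + G u y v) w = split_sum F w + split_sum G w.
Proof. by elim: w F G => [|y w IH] F G /=; rewrite ?addr0// IH addrACA. Qed.

Lemma raddf_split_sum (V W : nmodType) (f : {additive V -> W}) F w :
  f (split_sum F w) = split_sum (fun u y v => f (F u y v)) w.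
Proof. by elim: w F => [|y w IH] F /=; rewrite ?raddf0// raddfD IH. Qed.

Lemma sum_split_sum (V : nmodType) (I : Type) (r : seq I)
    (F : I -> seq X -> X -> seq X -> V) w :
  \sum_(i <- r) split_sum (F i) w =
  split_sum (fun u y v => \sum_(i <- r) F i u y v) w.
Proof.
elim: w F => [|y w IH] F /=; first by rewrite big1.
by rewrite big_split IH.
Qed.

Lemma scaler_split_sum (K : pzRingType) (V : lmodType K) (k : K) F w :
  k *: split_sum (V := V) F w = split_sum (fun u y v => k *: F u y v) w.
Proof. by elim: w F => [|y w IH] F /=; rewrite ?scaler0// scalerDr IH. Qed.

Lemma mulr_split_suml (K : pzRingType) (k : K) F w :
  split_sum (V := K) F w * k = split_sum (fun u y v => F u y v * k) w.
Proof. by elim: w F => [|y w IH] F /=; rewrite ?mul0r// mulrDl IH. Qed.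

Lemma mulr_split_sumr (K : pzRingType) (k : K) F w :
  k * split_sum (V := K) F w = split_sum (fun u y v => k * F u y v) w.
Proof. by elim: w F => [|y w IH] F /=; rewrite ?mulr0// mulrDr IH. Qed.

Lemma scaler_split_suml (K : pzRingType) (V : lmodType K) (x : V) F w :
  split_sum (V := K) F w *: x = split_sum (fun u y v => F u y v *: x) w.
Proof. by elim: w F => [|y w IH] F /=; rewrite ?scale0r// scalerDl IH. Qed.

Lemma split_sum_cat (V : nmodType) (F : seq X -> X -> seq X -> V) a b :
  split_sum F (a ++ b) = split_sum (fun u y v => F u y (v ++ b)) a +
                         split_sum (fun u y v => F (a ++ u) y v) b.
Proof.
elim: a F => [|y a IH] F /=; first by rewrite add0r.
by rewrite IH addrA.
Qed.

Lemma split_sum_rcons (V : nmodType) (F : seq X -> X -> seq X -> V) w x :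
  split_sum F (rcons w x) =
  split_sum (fun u y v => F u y (rcons v x)) w + F w x [::].
Proof.
rewrite -cats1 split_sum_cat /= addr0 cats0; congr (_ + _).
by apply: eq_split_sum => u y v; rewrite cats1.
Qed.

Lemma split_sum_rev (V : nmodType) (F : seq X -> X -> seq X -> V) w :
  split_sum F (rev w) = split_sum (fun u y v => F (rev v) y (rev u)) w.
Proof.
elim: w F => // y w IH F; rewrite rev_cons split_sum_rcons IH /= addrC.
by congr (_ + _); apply: eq_split_sum => u z v; rewrite rev_cons.
Qed.

(** Cutting at two letters: the later one first, or the earlier one first. *)
Lemma split_sum_split (V : nmodType)
    (F : seq X -> X -> seq X -> X -> seq X -> V) w :
  split_sum (fun u y v => split_sum (fun u1 z u2 => F u1 z u2 y v) u) w =
  split_sum (fun u z v => split_sum (fun v1 y v2 => F u z v1 y v2) v) w.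
Proof.
elim: w F => //= x w IH F; rewrite add0r -(IH (fun u => F (x :: u))).
by rewrite -split_sumD.
Qed.

Lemma big_rot (V : nmodType) (f : seq X -> V) w :
  \sum_(k < size w) f (rot k w) = split_sum (fun u y v => f (y :: v ++ u)) w.
Proof.
suff gen a : \sum_(k < size w) f (drop k w ++ a ++ take k w) =
    split_sum (fun u y v => f (y :: v ++ a ++ u)) w by exact: (gen [::]).
elim: w a => [|x w IH] a /=; first by rewrite big_ord0.
rewrite big_ord_recl /= cats0; congr (_ + _).
transitivity (split_sum (fun u y v => f (y :: v ++ rcons a x ++ u)) w).
  by rewrite -IH; apply: eq_bigr => k _ /=; rewrite cat_rcons.
by apply: eq_split_sum => u y v; rewrite cat_rcons.
Qed.

End SplitSum.

Lemma split_sum_map (V : nmodType) (X Y : Type) (f : Y -> X) F (w : seq Y) :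
  split_sum (V := V) F (map f w) =
  split_sum (fun u y v => F (map f u) (f y) (map f v)) w.
Proof. by elim: w F => //= y w IH F; rewrite IH. Qed.

(** * First order: the vacuum state on words *)

Section LinearMaps.
Variables (K : pzRingType) (V W : lmodType K) (f : V -> W).
Hypothesis lf : linear f.

Lemma linear_add x y : f (x + y) = f x + f y.
Proof. by rewrite -[x]scale1r lf !scale1r. Qed.
Lemma linear_zero : f 0 = 0.
Proof. by have := lf (-1) 0 0; rewrite scaler0 add0r scaleN1r addNr. Qed.
Lemma linear_scale k x : f (k *: x) = k *: f x.
Proof. by rewrite -[k *: x]addr0 lf linear_zero addr0. Qed.
Lemma linear_split_sum X F (w : seq X) :
  f (split_sum F w) = split_sum (fun u y v => f (F u y v)) w.
Proof. by elim: w F => [|y w IH] F /=; rewrite ?linear_zero// linear_add IH. Qed.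

End LinearMaps.

Lemma linear_scaler (K : comPzRingType) (V : lmodType K) (k : K) :
  linear ( *:%R k : V -> V).
Proof. by move=> a x y; rewrite scalerDr !scalerA mulrC. Qed.

Lemma linear_addfun (K : comPzRingType) (V W : lmodType K) (f g : V -> W) :
  linear f -> linear g -> linear (fun x => f x + g x).
Proof. by move=> lf lg a x y; rewrite lf lg scalerDr addrACA. Qed.

Lemma linear_subfun (K : comPzRingType) (V W : lmodType K) (f g : V -> W) :
  linear f -> linear g -> linear (fun x => f x - g x).
Proof. by move=> lf lg a x y; rewrite lf lg scalerBr opprD addrACA. Qed.

Lemma linear_scalefun (K : comPzRingType) (V W : lmodType K) (f : V -> W) k :
  linear f -> linear (fun x => k *: f x).
Proof. by move=> lf a x y; rewrite lf scalerDr !scalerA mulrC. Qed.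

Lemma rotation_sum_multilinear (K : nzRingType) (V W : lmodType K) (M : seq V -> W) :
  multilinear M -> multilinear (split_sum (fun u y v => M (y :: v ++ u))).
Proof.
move=> mM w1 w2 a x x'; rewrite !split_sum_cat /= (mM [::]) !scalerDr.
have e1 : split_sum (fun u y v => M (y :: (v ++ a *: x + x' :: w2) ++ u)) w1 =
  a *: split_sum (fun u y v => M (y :: (v ++ x :: w2) ++ u)) w1 +
  split_sum (fun u y v => M (y :: (v ++ x' :: w2) ++ u)) w1.
  rewrite scaler_split_sum -split_sumD; apply: eq_split_sum => u y v.
  by rewrite -!catA -!cat_cons mM.
have e2 : split_sum (fun u y v => M (y :: v ++ w1 ++ a *: x + x' :: u)) w2 =
  a *: split_sum (fun u y v => M (y :: v ++ w1 ++ x :: u)) w2 +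
  split_sum (fun u y v => M (y :: v ++ w1 ++ x' :: u)) w2.
  rewrite scaler_split_sum -split_sumD; apply: eq_split_sum => u y v.
  by rewrite !catA -!cat_cons mM.
by rewrite e1 e2 [LHS](AC (2*(2*2)) ((1*(3*5))*(2*(4*6)))).
Qed.

Section FlinMaps.
Variables (K : nzRingType) (D : lmodType K).

Lemma flin_ext (W : lmodType K) (f g : flin D -> W) : linear f -> linear g ->
  (forall w, f (tens w) = g (tens w)) -> f =1 g.
Proof.
move=> lf lg fg.
pose f' : {linear flin D -> W} := HB.pack f (GRing.isLinear.Build _ _ _ _ f lf).
pose g' : {linear flin D -> W} := HB.pack g (GRing.isLinear.Build _ _ _ _ g lg).
exact: (@wlift_unique _ _ _ _ f' g').
Qed.

End FlinMaps.

Section VacuumState.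
Variables (R : rcfType) (D : starAlgType R) (psi : tracial_state D).
Local Notation C := R[i].
Local Notation F := (flin D).
Implicit Types (d e x y z : D) (u v w : seq D) (s t : F).

Local Arguments fock_fun : simpl never.
Let opD (a : fock_op D) s t : a (s + t) = a s + a t. Proof. exact: (linearD a). Qed.
Let opZ (a : fock_op D) k t : a (k *: t) = k *: a t. Proof. by rewrite linearZ. Qed.
Let op0 (a : fock_op D) : a 0 = 0. Proof. exact: (linear0 a). Qed.

(** [contraction d] is l^*(d^* ), so that p(d) is the sum of [opening d],
    [contraction d] and the scalar psi(d). *)
Definition opening d : fock_op D := locked (creation d + preservation d).
Definition contraction d : fock_op D := locked (annihilation psi (star d)).
Definition pois d : fock_op D := locked (poisson_op psi d).

Lemma pois_split d t : pois d t = opening d t + contraction d t + psi d *: t.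
Proof.
rewrite /pois /opening /contraction -!lock poisson_opE; congr (_ + _).
by rewrite -addrA [annihilation _ _ _ + _]addrC addrA.
Qed.

Lemma contraction_vacuum d : contraction d vacuum = 0.
Proof. by rewrite /contraction -lock annihilation_vacuum. Qed.
Lemma contractionE d f w :
  contraction d (tens (f :: w)) = psi (d * f) *: tens w.
Proof. by rewrite /contraction -lock annihilationE /inner starK. Qed.
Lemma opening_vacuum d : opening d vacuum = tens [:: d].
Proof.
by rewrite /opening -lock fock_addE creationE preservation_vacuum addr0.
Qed.
Lemma openingE d f w :
  opening d (tens (f :: w)) = tens (d :: f :: w) + tens (d * f :: w).
Proof. by rewrite /opening -lock fock_addE creationE preservationE. Qed.

Lemma contraction_opening d e t :
  contraction d (opening e t) = psi (d * e) *: t + contraction (d * e) t.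
Proof.
move: t; apply: flin_ext => [a x y|a x y|[|f w]].
- by rewrite !linearP.
- by rewrite [contraction _ _]linearP scalerDr [in RHS]scalerDr addrACA !scalerA mulrC.
- by rewrite opening_vacuum contractionE contraction_vacuum addr0.
- by rewrite openingE opD !contractionE mulrA.
Qed.

Fixpoint poisson_act w t : F :=
  if w is d :: w' then pois d (poisson_act w' t) else t.
Definition xi w : F := poisson_act w vacuum.

Lemma poisson_act_linear w : linear (poisson_act w).
Proof. by elim: w => //= d w IH a s t; rewrite IH opD opZ. Qed.
HB.instance Definition _ w :=
  GRing.isLinear.Build C F F *:%R (poisson_act w) (poisson_act_linear w).

Lemma poisson_act_cat u v t :
  poisson_act (u ++ v) t = poisson_act u (poisson_act v t).
Proof. by elim: u => //= d u ->. Qed.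

Lemma xi_cons d w : xi (d :: w) = pois d (xi w). Proof. by []. Qed.

Lemma pword_act w t : pword psi w t = poisson_act w t.
Proof.
by elim: w => [|d w IH]; rewrite /pword ?big_nil// big_cons /= -IH /pois -lock.
Qed.

Definition vac t : C := flin_inner psi t vacuum.
Lemma vac_linear : scalar vac. Proof. exact: flin_inner_linear. Qed.
HB.instance Definition _ := GRing.isLinear.Build C F C *%R vac vac_linear.

Let vacD s t : vac (s + t) = vac s + vac t. Proof. exact: (linearD vac). Qed.
Let vacZ k t : vac (k *: t) = k * vac t. Proof. exact: (linearZ_LR vac). Qed.

Lemma vac_tens w : vac (tens w) = (w == [::])%:R.
Proof. by rewrite /vac flin_inner_tens; case: w. Qed.

Definition wphi w : C := vac (xi w).

Lemma wphi_nil : wphi [::] = 1. Proof. exact: vac_tens. Qed.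

Lemma fock_phi_pword w : fock_phi psi (pword psi w) = wphi w.
Proof. by rewrite /fock_phi pword_act. Qed.

Lemma vac_opening d t : vac (opening d t) = 0.
Proof.
move: t; apply: (@flin_ext _ _ C^o) => [a x y|a x y|[|f w]].
- by rewrite !linearP.
- by rewrite scaler0 addr0.
- by rewrite opening_vacuum vac_tens.
- by rewrite openingE vacD !vac_tens addr0.
Qed.

Lemma vac_pois d t :
  vac (pois d t) = vac (contraction d t) + psi d * vac t.
Proof. by rewrite pois_split !vacD vacZ vac_opening add0r. Qed.

(** Contracting the leading vector of xi(w) with d: the vector was opened at
    some letter y of w and the letters u before y filled the block of y. *)
Lemma contraction_xi d w :
  contraction d (xi w) = split_sum (fun u y v => wphi (y * d :: u) *: xi v) w.
Proof.
have [n] := ubnP (size w); elim: n d w => // n IH d [|e w] /=.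
  by rewrite contraction_vacuum.
rewrite ltnS => wn.
rewrite xi_cons pois_split !opD opZ contraction_opening (IH _ w)//.
have phi_pair x u : (size u < n)%N -> wphi (x :: e :: u) =
    wphi (x * e :: u) + psi e * wphi (x :: u) +
    split_sum (fun u1 z u2 => wphi (z * e :: u1) * wphi (x :: u2)) u.
  move=> un; rewrite /wphi !xi_cons [pois e _]pois_split IH//.
  rewrite !opD opZ !vacD vacZ !raddf_split_sum /= addrAC; congr (_ + _ + _).
  - by rewrite !vac_pois contraction_opening vacD vacZ vac_opening mulr0 addr0 addrC.
  - by apply: eq_split_sum => u1 z u2; rewrite opZ vacZ.
have -> : wphi [:: e * d] = psi (d * e).
  rewrite /wphi xi_cons vac_pois contraction_vacuum linear0 add0r vac_tens mulr1.
  exact: state_tracial.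
rewrite -!addrA; congr (_ + _).
rewrite (@eq_split_sum_in _ _ (fun u y v => wphi (y * d :: e :: u) *: xi v)
  (fun u y v => wphi (y * d * e :: u) *: xi v +
    (psi e *: (wphi (y * d :: u) *: xi v) +
    split_sum (fun u1 z u2 => wphi (z * e :: u1) *: (wphi (y * d :: u2) *: xi v)) u))).
  rewrite !split_sumD -scaler_split_sum -(IH d w)//.
  congr (_ + _); first by apply: eq_split_sum => u y v; rewrite mulrA.
  rewrite addrC; congr (_ + _).
  rewrite split_sum_split (IH e w)// raddf_split_sum /=.
  apply: eq_split_sum_in => u z v wE; rewrite opZ IH ?scaler_split_sum//.
  by move: wn; rewrite wE size_cat /=; lia.
move=> u y v wE; rewrite phi_pair; last first.
  by move: wn; rewrite wE size_cat /=; lia.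
rewrite !scalerDl scalerA addrA scaler_split_suml.
by congr (_ + _); apply: eq_split_sum => *; rewrite scalerA.
Qed.

Lemma pois_xi d w : xi (d :: w) =
  opening d (xi w) + psi d *: xi w +
  split_sum (fun u y v => wphi (y * d :: u) *: xi v) w.
Proof. by rewrite xi_cons pois_split contraction_xi -addrA [_ + psi d *: _]addrC addrA. Qed.

(** The letter d is a block of its own, or y is the last letter of its block; the
    letters v after y are then separate from those before y. *)
Lemma wphi_cons d w : wphi (d :: w) = psi d * wphi w +
  split_sum (fun u y v => wphi (y * d :: u) * wphi v) w.
Proof.
rewrite [LHS]/wphi pois_xi !vacD vacZ vac_opening add0r.
by rewrite raddf_split_sum; congr (_ + _); apply: eq_split_sum => *; rewrite /= vacZ.
Qed.

Lemma wphi_pair x e w : wphi (x :: e :: w) =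
  wphi (x * e :: w) + psi e * wphi (x :: w) +
  split_sum (fun u y v => wphi (y * e :: u) * wphi (x :: v)) w.
Proof.
rewrite {1}/wphi; have -> : xi (x :: e :: w) = pois x (xi (e :: w)) by [].
rewrite pois_xi !opD opZ !vacD vacZ !raddf_split_sum /=; congr (_ + _ + _).
- by rewrite /wphi !xi_cons !vac_pois contraction_opening vacD vacZ vac_opening mulr0 addr0 addrC.
- by apply: eq_split_sum => *; rewrite opZ vacZ.
Qed.

(** Both sides have the same expansion, along the letter after d: the
    recursion [wphi_pair] treats the word (d, e, w) as [wphi_cons] treats the
    word (e, w, d). *)
Lemma wphi_rcons d w : wphi (rcons w d) = wphi (d :: w).
Proof.
have [n] := ubnP (size w); elim: n d w => // n IH d [|e w] //= wn.
rewrite wphi_cons wphi_pair split_sum_rcons IH// wphi_nil mulr1.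
rewrite (@eq_split_sum_in _ _ _ (fun u y v => wphi (y * e :: u) * wphi (d :: v))).
  by ring.
by move=> u y v wE; rewrite IH//; move: wn; rewrite wE size_cat /=; lia.
Qed.

Lemma wphi_catC u v : wphi (u ++ v) = wphi (v ++ u).
Proof.
elim: u v => [|d u IH] v; first by rewrite cats0.
by rewrite cat_cons -wphi_rcons -cats1 -catA cats1 IH -cats1 -catA.
Qed.

End VacuumState.

(** * Second order: the cyclic Fock space *)

Section CyclicWords.
Variables (R : rcfType) (D : starAlgType R) (psi : tracial_state D).
Local Notation C := R[i].
Local Notation F := (flin D).
Local Notation pois := (pois psi).
Local Notation contraction := (contraction psi).
Local Notation pact := (poisson_act psi).
Local Notation xi := (xi psi).
Local Notation vac := (vac psi).
Local Notation wphi := (wphi psi).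
Local Notation cmap := (cmap psi).
Implicit Types (d e x y z : D) (u v w : seq D) (s t : F).

Local Arguments fock_fun : simpl never.
Let opD (a : fock_op D) s t : a (s + t) = a s + a t. Proof. exact: (linearD a). Qed.
Let opZ (a : fock_op D) k t : a (k *: t) = k *: a t. Proof. by rewrite linearZ. Qed.
Let opN (a : fock_op D) t : a (- t) = - a t. Proof. exact: (linearN a). Qed.
Let op0 (a : fock_op D) : a 0 = 0. Proof. exact: (linear0 a). Qed.
Let vacD s t : vac (s + t) = vac s + vac t. Proof. exact: (linearD vac). Qed.
Let vacZ k t : vac (k *: t) = k * vac t. Proof. exact: (linearZ_LR vac). Qed.
Let cmapD s t : cmap (s + t) = cmap s + cmap t. Proof. exact: (linearD cmap). Qed.
Let cmapZ k t : cmap (k *: t) = k *: cmap t. Proof. exact: (linearZ_LR cmap). Qed.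

Definition cproj : F -> fcyc D := flin_lift (@cyc _ D).
Lemma cproj_linear : linear cproj.
Proof. by apply: flin_lift_linear; case: (@cyc_multilinear _ D). Qed.
HB.instance Definition _ := GRing.isLinear.Build C F (fcyc D) *:%R cproj cproj_linear.
Let cprojD s t : cproj (s + t) = cproj s + cproj t. Proof. exact: (linearD cproj). Qed.
Let cprojZ k t : cproj (k *: t) = k *: cproj t. Proof. exact: (linearZ_LR cproj). Qed.

Lemma cproj_tens w : cproj (tens w) = cyc w.
Proof. by apply: flin_lift_tens; case: (@cyc_multilinear _ D). Qed.

(** ** Closing the last leg *)

(** For A linear in both arguments, [closing A d] maps t to the alternating
    sum, over the last legs y_n, y_(n-1), ... of t, of A at the product
    y_(n-k) ... y_n d and at the tensor of the remaining legs. *)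
Section Closing.
Variable V : lmodType C.
Implicit Types A : D -> F -> V.

Definition bilinear_family A : Prop :=
  (forall x, linear (A x)) /\ (forall t, linear (A^~ t)).

Fixpoint closing_rev A d w : V :=
  if w is y :: w' then A (y * d) (tens (rev w')) - closing_rev A (y * d) w' else 0.

Definition closing A d : F -> V := flin_lift (fun w => closing_rev A d (rev w)).

Lemma closing_rev_linear A w : bilinear_family A -> linear (closing_rev A ^~ w).
Proof.
move=> [_ A2]; elim: w => [|y w IH] a d e /=; first by rewrite scaler0 addr0.
rewrite mulrDr -scalerAr IH A2 scalerBr opprD.
by rewrite !addrA; congr (_ + _); rewrite -!addrA; congr (_ + _); rewrite addrC.
Qed.

Lemma closing_rev_multilinear A d : bilinear_family A -> multilinear (closing_rev A d).
Proof.
move=> bA w1; elim: w1 d => [|y w1 IH] d w2 a x x' /=.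
  rewrite mulrDl -scalerAl closing_rev_linear//; case: bA => _ ->.
  rewrite scalerBr opprD.
  by rewrite !addrA; congr (_ + _); rewrite -!addrA; congr (_ + _); rewrite addrC.
rewrite IH; case: bA => A1 _.
rewrite !rev_cat !rev_cons -!cats1 -!catA /= tens_multilinear A1 scalerBr opprD.
by rewrite !addrA; congr (_ + _); rewrite -!addrA; congr (_ + _); rewrite addrC.
Qed.

Lemma closing_multilinear A d : bilinear_family A ->
  multilinear (fun w => closing_rev A d (rev w)).
Proof.
move=> bA w1 w2 a x x'; rewrite !rev_cat !rev_cons -!cats1 -!catA /=.
exact: closing_rev_multilinear.
Qed.

Lemma closing_linear A d : bilinear_family A -> linear (closing A d).
Proof. by move=> bA; apply/flin_lift_linear/closing_multilinear. Qed.

Lemma closing_vacuum A d : bilinear_family A -> closing A d vacuum = 0.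
Proof. by move=> bA; rewrite [LHS]flin_lift_tens//; exact: closing_multilinear. Qed.

Lemma closing_rcons A d w y : bilinear_family A ->
  closing A d (tens (rcons w y)) = A (y * d) (tens w) - closing A (y * d) (tens w).
Proof.
move=> bA; rewrite /closing !flin_lift_tens; try exact: closing_multilinear.
by rewrite rev_rcons /= revK.
Qed.

Lemma bilinear_pois A e : bilinear_family A ->
  bilinear_family (fun x t => A x (pois e t)).
Proof. by move=> [A1 A2]; split=> [x a s t|t a x y]; rewrite ?opD ?opZ ?A1 ?A2. Qed.

Lemma closing_pois A d e t : bilinear_family A ->
  closing A d (pois e t) =
  vac t *: A (e * d) vacuum + closing (fun x t => A x (pois e t)) d t.
Proof.
move=> bA; have bAe := bilinear_pois e bA; have [A1 A2] := bA.
have lc d0 := closing_linear d0 bA.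
have lce d0 := closing_linear d0 bAe.
move: t; apply: flin_ext => [a s t|a s t|w].
- by rewrite opD opZ lc.
- rewrite vacD vacZ lce scalerDr scalerDl scalerA -!addrA.
  by congr (_ + _); rewrite addrCA.
elim/last_ind: w d => [|w y IH] d.
  rewrite pois_split contraction_vacuum opening_vacuum addr0 (linear_add (lc d)).
  rewrite (linear_scale (lc d)) !closing_vacuum// (closing_rcons d [::])//.
  by rewrite closing_vacuum// vac_tens scaler0 scale1r subr0 !addr0.
have -> : vac (tens (rcons w y)) = 0 by rewrite vac_tens; case: (w).
rewrite scale0r add0r closing_rcons// pois_split.
case: w IH => [|f w] IH /=.
  rewrite openingE contractionE !(linear_add (lc d)) !(linear_scale (lc d)).
  rewrite !closing_vacuum// (closing_rcons d [:: e])// !(closing_rcons _ [::])//.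
  rewrite !closing_vacuum// !subr0 pois_split contraction_vacuum addr0.
  rewrite opening_vacuum (linear_add (A1 _)) (linear_scale (A1 _)) scaler0 addr0.
  by rewrite mulrA subrK.
have lf : linear (fun t => A (y * d) t - closing A (y * d) t).
  exact: linear_subfun.
have <- : closing A (y * d) (pois e (tens (f :: w))) =
    closing (fun x t => A x (pois e t)) (y * d) (tens (f :: w)).
  by rewrite IH vac_tens scale0r add0r.
rewrite openingE contractionE -!rcons_cons !(linear_add (lc d)).
rewrite !(linear_scale (lc d)) !closing_rcons//.
rewrite -!(linear_scale lf) -!(linear_add lf) /=.
by rewrite pois_split openingE contractionE.
Qed.

(** In a product xi(w), the first leg that [closing] meets is opened at some
    letter y; the letters u before y act on A and the letters v after y are
    closed among themselves. *)
Lemma closing_xi A d w : bilinear_family A -> closing A d (xi w) =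
  split_sum (fun u y v => wphi v *: A (y * d) (xi u)) w.
Proof.
elim: w A d => [|e w IH] A d bA /=; first exact: closing_vacuum.
by rewrite xi_cons closing_pois// IH//; exact: bilinear_pois.
Qed.

End Closing.

Definition cxi w : fcyc D := cmap (xi w).

Lemma bilinear_cmap_pois : bilinear_family (fun x t => cmap (pois x t)).
Proof.
split=> [x a s t|t a x y]; first by rewrite opD opZ cmapD cmapZ.
by rewrite /pois -!lock -cmapZ -cmapD poisson_op_linear.
Qed.

(** Applied to a tensor that starts with an open leg, the map c rotates, and
    then repeatedly either merges the last leg into the first or contracts the
    two. *)
Lemma cmap_opening d t :
  cmap (opening d t) = cproj (opening d t) + closing (fun x t => cmap (pois x t)) d t.
Proof.
have bA := bilinear_cmap_pois.
apply/eqP; rewrite addrC -subr_eq; apply/eqP; move: t; apply: flin_ext.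
- by apply: linear_subfun => a s t; rewrite opD opZ ?cmapD ?cmapZ// cprojD cprojZ.
- exact: closing_linear.
move=> w; elim/last_ind: w d => [|w y IH] d.
  by rewrite opening_vacuum cmap_tens1 cproj_tens closing_vacuum// subrr.
rewrite closing_rcons// -IH pois_split cmapD cmapZ opprB.
rewrite [RHS](_ : _ = cmap (contraction (y * d) (tens w)) +
  psi (y * d) *: cmap (tens w) + cproj (opening (y * d) (tens w))); last first.
  by rewrite cmapD addrC -!addrA addKr addrC -addrA.
case: w {IH} => [|f w].
  rewrite (openingE d y [::]) !opening_vacuum contraction_vacuum !cmapD !cprojD.
  rewrite (cmap_tens psi d [::] y) !cmap_tens1 !cproj_tens.
  rewrite cmap_vacuum !scaler0 !addr0 (linear0 cmap) add0r.
  by rewrite opprD addrACA subrr addr0 addrAC subrr add0r.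
rewrite rcons_cons !openingE contractionE !cmapD !cprojD.
rewrite -rcons_cons cmap_tens cmap_tens rcons_cons !cproj_tens.
have cancel (a b c : fcyc D) : a + b + c - a = b + c.
  by rewrite addrC -!addrA addKr.
rewrite opprD addrACA !cancel addrACA addrC mulrA (cmapZ (psi _)).
congr (_ + _).
rewrite addrC (state_tracial psi d y); congr (_ *: _ + _).
by rewrite (state_tracial psi (d * f)) mulrA.
Qed.

(** The term at y collects the words in which d and y are consecutive letters
    of one block; either v or u is then enclosed by that block. *)
Lemma cxi_cons d w : cxi (d :: w) =
  psi d *: cxi w + cproj (opening d (xi w)) +
  split_sum (fun u y v => wphi v *: cxi (y * d :: u) +
                          wphi (y * d :: u) *: cxi v) w.
Proof.
rewrite /cxi pois_xi !cmapD cmapZ cmap_opening closing_xi; last first.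
  exact: bilinear_cmap_pois.
rewrite (raddf_split_sum cmap) /= [in RHS]split_sumD addrA.
congr (_ + _); last by apply: eq_split_sum => u y v; rewrite cmapZ.
by rewrite addrAC [_ + psi d *: _]addrC.
Qed.

(** ** Rotating the legs *)

Definition rotations w : F := split_sum (fun u y v => tens (y :: v ++ u)) w.

Lemma rotations_rot w : rotations (rot 1 w) = rotations w.
Proof.
case: w => // x w; rewrite rot1_cons /rotations split_sum_rcons /= cats0 addrC.
by congr (_ + _); apply: eq_split_sum => u y v; rewrite cat_rcons.
Qed.

Let interleave (s s' t t' x x' : F) :
  s + s' + (t + t' + (x + x')) = s + (t + x) + (s' + (t' + x')) :> F.
Proof. by rewrite (addrACA t) (addrACA s). Qed.

Lemma rotations_multilinear : cyclic_multilinear rotations.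
Proof.
split; last exact: rotations_rot.
exact/rotation_sum_multilinear/tens_multilinear.
Qed.

(** The adjoint of [cproj], see [fcyc_inner_cproj]. *)
Definition rotsum : fcyc D -> F := fcyc_lift rotations.
Lemma rotsum_linear : linear rotsum.
Proof. exact: fcyc_lift_linear rotations_multilinear. Qed.
HB.instance Definition _ := GRing.isLinear.Build C (fcyc D) F *:%R rotsum rotsum_linear.
Let rotsumD (x y : fcyc D) : rotsum (x + y) = rotsum x + rotsum y. Proof. exact: (linearD rotsum). Qed.
Let rotsumZ k (x : fcyc D) : rotsum (k *: x) = k *: rotsum x. Proof. exact: (linearZ_LR rotsum). Qed.

Lemma rotsum_cyc w : rotsum (cyc w) = rotations w.
Proof. exact: fcyc_lift_cyc rotations_multilinear. Qed.

Fixpoint create w t : F := if w is d :: w' then creation d (create w' t) else t.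

Lemma create_tens v w : create v (tens w) = tens (v ++ w).
Proof. by elim: v => //= d v ->; rewrite creationE. Qed.

Lemma create_linear w : linear (create w).
Proof. by elim: w => //= d w IH a s t; rewrite IH opD opZ. Qed.

Lemma create_multilinear t : multilinear (create^~ t).
Proof.
elim=> [|z w1 IH] w2 a x y /=; last by rewrite IH opD opZ.
move: (create w2 t); apply: flin_ext => [b s s'|b s s'|w].
- by rewrite opD opZ.
- by rewrite !opD !opZ !scalerDr addrACA !scalerA mulrC.
- by rewrite !creationE (@tens_multilinear _ D [::]).
Qed.

(** The tensor product of s and t. *)
Definition fcat s t : F := flin_lift (create^~ t) s.

Lemma fcat_linearl t : linear (fcat^~ t).
Proof. exact/flin_lift_linear/create_multilinear. Qed.

Lemma fcat_tens w t : fcat (tens w) t = create w t.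
Proof. exact/flin_lift_tens/create_multilinear. Qed.

Lemma fcat_linearr s : linear (fcat s).
Proof.
move=> a t t'; move: s; apply: flin_ext => [||w].
- exact: fcat_linearl.
- by apply: linear_addfun; [apply: linear_scalefun|]; exact: fcat_linearl.
- by rewrite !fcat_tens create_linear.
Qed.

Definition leg_cuts_word (A : F -> F) w : F :=
  split_sum (fun u f v => create (f :: v) (A (tens u))) w.

Lemma leg_cuts_multilinear A : linear A -> multilinear (leg_cuts_word A).
Proof.
move=> lA w1 w2 a x y; rewrite /leg_cuts_word !split_sum_cat.
have cm t := create_multilinear t; have tm := @tens_multilinear _ D.
have e1 : split_sum (fun u z v => create (z :: v ++ a *: x + y :: w2) (A (tens u))) w1 =
  a *: split_sum (fun u z v => create (z :: v ++ x :: w2) (A (tens u))) w1 +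
  split_sum (fun u z v => create (z :: v ++ y :: w2) (A (tens u))) w1.
  rewrite scaler_split_sum -split_sumD; apply: eq_split_sum => u z v.
  by rewrite -!cat_cons cm.
have e2 : split_sum (fun u z v => create (z :: v) (A (tens (w1 ++ a *: x + y :: u)))) w2 =
  a *: split_sum (fun u z v => create (z :: v) (A (tens (w1 ++ x :: u)))) w2 +
  split_sum (fun u z v => create (z :: v) (A (tens (w1 ++ y :: u)))) w2.
  rewrite scaler_split_sum -split_sumD; apply: eq_split_sum => u z v.
  by rewrite tm lA (create_linear (z :: v)).
rewrite e1 /= e2 cats0.
have -> : creation (a *: x + y) (create w2 (A (tens w1))) =
  a *: creation x (create w2 (A (tens w1))) + creation y (create w2 (A (tens w1))).
  exact: (cm _ [::]).
by rewrite interleave !scalerDr.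
Qed.

(** On a tensor t, the sum over its legs f, with t = t1 (x) f (x) t2, of
    f (x) t2 (x) A t1. *)
Definition leg_cuts A : F -> F := flin_lift (leg_cuts_word A).

Lemma leg_cuts_linear A : linear A -> linear (leg_cuts A).
Proof. by move=> lA; apply/flin_lift_linear/leg_cuts_multilinear. Qed.

Lemma leg_cuts_tens A w : linear A -> leg_cuts A (tens w) = leg_cuts_word A w.
Proof. by move=> lA; apply/flin_lift_tens/leg_cuts_multilinear. Qed.

Lemma linear_comp_op (A : F -> F) (a : fock_op D) : linear A -> linear (fun t => A (a t)).
Proof. by move=> lA k s t; rewrite opD opZ lA. Qed.

Lemma leg_cuts_pois A e t : linear A ->
  leg_cuts A (pois e t) =
  fcat (opening e t) (A vacuum) + leg_cuts (fun t => A (pois e t)) t.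
Proof.
move=> lA; have lAe := linear_comp_op (pois e) lA.
have lL := leg_cuts_linear lA.
have lF := fcat_linearl (A vacuum).
move: t; apply: flin_ext => [a s t|a s t|[|f w]].
- by rewrite opD opZ lL.
- by rewrite opD opZ lF leg_cuts_linear// scalerDr addrACA.
- rewrite pois_split contraction_vacuum addr0 opening_vacuum.
  rewrite (linear_add lL) (linear_scale lL) !leg_cuts_tens//.
  by rewrite /leg_cuts_word /= scaler0 !addr0 fcat_tens.
rewrite pois_split openingE contractionE.
rewrite !(linear_add lL) !(linear_scale lL) !leg_cuts_tens//.
rewrite (linear_add lF) !fcat_tens /leg_cuts_word /=.
rewrite [in RHS](_ : split_sum _ _ =
  split_sum (fun u y v => create (y :: v) (A (tens (e :: f :: u)))) w +
  split_sum (fun u y v => create (y :: v) (A (tens (e * f :: u)))) w +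
  psi (e * f) *: split_sum (fun u y v => create (y :: v) (A (tens u))) w +
  psi e *: split_sum (fun u y v => create (y :: v) (A (tens (f :: u)))) w); last first.
  rewrite !scaler_split_sum -!split_sumD; apply: eq_split_sum => u y v.
  rewrite -!(linear_scale (create_linear (y :: v))) -!(linear_add (create_linear (y :: v))).
  by rewrite -!(linear_scale lA) -!(linear_add lA) pois_split openingE contractionE.
rewrite pois_split contraction_vacuum addr0 opening_vacuum.
rewrite (linear_add lA) (linear_scale lA) (linear_add (create_linear w)) (linear_scale (create_linear w)).
rewrite opD opZ /=.
rewrite -/vacuum scalerDr.
by rewrite [LHS](AC ((1*2)*2*1*2) ((1*4)*((2*7)*(3*5*6*8)))).
Qed.

Lemma leg_cuts_xi A w : linear A -> leg_cuts A (xi w) =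
  split_sum (fun u y v => fcat (opening y (xi v)) (A (xi u))) w.
Proof.
elim: w A => [|e w IH] A lA /=; first by rewrite leg_cuts_tens.
by rewrite xi_cons leg_cuts_pois// IH//; exact: linear_comp_op.
Qed.

(** A rotation of d (x) t or of d t_1 (x) t_2 (x) ... either leaves d in front
    or puts another leg in front. *)
Lemma rotsum_opening d t :
  rotsum (cproj (opening d t)) = opening d t + leg_cuts (opening d) t.
Proof.
have lo : linear (opening d) by move=> a x y; rewrite opD opZ.
have lL := leg_cuts_linear lo.
move: t; apply: flin_ext => [a s t|a s t|[|f w]].
- by rewrite opD opZ cprojD cprojZ rotsumD rotsumZ.
- by rewrite lL opD opZ scalerDr addrACA.
- rewrite leg_cuts_tens// opening_vacuum cproj_tens rotsum_cyc.
  by rewrite /rotations /leg_cuts_word.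
rewrite leg_cuts_tens// openingE cprojD rotsumD !cproj_tens !rotsum_cyc.
rewrite /rotations /leg_cuts_word /= opening_vacuum !cats0 create_tens creationE.
rewrite [X in _ = _ + (_ + X)](_ : _ =
  split_sum (fun u y v => tens (y :: v ++ d :: f :: u)) w +
  split_sum (fun u y v => tens (y :: v ++ d * f :: u)) w).
  by rewrite [LHS](AC ((1*2)*2) ((1*4)*(2*(3*5)))).
rewrite -split_sumD; apply: eq_split_sum => u y v.
by rewrite openingE (linear_add (create_linear v)) opD !create_tens !creationE.
Qed.

Lemma opening_opening e d t :
  opening e (opening d t) = creation e (opening d t) + opening (e * d) t.
Proof.
move: t; apply: flin_ext => [a s t|a s t|[|f w]].
- by rewrite !opD !opZ.
- by rewrite !opD !opZ scalerDr addrACA.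
- by rewrite !opening_vacuum openingE creationE.
- rewrite !openingE !opD !openingE !creationE mulrA.
  by rewrite [LHS](AC (2*2) ((1*3)*(2*4))).
Qed.

(** Letting p(e) act on the first factor of s (x) (d-opened t) differs from
    letting it act on the product in the terms that merge e into the second
    factor, which appear when the first factor is the vacuum. *)
Lemma fcat_pois e d s t : fcat (pois e s) (opening d t) =
  pois e (fcat s (opening d t)) - vac s *: pois (e * d) t.
Proof.
have lF := fcat_linearl (opening d t).
move: s; apply: flin_ext => [a s s'|a s s'|[|f w]].
- by rewrite opD opZ lF.
- rewrite lF opD opZ vacD vacZ scalerDl opprD scalerDr scalerN -scalerA.
  by rewrite addrACA.
- rewrite pois_split contraction_vacuum opening_vacuum addr0 (linear_add lF).
  rewrite (linear_scale lF) !fcat_tens /= vac_tens scale1r.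
  rewrite !pois_split opening_opening contraction_opening.
  by rewrite [X in _ = X - _](AC (2*2*1) ((1*5)*(2*4*3))) addrK.
rewrite vac_tens scale0r subr0 pois_split openingE contractionE.
rewrite !(linear_add lF) !(linear_scale lF) !fcat_tens /=.
move: (create w (opening d t)); apply: flin_ext => [a s s'|a s s'|v].
- rewrite !opD !opZ !scalerDr !scalerA [psi _ * a]mulrC [psi e * a]mulrC.
  by rewrite [LHS](AC (2*2*2*2) ((1*3*5*7)*(2*4*6*8))).
- by rewrite !opD !opZ.
- by rewrite !creationE pois_split openingE contractionE.
Qed.

Lemma fcat_opening y d s t : fcat (opening y s) (opening d t) =
  opening y (fcat s (opening d t)) - vac s *: opening (y * d) t.
Proof.
have lF := fcat_linearl (opening d t).
move: s; apply: flin_ext => [a s s'|a s s'|[|f w]].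
- by rewrite opD opZ lF.
- rewrite lF opD opZ vacD vacZ scalerDl opprD scalerDr scalerN -scalerA.
  by rewrite addrACA.
- by rewrite opening_vacuum !fcat_tens /= vac_tens scale1r opening_opening addrK.
rewrite vac_tens scale0r subr0 openingE (linear_add lF) !fcat_tens /=.
move: (create w (opening d t)); apply: flin_ext => [a s s'|a s s'|v].
- by rewrite !opD !opZ scalerDr addrACA.
- by rewrite !opD !opZ.
- by rewrite !creationE openingE.
Qed.

Lemma fcat_xi_opening v d t : fcat (xi v) (opening d t) =
  pact v (opening d t) -
  split_sum (fun u z v => wphi v *: pact u (pois (z * d) t)) v.
Proof.
elim: v => [|e v IH] /=; first by rewrite fcat_tens subr0.
rewrite xi_cons fcat_pois IH opD opN -addrA -opprD /=.
congr (_ - _); rewrite addrC; congr (_ + _).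
by rewrite (raddf_split_sum (pois e)); apply: eq_split_sum => u z w; rewrite /= opZ.
Qed.

(** The vector c xi(w) is the cyclic symmetrization of the vectors obtained
    from the rotations of w when their first letter stays open. *)
Lemma rotsum_cxi w : rotsum (cxi w) =
  split_sum (fun u y v => opening y (pact v (xi u))) w.
Proof.
have [n] := ubnP (size w); elim: n w => // n IH [|d w] wn.
  by rewrite /cxi cmap_vacuum (linear0 rotsum).
have {}wn : (size w < n)%N by [].
have lo y : linear (opening y) by move=> a s t; rewrite opD opZ.
rewrite cxi_cons !rotsumD rotsumZ rotsum_opening leg_cuts_xi//.
rewrite (raddf_split_sum rotsum) /=.
pose P1 := split_sum (fun u y v => opening y (pact v (opening d (xi u)))) w.
pose P2 := split_sum (fun u y v => split_sum (fun v1 z v2 =>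
  wphi v2 *: opening y (pact v1 (pois (z * d) (xi u)))) v) w.
pose P3 := split_sum (fun u y v => wphi v *: opening (y * d) (xi u)) w.
pose P4 := split_sum (fun u y v => wphi (y * d :: u) *: rotsum (cxi v)) w.
have e1 : split_sum (fun u y v => fcat (opening y (xi v)) (opening d (xi u))) w =
    P1 - P2 - P3.
  have -> : P1 - P2 - P3 = P1 + - (P2 + P3) by rewrite -addrA opprD.
  apply/eqP; rewrite -subr_eq opprK; apply/eqP.
  rewrite -!split_sumD; apply: eq_split_sum => u y v.
  rewrite fcat_opening fcat_xi_opening opD opN (linear_split_sum (lo y)).
  rewrite -[X in X + _]addrA -opprD.
  rewrite [X in _ - (X + _)](_ : _ = split_sum (fun v1 z v2 =>
    wphi v2 *: opening y (pact v1 (pois (z * d) (xi u)))) v) ?subrK//.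
  by apply: eq_split_sum => v1 z v2; rewrite opZ.
have lpact v : linear (pact v) by exact: poisson_act_linear.
have e2 : split_sum (fun u y v => opening y (pact v (xi (d :: u)))) w =
    P1 + psi d *: rotsum (cxi w) + P4.
  transitivity (P1 + psi d *: rotsum (cxi w) +
      split_sum (fun u y v => split_sum (fun u1 z u2 =>
        wphi (z * d :: u1) *: opening y (pact v (xi u2))) u) w).
    rewrite IH// scaler_split_sum -!split_sumD; apply: eq_split_sum => u y v.
    rewrite pois_xi !(linear_add (lpact v)) (linear_scale (lpact v)) !opD opZ.
    rewrite (linear_split_sum (lpact v)) (linear_split_sum (lo y)).
    congr (_ + _); apply: eq_split_sum => u1 z u2.
    by rewrite (linear_scale (lpact v)) opZ.
  rewrite split_sum_split; congr (_ + _); apply: eq_split_sum_in => u z v wE.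
  rewrite IH ?scaler_split_sum//; move: wn; rewrite wE size_cat /=; lia.
have e3 : split_sum (fun u y v => rotsum (wphi v *: cxi (y * d :: u) +
    wphi (y * d :: u) *: cxi v)) w = P3 + P2 + P4.
  rewrite /P2 -(split_sum_split (fun u y v1 z v2 =>
    wphi v2 *: opening y (pact v1 (pois (z * d) (xi u))))).
  rewrite -!split_sumD; apply: eq_split_sum_in => u y v wE.
  rewrite rotsumD !rotsumZ; congr (_ + _); rewrite IH /=.
    by rewrite scalerDr scaler_split_sum.
  by move: wn; rewrite wE size_cat /=; lia.
rewrite e1 e2 e3 /= -/(xi w).
rewrite [LHS](AC (1*(1*3)*3) ((2*(3*1*8))*((5*6)*(4*7)))).
by rewrite /= !addNr !addr0.
Qed.

(** ** Rotation invariance *)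

Definition unrotsum_word w : fcyc D := ((size w)%:R : C)^-1 *: cyc w.
Lemma unrotsum_multilinear : multilinear unrotsum_word.
Proof.
have [cm _] := @cyc_multilinear _ D; move=> w1 w2 a x y.
have sz z : size (w1 ++ z :: w2) = (size w1 + size w2).+1.
  by rewrite size_cat /= addnS.
by rewrite /unrotsum_word !sz cm; exact: linear_scaler.
Qed.
Definition unrotsum : F -> fcyc D := flin_lift unrotsum_word.

Lemma cyc_catC u v : cyc (u ++ v) = cyc (v ++ u).
Proof.
have [_ cr] := @cyc_multilinear _ D.
elim: u v => [|x u IH] v; first by rewrite cats0.
by rewrite cat_cons -cr rot1_cons -cats1 -catA IH -catA.
Qed.

Lemma rotsumK_cyc w : w != [::] -> unrotsum (rotsum (cyc w)) = cyc w.
Proof.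
have lu := flin_lift_linear unrotsum_multilinear.
move=> w0; rewrite rotsum_cyc /unrotsum (linear_split_sum lu).
have sw0 : (size w)%:R != 0 :> C by rewrite pnatr_eq0 size_eq0.
transitivity (split_sum (fun _ _ _ => ((size w)%:R : C)^-1 *: cyc w) w).
  apply: eq_split_sum_in => u y v wE; rewrite flin_lift_tens; last first.
    exact: unrotsum_multilinear.
  rewrite /unrotsum_word wE (cyc_catC u) /= !size_cat /= addnC addnS.
  by rewrite addnC.
by rewrite split_sum_const -scaler_nat scalerA mulfV// scale1r.
Qed.

(** Up to the degree 0 component, which c avoids, a cyclic tensor is the
    average of its rotations. *)
Lemma rotsumK t : unrotsum (rotsum (cmap t)) = cmap t.
Proof.
have lu := flin_lift_linear unrotsum_multilinear.
have lur : linear (fun x : fcyc D => unrotsum (rotsum x)).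
  by move=> a x y; rewrite rotsumD rotsumZ /unrotsum lu.
move: t; apply: flin_ext => [a s t|a s t|w].
- by rewrite cmapD cmapZ lur.
- by rewrite cmapD cmapZ.
have [n] := ubnP (size w); elim: n w => // n IH [|d w] wn.
  by rewrite cmap_vacuum (linear_zero lur).
case/lastP: w wn => [|w e] wn; first by rewrite cmap_tens1 rotsumK_cyc.
rewrite cmap_tens !(linear_add lur) (linear_scale lur) !rotsumK_cyc// IH//.
by move: wn; rewrite /= size_rcons; lia.
Qed.

Lemma cxi_rcons d w : cxi (rcons w d) = cxi (d :: w).
Proof.
rewrite -[LHS]rotsumK -[RHS]rotsumK; congr unrotsum.
rewrite -!/(cxi _) !rotsum_cxi split_sum_rcons /= addrC; congr (_ + _).
apply: eq_split_sum => u y v.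
by rewrite -cats1 poisson_act_cat.
Qed.

Lemma cxi_catC u v : cxi (u ++ v) = cxi (v ++ u).
Proof.
elim: u v => [|d u IH] v; first by rewrite cats0.
by rewrite cat_cons -cxi_rcons -cats1 -catA cats1 IH -cats1 -catA.
Qed.

(** ** The covariance on words *)

Lemma sesq_inner_ext (f g : F -> F -> C) :
  (forall t, linear (f^~ t : F -> C^o)) -> (forall t, linear (g^~ t : F -> C^o)) ->
  (forall s, linear (fun t => (f s t)^* : C^o)) ->
  (forall s, linear (fun t => (g s t)^* : C^o)) ->
  (forall v w, f (tens v) (tens w) = g (tens v) (tens w)) ->
  forall s t, f s t = g s t.
Proof.
move=> fl gl fr gr fg s t.
apply: (@flin_ext _ _ C^o (f^~ t) (g^~ t)) => // v.
apply: (can_inj conjCK).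
by apply: (@flin_ext _ _ C^o (fun t => (f (tens v) t)^*) (fun t => (g (tens v) t)^*))
  => // w; rewrite fg.
Qed.

Lemma flin_inner_linearr s : linear (fun t => (flin_inner psi s t)^* : C^o).
Proof.
by move=> a t t'; rewrite flin_inner_antilinear rmorphD rmorphM /= conjCK.
Qed.

Lemma fcyc_ext (W : lmodType C) (f g : fcyc D -> W) : linear f -> linear g ->
  (forall w, f (cyc w) = g (cyc w)) -> f =1 g.
Proof.
move=> lf lg fg.
pose f' : {linear fcyc D -> W} := HB.pack f (GRing.isLinear.Build _ _ _ _ f lf).
pose g' : {linear fcyc D -> W} := HB.pack g (GRing.isLinear.Build _ _ _ _ g lg).
exact: (@wlift_unique _ _ _ _ f' g').
Qed.

Lemma fcyc_inner_cproj t (x : fcyc D) :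
  fcyc_inner psi (cproj t) x = flin_inner psi t (rotsum x).
Proof.
apply: (can_inj conjCK).
apply: (@fcyc_ext C^o (fun x : fcyc D => (fcyc_inner psi (cproj t) x)^*)
  (fun x : fcyc D => (flin_inner psi t (rotsum x))^*)) => [a y z|a y z|w].
- by rewrite fcyc_inner_antilinear rmorphD rmorphM /= conjCK.
- by rewrite rotsumD rotsumZ flin_inner_linearr.
congr (_^*).
apply: (@flin_ext _ _ C^o (fun t => fcyc_inner psi (cproj t) (cyc w))
  (fun t => flin_inner psi t (rotsum (cyc w)))) => [a y z|a y z|v].
- by rewrite cprojD cprojZ fcyc_inner_linear.
- by rewrite flin_inner_linear.
rewrite cproj_tens fcyc_inner_cyc rotsum_cyc /rotations -big_rot.
have -> : flin_inner psi (tens v) (\sum_(k < size w) tens (rot k w)) =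
   \sum_(k < size w) flin_inner psi (tens v) (tens (rot k w)).
  pose f : {linear F -> C^o} := HB.pack (fun t => (flin_inner psi (tens v) t)^* : C^o)
    (GRing.isLinear.Build _ _ _ _ _ (flin_inner_linearr (tens v))).
  apply: (can_inj conjCK); rewrite [RHS]rmorph_sum.
  exact: (raddf_sum f).
by apply: eq_bigr => k _; rewrite flin_inner_tens.
Qed.

Lemma star1 : star 1 = 1 :> D.
Proof. by have := starM (star 1) (1 : D); rewrite mulr1 starK mulr1. Qed.

(** Positivity forces the state to be hermitian. *)
Lemma state_star d : psi (star d) = (psi d)^*.
Proof.
have real e : (psi (star e * e))^* = psi (star e * e).
  by apply/CrealP/ger0_real; exact: state_ge0.
have := real (d + 'i%:A); have := real (d + 1).
rewrite !starD starZ star1 conjCi !mulrDl !mulrDr !mulr1 !mul1r -!scalerAl -!scalerAr.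
rewrite !mul1r !mulr1 !scalerA mulNr mulCii opprK scale1r !linearD !linearZ /= state1.
rewrite !rmorphD !rmorphM /= rmorphN /= conjCi conjC1 real !opprK.
move: (psi (star d)) (psi d) (psi (star d * d)) => a b q.
move=> /eqP; rewrite -subr_eq0 => /eqP h1 /eqP; rewrite -subr_eq0 => /eqP h2.
apply/eqP; rewrite -subr_eq0 -(inj_eq (mulfI (neq0Ci C))) mulr0.
rewrite -(inj_eq (mulfI (_ : 2 != 0 :> C))) ?pnatr_eq0// mulr0; apply/eqP.
transitivity (- ('i * (q + a^* + (b^* + 1) - (q + a + (b + 1))) +
  (q + - 'i * a^* + ('i * b^* + 1) - (q + 'i * a + (- 'i * b + 1))))).
  by ring.
by rewrite h1 h2 mulr0 addr0 oppr0.
Qed.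

Let innerD s s' t : flin_inner psi (s + s') t = flin_inner psi s t + flin_inner psi s' t.
Proof. exact: (linear_add (flin_inner_linear psi t : linear (_ : F -> C^o))). Qed.
Let innerZ k s t : flin_inner psi (k *: s) t = k * flin_inner psi s t.
Proof. exact: (linear_scale (flin_inner_linear psi t : linear (_ : F -> C^o))). Qed.
Let innerDr s t t' : flin_inner psi s (t + t') = flin_inner psi s t + flin_inner psi s t'.
Proof. by have := flin_inner_antilinear psi s 1 t t'; rewrite scale1r conjC1 mul1r. Qed.
Let innerZr k s t : flin_inner psi s (k *: t) = k^* * flin_inner psi s t.
Proof.
apply: (can_inj conjCK); rewrite rmorphM /= conjCK.
exact: (linear_scale (flin_inner_linearr s)).
Qed.

Let inner_linearl (a : F -> F) t : linear a ->
  linear (fun s => flin_inner psi (a s) t : C^o).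
Proof. by move=> la k s s'; rewrite la innerD innerZ. Qed.
Let inner_linearr (a : F -> F) s : linear a ->
  linear (fun t => (flin_inner psi s (a t))^* : C^o).
Proof. by move=> la k t t'; rewrite la flin_inner_linearr. Qed.

Lemma pois_adjoint d s t :
  flin_inner psi (pois d s) t = flin_inner psi s (pois (star d) t).
Proof.
have lp e : linear (pois e) by move=> a x y; rewrite opD opZ.
have li : linear (@id F) by [].
move: s t; apply: sesq_inner_ext => [t|t|s|s|v w].
- exact: inner_linearl.
- exact: (inner_linearl (pois (star d) t) li).
- exact: (inner_linearr (pois d s) li).
- exact: inner_linearr.
case: v w => [|f v] [|e w]; rewrite !pois_split ?contraction_vacuum ?opening_vacuum
  ?openingE ?contractionE ?addr0 !innerD ?innerDr !innerZ ?innerZr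
  -?state_star !flin_inner_tens /= /inner ?starM ?starK ?mulrA; ring.
Qed.

Lemma flin_inner_conj s t : flin_inner psi s t = (flin_inner psi t s)^*.
Proof.
have li : linear (@id F) by [].
move: s t; apply: sesq_inner_ext => [t|t|s|s|v w].
- exact: (inner_linearl t li).
- exact: (inner_linearr t li).
- exact: (inner_linearr s li).
- by move=> a x y; rewrite !conjCK innerD innerZ.
rewrite !flin_inner_tens; elim: v w => [|f v IH] [|g w] /=; rewrite ?conjC0 ?conjC1//.
by rewrite rmorphM /= -IH /inner -state_star starM starK.
Qed.

Lemma opening_adjoint d e s t :
  flin_inner psi (opening d s) (opening (star e) t) =
  flin_inner psi (pois (e * d) s) t.
Proof.
have lp x : linear (pois x) by move=> a y z; rewrite opD opZ.
have lo x : linear (opening x) by move=> a y z; rewrite opD opZ.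
have li : linear (@id F) by [].
move: s t; apply: sesq_inner_ext => [t|t|s|s|v w].
- exact: inner_linearl.
- exact: inner_linearl.
- exact: inner_linearr.
- exact: (inner_linearr (pois (e * d) s) li).
case: v w => [|f v] [|g w]; rewrite ?pois_split ?contraction_vacuum ?opening_vacuum
  ?openingE ?contractionE ?addr0 ?innerD ?innerDr ?innerZ ?innerZr
  -?state_star !flin_inner_tens /= /inner ?starM ?starK ?mulrA; ring.
Qed.

Lemma pact_adjoint w s t :
  flin_inner psi (pact w s) t = flin_inner psi s (pact (word_star w) t).
Proof.
elim: w s t => // d w IH s t; rewrite /= pois_adjoint IH.
by rewrite /word_star /= rev_cons -cats1 poisson_act_cat.
Qed.

Definition wrho v w : C := fcyc_inner psi (cxi v) (cxi (word_star w)).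

Lemma fock_rho_pword v w : fock_rho psi (pword psi v) (pword psi w) = wrho v w.
Proof.
rewrite /fock_rho !pword_act; congr (fcyc_inner _ _ (cmap _)).
suff -> : star (pword psi w) = pword psi (word_star w) by exact: pword_act.
apply: fock_starE; apply/adjoint_relP; exists [:: (1, w)].
by rewrite /fcomb_star /= conjC1 !fcomb_eval1.
Qed.

Lemma wrho_nil w : wrho [::] w = 0.
Proof.
rewrite /wrho /cxi cmap_vacuum.
exact: (linear_zero (fcyc_inner_linear psi _ : linear (_ : fcyc D -> C^o))).
Qed.

(** The last sum is over the letter e of v next to d in its block, when that
    block joins the two circles. *)
Lemma wrho_cons d w v : wrho (d :: w) v = psi d * wrho w v +
  split_sum (fun u y u' => wphi u' * wrho (y * d :: u) v +
                           wphi (y * d :: u) * wrho u' v) w +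
  split_sum (fun a e b => wphi ((e * d) :: w ++ b ++ a)) v.
Proof.
have lr : linear (fun x : fcyc D => fcyc_inner psi x (cxi (word_star v)) : C^o).
  exact: fcyc_inner_linear.
rewrite {1}/wrho cxi_cons !(linear_add lr) (linear_scale lr) (linear_split_sum lr).
rewrite addrAC; congr (_ + _ + _).
  by apply: eq_split_sum => u y u'; rewrite (linear_add lr) !(linear_scale lr).
rewrite fcyc_inner_cproj rotsum_cxi.
have -> G : flin_inner psi (opening d (xi w)) (split_sum G (word_star v)) =
    split_sum (fun u y u' => flin_inner psi (opening d (xi w)) (G u y u')) (word_star v).
  elim: (word_star v) G => [|y u IH] G /=; last by rewrite innerDr IH.
  apply: (can_inj conjCK); rewrite conjC0.
  exact: (linear_zero (flin_inner_linearr _)).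
rewrite {1}/word_star split_sum_rev split_sum_map; apply: eq_split_sum => a e b.
rewrite -/(word_star a) -/(word_star b) opening_adjoint -pact_adjoint.
rewrite /xi -pact_adjoint -[pois _ _]/(pact (e * d :: w) vacuum) -!poisson_act_cat.
by rewrite -[LHS]/(wphi _) wphi_catC.
Qed.

End CyclicWords.

(** * The second order probability space on A(D) *)

Section SecondOrderSpace.
Variables (R : rcfType) (D : starAlgType R) (psi : tracial_state D).
Local Notation C := R[i].
Local Notation A := (fock_alg psi).
Local Notation phi := (fock_phi psi).
Local Notation rho := (fock_rho psi).
Implicit Types a b c : A.

Lemma fock_alg_ext (W : lmodType C) (f g : A -> W) : linear f -> linear g ->
  (forall w, f (pword psi w) = g (pword psi w)) -> f =1 g.
Proof.
move=> lf lg fg a; have [u ->] := fock_alg_span a; elim: u => [|t u IH].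
  by rewrite fcomb_eval_nil (linear_zero lf) (linear_zero lg).
by rewrite fcomb_eval_cons lf lg fg IH.
Qed.

Lemma fock_phi_linear : scalar phi.
Proof.
move=> k a b; rewrite /fock_phi.
have -> : (k *: a + b) vacuum = k *: a vacuum + b vacuum by [].
exact: flin_inner_linear.
Qed.

Lemma fock_rho_linearl b : scalar (rho^~ b).
Proof.
move=> k a a'; rewrite /fock_rho.
have -> : (k *: a + a') vacuum = k *: a vacuum + a' vacuum by [].
by rewrite cmap_linear fcyc_inner_linear.
Qed.

Lemma fock_rho_linearr a : scalar (rho a).
Proof.
move=> k b b'; rewrite /fock_rho starD starZ.
have -> : (k^* *: star b + star b') vacuum = k^* *: star b vacuum + star b' vacuum by [].
by rewrite cmap_linear fcyc_inner_antilinear conjCK.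
Qed.

Let mulrl b : linear (fun a => a * b).
Proof. by move=> k x y; rewrite mulrDl -scalerAl. Qed.
Let mulrr b : linear (fun a => b * a).
Proof. by move=> k x y; rewrite mulrDr -scalerAr. Qed.
Let comp (f : A -> C) (g : A -> A) : scalar f -> linear g -> linear (f \o g : A -> C^o).
Proof. by move=> lf lg k x y; rewrite /= lg lf. Qed.

(** By linearity, as the algebra is spanned by words. *)
Lemma trace_ext (f : A -> C) : scalar f ->
  (forall v w, f (pword psi (v ++ w)) = f (pword psi (w ++ v))) ->
  forall a b, f (a * b) = f (b * a).
Proof.
move=> lf fC a b.
apply: (fock_alg_ext (comp lf (mulrl b)) (comp lf (mulrr b))) => v /=.
apply: (fock_alg_ext (comp lf (mulrr _)) (comp lf (mulrl _))) => w /=.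
by rewrite -!pword_cat fC.
Qed.

Lemma fock_second_order_space : second_order_space phi rho.
Proof.
have rhoC v w c : rho (pword psi (v ++ w)) c = rho (pword psi (w ++ v)) c.
  apply: (fock_alg_ext (fock_rho_linearr _) (fock_rho_linearr _)) => u.
  by rewrite !fock_rho_pword /wrho cxi_catC.
have rhoCr v w c : rho c (pword psi (v ++ w)) = rho c (pword psi (w ++ v)).
  apply: (fock_alg_ext (fock_rho_linearl _) (fock_rho_linearl _)) => u.
  by rewrite !fock_rho_pword /wrho /word_star !map_cat !rev_cat cxi_catC.
have pw1 : (1 : A) = pword psi [::] by rewrite /pword big_nil.
split.
- exact: fock_phi_linear.
- by rewrite pw1 fock_phi_pword wphi_nil.
- by apply: trace_ext fock_phi_linear _ => v w; rewrite !fock_phi_pword wphi_catC.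
- exact: fock_rho_linearl.
- exact: fock_rho_linearr.
- by move=> a b c; apply: (trace_ext (fock_rho_linearl c)) => v w.
- by move=> a b c; apply: (trace_ext (fock_rho_linearr c)) => v w.
- move=> a; apply: (fock_alg_ext (fock_rho_linearl 1) (g := fun=> 0)).
    by move=> k x y; rewrite scaler0 addr0.
  move=> w; rewrite pw1 fock_rho_pword /wrho /word_star /= /cxi cmap_vacuum.
  have := fcyc_inner_antilinear psi (cmap psi (xi psi w)) 1 0 0.
  rewrite scaler0 addr0 conjC1 mul1r => /esym/eqP.
  by rewrite -subr_eq0 addrK => /eqP.
- move=> b; apply: (fock_alg_ext (fock_rho_linearr 1) (g := fun=> 0)).
    by move=> k x y; rewrite scaler0 addr0.
  by move=> w; rewrite pw1 fock_rho_pword wrho_nil.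
Qed.

End SecondOrderSpace.

(** * Freeness *)

Section Spans.
Variables (K : pzRingType) (V : lmodType K).

Inductive lspan (S : set V) : set V :=
| lspan0 : lspan S 0
| lspan_cons k x y : S x -> lspan S y -> lspan S (k *: x + y).

Lemma lspan_in (S : set V) x : S x -> lspan S x.
Proof. by move=> Sx; rewrite -[x]scale1r -[_ *: _]addr0; apply: lspan_cons => //; exact: lspan0. Qed.

Lemma lspanP (S : set V) k x y : lspan S x -> lspan S y -> lspan S (k *: x + y).
Proof.
move=> Sx; elim: Sx y => [|l x' x'' Sx' _ IH] y Sy; first by rewrite scaler0 add0r.
by rewrite scalerDr scalerA -addrA; apply: lspan_cons => //; exact: IH.
Qed.

Lemma lspanD (S : set V) x y : lspan S x -> lspan S y -> lspan S (x + y).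
Proof. by rewrite -[x in x + y]scale1r; exact: lspanP. Qed.

Lemma lspanZ (S : set V) k x : lspan S x -> lspan S (k *: x).
Proof. by move=> Sx; rewrite -[_ *: _]addr0; apply: lspanP => //; exact: lspan0. Qed.

Lemma lspan_eq (W : lmodType K) (f g : V -> W) (S : set V) x :
  linear f -> linear g -> (forall y, S y -> f y = g y) -> lspan S x -> f x = g x.
Proof.
move=> lf lg fg; elim=> [|k y z Sy _ IH]; first by rewrite (linear_zero lf) (linear_zero lg).
by rewrite lf lg IH fg.
Qed.

End Spans.

Lemma lspan_map (K : pzRingType) (V W : lmodType K) (f : V -> W) (S : set V) (S' : set W) x :
  linear f -> (forall y, S y -> lspan S' (f y)) -> lspan S x -> lspan S' (f x).
Proof.
move=> lf SS'; elim=> [|k y z Sy _ IH]; first by rewrite (linear_zero lf); exact: lspan0.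
by rewrite lf; apply: lspanP => //; exact: SS'.
Qed.


(** P relates the lists s and xs entry by entry. *)
Fixpoint matched (I X : Type) (P : I -> X -> Prop) (s : seq I) (xs : seq X) : Prop :=
  match s, xs with
  | [::], [::] => True
  | i :: s', x :: xs' => P i x /\ matched P s' xs'
  | _, _ => False
  end.

Lemma matched_sub (I X Y : Type) (P : I -> X -> Prop) (Q : I -> Y -> Prop) (f : X -> Y) s xs :
  (forall i x, P i x -> Q i (f x)) -> matched P s xs -> matched Q s (map f xs).
Proof. by move=> PQ; elim: s xs => [|i s IH] [|x xs]//= [/PQ ? /IH]. Qed.

Lemma matched_cat (I X : Type) (P : I -> X -> Prop) s s' xs xs' :
  matched P s xs -> matched P s' xs' -> matched P (s ++ s') (xs ++ xs').
Proof. by elim: s xs => [|i s IH] [|x xs]//= [? /IH IHs] /IHs. Qed.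

Lemma matched_cat_inv (I X : Type) (P : I -> X -> Prop) s xs xs' :
  matched P s (xs ++ xs') -> exists s1 s2,
  [/\ s = s1 ++ s2, matched P s1 xs & matched P s2 xs'].
Proof.
elim: xs s => [|x xs IH] [|i s]//=; first by exists [::], [::].
  by exists [::], (i :: s).
move=> [Px /IH[s1 [s2 [-> m1 m2]]]]; by exists (i :: s1), s2.
Qed.

Lemma matched_rev (I X : Type) (P : I -> X -> Prop) s xs :
  matched P s xs -> matched P (rev s) (rev xs).
Proof.
elim: s xs => [|i s IH] [|x xs]//= [Pi /IH m]; rewrite !rev_cons -!cats1.
exact: matched_cat.
Qed.

Lemma matched_map (X Y Z : Type) (Q : Y -> Z -> Prop) (f : X -> Y) (g : X -> Z) l :
  (forall x, Q (f x) (g x)) -> matched Q (map f l) (map g l).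
Proof. by move=> Qfg; elim: l => //= x l IH; split. Qed.

Lemma nth_map_enum (X : Type) (x0 : X) n (f : 'I_n.+1 -> X) k : (k < n.+1)%N ->
  nth x0 [seq f i | i <- enum 'I_n.+1] k = f (inord k).
Proof.
move=> kn; rewrite (nth_map ord0); last by rewrite size_enum_ord.
by congr f; apply/val_inj; rewrite /= nth_enum_ord// inordK.
Qed.

Lemma rev_map_enum (X : Type) n (f : 'I_n.+1 -> X) :
  rev [seq f j | j <- enum 'I_n.+1] = [seq f (rev_ord j) | j <- enum 'I_n.+1].
Proof.
pose x0 := f ord0; apply: (@eq_from_nth _ x0); first by rewrite size_rev !size_map.
have sz : size [seq f j | j <- enum 'I_n.+1] = n.+1 by rewrite size_map size_enum_ord.
move=> j; rewrite size_rev sz => jn.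
rewrite nth_rev sz// nth_map_enum; last by rewrite ltn_subrL.
rewrite nth_map_enum//; congr f; apply/val_inj.
by rewrite /= !inordK// ltn_subrL.
Qed.

Lemma rev_ord_sub n (j k : 'I_n.+1) :
  rev_ord (j - k) = inord ((n - j + k) %% n.+1).
Proof.
apply/val_inj; rewrite /= inordK ?ltn_mod// subSS.
have [jn kn] := (ltn_ord j, ltn_ord k).
have [->|k0] := posnP k; first by rewrite subn0 modnn !addn0 !modn_small// ltnS leq_subr.
rewrite (@modn_small (n.+1 - k)); last by lia.
have [jk|kj] := ltnP j k.
  rewrite modn_small; last by lia.
  have -> : (n - j + k = n.+1 + (k - j.+1))%N by lia.
  by rewrite modnDl modn_small; lia.
have -> : (j + (n.+1 - k) = n.+1 + (j - k))%N by lia.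
by rewrite modnDl !modn_small; lia.
Qed.

Lemma rot_map_enum (X : Type) n (f : 'I_n.+1 -> X) (k : 'I_n.+1) :
  rot k [seq f j | j <- enum 'I_n.+1] = [seq f (j + k) | j <- enum 'I_n.+1].
Proof.
pose x0 := f ord0; apply: (@eq_from_nth _ x0); first by rewrite size_rot !size_map.
move=> j; rewrite size_rot size_map size_enum_ord => jn.
rewrite nth_map_enum// /rot nth_cat size_drop size_map size_enum_ord.
have kn := ltn_ord k.
case: ltnP => jk.
  rewrite nth_drop nth_map_enum; last lia.
  by congr f; apply/val_inj; rewrite /= !inordK ?modn_small//; lia.
rewrite nth_take; last lia.
rewrite nth_map_enum; last lia.
congr f; apply/val_inj; rewrite /= !inordK; [|lia|lia].
have -> : (j + k = n.+1 + (j - (n.+1 - k)))%N by lia.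
by rewrite modnDl modn_small//; lia.
Qed.

(** Two functions that are multilinear agree on lists of vectors, the k-th
    taken in the span of S_(i_k), as soon as they agree on lists of vectors
    of the S_(i_k). *)
Lemma multilinear_ext (K : comNzRingType) (V : lmodType K) (W : lmodType K) (I : Type)
    (S : I -> set V) (f g : seq V -> W) s :
  multilinear f -> multilinear g ->
  (forall xs, matched S s xs -> f xs = g xs) ->
  forall xs, matched (fun i => lspan (S i)) s xs -> f xs = g xs.
Proof.
move=> mf mg fg xs mxs.
suff gen pre : (forall ys, matched S s ys -> f (pre ++ ys) = g (pre ++ ys)) ->
    f (pre ++ xs) = g (pre ++ xs) by exact: (gen [::] fg).
elim: s xs mxs pre {fg} => [|i s IH] [|x xs]//= => [_ pre|[Sx m] pre fg].
  by move/(_ [::]); exact.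
apply: (lspan_eq (f := fun x => f (pre ++ x :: xs)) (g := fun x => g (pre ++ x :: xs)) _ _ _ Sx).
- by move=> k y z; rewrite mf.
- by move=> k y z; rewrite mg.
move=> y Sy; rewrite -!cat_rcons; apply: IH => // ys mys.
by rewrite !cat_rcons; apply: fg.
Qed.

Section Coloured.
Variables (R : rcfType) (D : starAlgType R) (psi : tracial_state D).
Variables (I : eqType) (d : I -> D).
Hypothesis orth : forall i j, i != j -> d i * d j = 0.
Local Notation C := R[i].
Local Notation F := (flin D).
Local Notation pois := (pois psi).
Local Notation cmap := (cmap psi).
Local Notation vac := (vac psi).
Local Notation letter := (I * nat)%type.
Implicit Types (i j : I) (l : letter) (w v : seq letter) (s : seq I) (t : F).

Local Arguments fock_fun : simpl never.
Let opD (a : fock_op D) (s t : F) : a (s + t) = a s + a t. Proof. exact: (linearD a). Qed.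
Let opZ (a : fock_op D) k t : a (k *: t) = k *: a t. Proof. by rewrite linearZ. Qed.

(** The powers of the d_i with positive exponent: the letter (i, k) stands for
    d_i^(k + 1). *)
Definition letter_val l : D := d l.1 ^+ l.2.+1.
Local Notation ev := letter_val.

Definition mono i w : bool := all (fun l => l.1 == i) w.
Definition run i w : bool := (w != [::]) && mono i w.

Lemma letter_orth l l' : l.1 != l'.1 -> ev l * ev l' = 0.
Proof. by move=> ll; rewrite /ev exprSr exprS -mulrA (mulrA (d l.1)) orth// mul0r mulr0. Qed.

Lemma letter_mul i k m : ev (i, k) * ev (i, m) = ev (i, (k + m).+1).
Proof. by rewrite /ev /= -exprD addSn addnS. Qed.

Definition tev w : F := tens (map ev w).
Definition mono_tens i : set F := [set t | exists2 w, mono i w & t = tev w].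
Definition run_tens i : set F := [set t | exists2 w, run i w & t = tev w].
(** Tensors that the algebra generated by p(d_i) cannot merge with. *)
Definition alien_tens i : set F :=
  [set t | exists l w, l.1 != i /\ t = tev (l :: w)].

Lemma tens0 (w1 w2 : seq D) : tens (w1 ++ 0 :: w2) = 0 :> F.
Proof.
have := @tens_multilinear _ D w1 w2 (-1) 0 0.
by rewrite scaler0 addr0 scaleN1r addNr.
Qed.

Lemma cyc0 (w1 w2 : seq D) : cyc (w1 ++ 0 :: w2) = 0.
Proof.
have [cm _] := @cyc_multilinear _ D; have := cm w1 w2 (-1) 0 0.
by rewrite scaler0 addr0 scaleN1r addNr.
Qed.

Lemma pois_mono i t : lspan (mono_tens i) t -> lspan (mono_tens i) (pois (d i) t).
Proof.
apply: lspan_map => [k x y|_ [w wi ->]]; first by rewrite opD opZ.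
have di : d i = ev (i, 0%N) by rewrite /ev expr1.
rewrite pois_split; apply: lspanD; [apply: lspanD|apply: lspanZ]; last first.
- by apply: lspan_in; exists w.
- case: w wi => [|l w] wi; first by rewrite contraction_vacuum; exact: lspan0.
  rewrite contractionE; apply/lspanZ/lspan_in; exists w => //.
  by case/andP: wi.
case: w wi => [|[j k] w] wi.
  rewrite opening_vacuum di; apply: lspan_in; exists [:: (i, 0%N)] => //.
  by rewrite /mono /= eqxx.
rewrite openingE; case/andP: (wi) => /= /eqP -> wi'; rewrite di letter_mul.
apply: lspanD; apply: lspan_in; [exists [:: (i, 0%N), (i, k) & w]|
  exists ((i, (0 + k).+1) :: w)] => //; by rewrite /mono /= eqxx.
Qed.

Local Notation gen i := (subalg_gen [set poisson psi (d i)]).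

Lemma fock_alg_pois e t : poisson psi e t = pois e t.
Proof. by rewrite /pois -lock. Qed.

Local Notation A := (fock_alg psi).
Lemma fock_algD (a b : A) t : (a + b) t = a t + b t. Proof. by []. Qed.
Lemma fock_algZ k (a : A) t : (k *: a) t = k *: a t. Proof. by []. Qed.
Lemma fock_algM (a b : A) t : (a * b) t = a (b t). Proof. by []. Qed.

Lemma gen_mono i a t : gen i a -> lspan (mono_tens i) t -> lspan (mono_tens i) (a t).
Proof.
move=> ga; elim: ga t => [_ ->||a' b _ IHa _ IHb|k a' _ IHa|a' b _ IHa _ IHb] t ti //.
- by rewrite fock_alg_pois; exact: pois_mono.
- by rewrite fock_algD; apply: lspanD; [exact: IHa|exact: IHb].
- by rewrite fock_algZ; apply: lspanZ; exact: IHa.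
- by rewrite fock_algM; apply: IHa; exact: IHb.
Qed.

Lemma mono_run i t : lspan (mono_tens i) t -> vac t = 0 -> lspan (run_tens i) t.
Proof.
move=> ti t0; suff [t' t'i tE] : exists2 t', lspan (run_tens i) t' & t = t' + vac t *: vacuum.
  by rewrite tE t0 scale0r addr0.
elim: ti {t0} => [|k _ y [w wi ->] _ [t' t'i yE]].
  exists 0; first exact: lspan0.
  by rewrite (linear_zero (vac_linear psi : linear (_ : F -> C^o))) scale0r addr0.
rewrite vac_linear vac_tens; case: w wi => [|l w] wi.
  by exists t' => //; rewrite {1}yE scalerDl mulr1 addrCA.
exists (k *: tev (l :: w) + t'); last by rewrite mulr0 add0r {1}yE addrA.
by apply: lspan_cons => //; exists (l :: w).
Qed.

Lemma fcat_pois_alien i (s t : F) : lspan (alien_tens i) t ->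
  fcat (pois (d i) s) t = pois (d i) (fcat s t).
Proof.
apply: (lspan_eq (g := fun t => pois (d i) (fcat s t))) => [||_ [l [w [li ->]]]].
  exact: fcat_linearr.
  by move=> k x y; rewrite fcat_linearr opD opZ.
have lF := fcat_linearl (tev (l :: w)).
have z : d i * ev l = 0 by rewrite -[d i]expr1; apply: (@letter_orth (i, 0%N)); rewrite eq_sym.
move: s; apply: flin_ext => [a x y|a x y|[|f v]].
- by rewrite opD opZ lF.
- by rewrite lF opD opZ.
- rewrite pois_split contraction_vacuum opening_vacuum addr0 (linear_add lF).
  rewrite (linear_scale lF) !fcat_tens /= creationE pois_split openingE contractionE.
  by rewrite z (linear0 psi) scale0r addr0 (tens0 [::]) addr0.
rewrite pois_split openingE contractionE !(linear_add lF) !(linear_scale lF) !fcat_tens.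
by rewrite !create_tens /= pois_split openingE contractionE.
Qed.

Lemma gen_fcat i a (s t : F) : gen i a -> lspan (alien_tens i) t ->
  a (fcat s t) = fcat (a s) t.
Proof.
move=> ga ti; have lF := fcat_linearl t.
elim: ga s => [_ ->|//|a' b _ IHa _ IHb|k a' _ IHa|a' b _ IHa _ IHb] s.
- by rewrite !fock_alg_pois fcat_pois_alien.
- by rewrite !fock_algD IHa IHb (linear_add lF).
- by rewrite !fock_algZ IHa (linear_scale lF).
- by rewrite !fock_algM IHb IHa.
Qed.

Definition bigcat (ts : seq F) : F := foldr (@fcat _ D) vacuum ts.

Lemma fcat_vacuum (s : F) : fcat s vacuum = s.
Proof.
move: s; apply: flin_ext => [|//|w]; first exact: fcat_linearl.
by rewrite fcat_tens create_tens cats0.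
Qed.

Definition headed i : set F := [set t | exists l w, l.1 = i /\ t = tev (l :: w)].

Lemma bigcat_headed i s ts : matched (fun i => lspan (run_tens i)) (i :: s) ts ->
  lspan (headed i) (bigcat ts).
Proof.
case: ts => //= t ts [ti m].
have {m} : lspan (fun t : F => exists w, t = tev w) (bigcat ts).
  elim: s ts m => [|j s IH] [|u ts]//= => [_|[uj /IH m]].
    by apply: lspan_in; exists [::].
  refine (lspan_map (f := fun u => fcat u (bigcat ts)) _ _ uj); first exact: fcat_linearl.
  move=> _ [w _ ->]; apply: (lspan_map (f := fcat (tev w)) _ _ m); first exact: fcat_linearr.
  by move=> _ [v ->]; apply: lspan_in; exists (w ++ v); rewrite fcat_tens create_tens -map_cat.
move: (bigcat ts) => u mu.
refine (lspan_map (f := fun t => fcat t u) _ _ ti); first exact: fcat_linearl.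
move=> _ [w /andP[w0 wi] ->]; apply: (lspan_map (f := fcat (tev w)) _ _ mu).
  exact: fcat_linearr.
move=> _ [v ->]; apply: lspan_in; case: w w0 wi => // l w _ /andP[/eqP li _].
by exists l, (w ++ v); rewrite li fcat_tens create_tens -map_cat.
Qed.

Lemma vac_bigcat s ts : s != [::] ->
  matched (fun i => lspan (run_tens i)) s ts -> vac (bigcat ts) = 0.
Proof.
case: s => // i s _ /bigcat_headed.
apply: (lspan_eq (f := vac : F -> C^o) (g := fun=> 0)) => [||_ [l [w [_ ->]]]].
- exact: vac_linear.
- by move=> k x y; rewrite scaler0 addr0.
- by rewrite vac_tens.
Qed.

Lemma prod_bigcat s (as_ : seq A) : sorted (fun i j => i != j) s ->
  matched (fun i a => gen i a /\ fock_phi psi a = 0) s as_ ->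
  matched (fun i => lspan (run_tens i)) s [seq (a : A) vacuum | a <- as_] /\
  (\prod_(a <- as_) a) vacuum = bigcat [seq (a : A) vacuum | a <- as_].
Proof.
move=> ss m; have mr : matched (fun i => lspan (run_tens i)) s [seq (a : A) vacuum | a <- as_].
  apply: matched_sub m => i a [ga a0]; apply: mono_run => //.
  by apply: gen_mono => //; apply: lspan_in; exists [::].
split=> //; elim: as_ s ss m mr => [|a as_ IH] [|i s]//= ss; first by rewrite big_nil.
move=> [[ga a0] m] [ai mr].
rewrite big_cons fock_algM (IH s (path_sorted ss))//.
case: s ss m mr => [|j s] /=.
  by case: as_ {IH} => // _ _ _; rewrite fcat_vacuum.
move=> /andP[ij ss] m mr.
have fv (u : F) : fcat vacuum u = u by rewrite fcat_tens.
have := bigcat_headed (mr : matched _ (j :: s) _); move: (bigcat _) => u uj.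
rewrite -{1}(fv u) (gen_fcat _ ga)//.
apply: (lspan_map (f := id)) uj => // _ [l [w [lj ->]]].
by apply: lspan_in; exists l, w; rewrite lj eq_sym.
Qed.

Definition run_cycs i : set (fcyc D) :=
  [set x | exists2 w, run i w & x = cyc (map ev w)].

Lemma cmap_mono_tens i w : mono i w -> lspan (run_cycs i) (cmap (tev w)).
Proof.
have [n] := ubnP (size w); elim: n w => // n IH [|l w] wn wi.
  by rewrite cmap_vacuum; exact: lspan0.
case/lastP: w wn wi => [|w l'] wn wi.
  by rewrite /tev /= cmap_tens1; apply: lspan_in; exists [:: l].
rewrite /tev /= map_rcons cmap_tens.
have := wi; rewrite /mono /= all_rcons => /and3P[/eqP li /eqP li' wi'].
case: l l' li li' wi wn => [_ k] [_ m] /= -> -> wi wn; rewrite letter_mul.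
apply: lspanD; [apply: lspanD; apply: lspan_in|apply: lspanZ; apply: IH => //].
- by exists ((i, k) :: rcons w (i, m)); rewrite //= map_rcons.
- by exists ((i, (m + k).+1) :: w) => //; rewrite /run /mono /= eqxx.
- by move: wn; rewrite /= size_rcons; lia.
Qed.

Lemma cmap_mono i t : lspan (mono_tens i) t -> lspan (run_cycs i) (cmap t).
Proof.
apply: lspan_map => [|_ [w wi ->]]; first exact: cmap_linear.
exact: cmap_mono_tens.
Qed.

Definition runs s ws : Prop := matched (fun i w => run i w) s ws.

(** On a cyclically alternating product the first and the last leg have
    different colours, so that c cannot join them. *)
Lemma cmap_alternating s ws : (1 < size s)%N -> cycle (fun i j => i != j) s ->
  runs s ws -> cmap (tev (flatten ws)) = cyc (map ev (flatten ws)).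
Proof.
case: s => [|i s]//=; case/lastP: s => // s j _.
rewrite rcons_path last_rcons => /andP[_ ji].
case: ws => // w1 ws; case/lastP: ws => [|ws w2]; first by move=> [_]; case: (s).
rewrite -!cats1 /runs /= => -[/andP[w10 w1i]].
move=> /matched_cat_inv [s1 [s2 [sE m1]]].
move=> m2; case: s2 sE m2 => [|j' [|j'' s2]] sE; [by []| |by case].
move: sE; rewrite !cats1 => /rcons_inj [_ <-] [/andP[w20 w2j] _].
rewrite flatten_rcons.
case: w1 w10 w1i => // l w1 _ /andP[/eqP li _].
case/lastP: w2 w20 w2j => // w2 l' _.
rewrite /mono all_rcons => /andP[/eqP l'j _].
rewrite /tev catA -rcons_cat cat_cons !rcons_cons /= map_rcons cmap_tens.
rewrite !letter_orth ?li ?l'j//; last by rewrite eq_sym.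
by rewrite (linear0 psi) scale0r addr0 (cyc0 [::]) addr0.
Qed.

End Coloured.

Lemma split_sum_flatten (V : nmodType) (X : Type) (G : seq X -> X -> seq X -> V) vs :
  split_sum G (flatten vs) = split_sum (fun us x zs =>
    split_sum (fun u y v => G (flatten us ++ u) y (v ++ flatten zs)) x) vs.
Proof.
elim: vs G => //= x vs IH G; rewrite split_sum_cat IH; congr (_ + _).
apply: eq_split_sum => us y zs; apply: eq_split_sum => u z v.
by rewrite catA.
Qed.

Section Pairing.
Variables (R : rcfType) (D : starAlgType R) (psi : tracial_state D).
Variables (I : eqType) (d : I -> D).
Hypothesis orth : forall i j, i != j -> d i * d j = 0.
Local Notation C := R[i].
Local Notation F := (flin D).
Local Notation A := (fock_alg psi).
Local Notation phi := (fock_phi psi).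
Local Notation rho := (fock_rho psi).
Local Notation cmap := (cmap psi).
Local Notation letter := (I * nat)%type.
Implicit Types (i j : I) (l : letter) (w v : seq letter) (s : seq I) (t : F).

Definition dstar i : D := star (d i).
Local Notation ev := (letter_val d).
Local Notation evS := (letter_val dstar).
Local Notation alt := (fun i j => i != j).

Lemma orth_star i j : i != j -> dstar i * dstar j = 0.
Proof.
move=> ij; rewrite /dstar -starM orth 1?eq_sym//.
by have := starZ (0 : C) (0 : D); rewrite conjC0 !scale0r.
Qed.

Lemma star_exp (x : D) n : star (x ^+ n) = star x ^+ n.
Proof. by elim: n => [|n IH]; rewrite ?expr0 ?star1// exprS starM IH -exprSr. Qed.

Lemma inner_orth l l' : l.1 != l'.1 -> inner psi (ev l) (evS l') = 0.
Proof.
move=> ll; rewrite /inner star_exp /dstar starK.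
rewrite -[_ * _]/(ev l' * ev l) letter_orth// ?linear0//.
by rewrite eq_sym.
Qed.

Definition pairing w v : C := word_inner psi (map ev w) (map evS v).

Lemma pairing_colour w v : pairing w v != 0 -> map fst w = map fst v.
Proof.
elim: w v => [|l w IH] [|l' v]; rewrite /pairing /= ?eqxx//.
rewrite mulf_eq0 negb_or => /andP[ll' /IH ->].
have [->//|/inner_orth] := eqVneq l.1 l'.1.
by move/eqP; rewrite (negbTE ll').
Qed.

Lemma map_fst_mono i w : mono i w -> map fst w = nseq (size w) i.
Proof. by elim: w => //= l w IH /andP[/eqP -> /IH ->]. Qed.

(** Two words that start with runs of letters can only be paired when the
    runs are paired with each other. *)
Lemma pairing_cat i j w v w' v' : run i w -> run j v ->
  (head i (map fst w') != i) || (w' == [::]) ->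
  (head j (map fst v') != j) || (v' == [::]) ->
  pairing (w ++ w') (v ++ v') = pairing w v * pairing w' v'.
Proof.
move=> /andP[w0 wi] /andP[v0 vj].
have [ij|ij] := eqVneq i j; last first.
  case: w w0 wi => // l w _ /andP[/eqP li _]; case: v v0 vj => // l' v _ /andP[/eqP lj _].
  by rewrite /pairing /= inner_orth ?mul0r// li lj.
rewrite -{}ij in vj * => hw hv {w0 v0}; elim: w v wi vj => [|l w IH] [|l' v] wi vj.
- by rewrite {2}/pairing /= mul1r.
- case: w' hw {hv} => [|l w'] /=; first by rewrite /pairing /= mul0r.
  rewrite orbF => li; rewrite /pairing /= inner_orth ?mul0r//.
  by case/andP: vj => /eqP ->.
- case: v' hv {hw IH} => [|l' v'] /=; first by rewrite /pairing /= mul0r.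
  rewrite orbF => li; rewrite /pairing /= inner_orth ?mul0r//.
  by case/andP: wi => /eqP ->; rewrite eq_sym.
- rewrite /pairing /= -mulrA; congr (_ * _).
  by apply: IH; [case/andP: wi|case/andP: vj].
Qed.

Fixpoint zip_prod (X Y : Type) (f : X -> Y -> C) (xs : seq X) (ys : seq Y) : C :=
  match xs, ys with
  | [::], [::] => 1
  | x :: xs', y :: ys' => f x y * zip_prod f xs' ys'
  | _, _ => 0
  end.

Lemma head_runs i s ws : runs s ws -> path alt i s ->
  (head i (map fst (flatten ws)) != i) || (flatten ws == [::]).
Proof.
case: s ws => [|j s] [|w ws]//=; first by rewrite eqxx orbT.
move=> [/andP[w0 wj] _] /andP[ij _].
by case: w w0 wj => // l w _ /andP[/eqP /= -> _]; rewrite eq_sym ij.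
Qed.

Lemma pairing_flatten s s' ws vs : sorted alt s -> sorted alt s' ->
  runs s ws -> runs s' vs ->
  pairing (flatten ws) (flatten vs) = zip_prod pairing ws vs.
Proof.
elim: s s' ws vs => [|i s IH] [|j s'] [|w ws] [|v vs]//= ss ss'.
- by move=> _ [/andP[v0 _] _]; case: v v0.
- by move=> [/andP[w0 _] _] _; case: w w0.
move=> [wi mw] [vj mv].
rewrite (pairing_cat wi vj); try exact: head_runs; try exact: (head_runs mw ss);
  try exact: (head_runs mv ss').
by rewrite (IH s')//; [exact: path_sorted ss|exact: path_sorted ss'].
Qed.

Lemma zip_prod_colour s s' ws vs : runs s ws -> runs s' vs ->
  zip_prod pairing ws vs != 0 -> s = s'.
Proof.
elim: s s' ws vs => [|i s IH] [|j s'] [|w ws] [|v vs]//=; rewrite ?eqxx//.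
move=> [/andP[w0 wi] mw] [/andP[v0 vj] mv].
rewrite mulf_eq0 negb_or => /andP[/pairing_colour wv /(IH _ _ _ mw mv) ->].
congr (_ :: _); move: wv; rewrite (map_fst_mono wi) (map_fst_mono vj).
by case: w w0 {wi} => // l w _; case: v v0 {vj} => // l' v _ [].
Qed.

(** Of the rotations of the second word only those that cut it between two
    runs contribute, as the others start and end in the same colour. *)
Lemma cyc_pairing s s' ws vs : (1 < size s)%N -> (1 < size s')%N ->
  cycle alt s -> cycle alt s' -> runs s ws -> runs s' vs ->
  cyc_word_inner psi (map ev (flatten ws)) (map evS (flatten vs)) =
  split_sum (fun us x zs => zip_prod pairing ws (x :: zs ++ us)) vs.
Proof.
move=> s2 s2' cs cs' mw mv.
rewrite /cyc_word_inner big_rot split_sum_map.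
rewrite (@eq_split_sum _ _ _ (fun u y v => pairing (flatten ws) (y :: v ++ u))); last first.
  by move=> u y v; rewrite /pairing /= map_cat.
rewrite split_sum_flatten; apply: eq_split_sum_in => us x zs vsE.
have ss : sorted alt s by case: (s) cs => //= i s0; rewrite rcons_path => /andP[].
have [s1 [s3 [sE m1]]] := matched_cat_inv (eq_ind _ (fun vs => runs s' vs) mv _ vsE).
case: s3 sE => // j s3 sE [/andP[x0 xj] m3].
have cj : path alt j (rcons (s3 ++ s1) j).
  by move: cs'; rewrite sE -(rot_cycle (size s1)) rot_size_cat.
have mzu : runs (s3 ++ s1) (zs ++ us) by exact: matched_cat.
have sx : sorted alt (j :: s3 ++ s1) by move: cj; rewrite rcons_path => /andP[].
have jx : runs (j :: s3 ++ s1) (x :: zs ++ us) by split=> //; exact/andP.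
pose G u y v := pairing (flatten ws) (y :: (v ++ flatten zs) ++ flatten us ++ u).
rewrite -/(split_sum G x); case: x x0 xj vsE jx => // y0 x _ xj vsE jx.
transitivity (G [::] y0 x + split_sum (fun u => G (y0 :: u)) x); first by [].
rewrite -[RHS]addr0; congr (_ + _).
  by rewrite -(pairing_flatten ss sx mw jx) /G cats0 -catA -flatten_cat.
rewrite -[RHS](@split_sum0 _ _ x); apply: eq_split_sum_in => u y v xE.
have mvu : runs (j :: rcons (s3 ++ s1) j) ((y :: v) :: rcons (zs ++ us) (y0 :: u)).
  move: xj; rewrite /mono /= xE all_cat /= => /and4P[y0j uj yj vj].
  split; first by rewrite /run /mono /= yj vj.
  rewrite -!cats1; apply: matched_cat => //=; split=> //.
  by rewrite /run /mono /= y0j uj.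
have -> : G (y0 :: u) y v = pairing (flatten ws)
    (flatten ((y :: v) :: rcons (zs ++ us) (y0 :: u))).
  by rewrite /G [in RHS]/= flatten_rcons flatten_cat -!catA.
rewrite (pairing_flatten ss _ mw mvu)//.
apply/eqP; case: eqP => // /eqP /(zip_prod_colour mw mvu) sE'.
by move: cs; rewrite sE' /= rcons_path last_rcons eqxx andbF.
Qed.

Definition zip_inner : seq F -> seq F -> C := zip_prod (flin_inner psi).

Lemma zip_inner_multilinear ts : multilinear ((zip_inner^~ ts) : seq F -> C^o).
Proof.
move=> w1; elim: w1 ts => [|x w1 IH] [|y ts] w2 a t t' /=.
- by rewrite /zip_inner /= scaler0 addr0.
- by rewrite /zip_inner /= flin_inner_linear mulrDl scalerAl.
- by rewrite /zip_inner /= scaler0 addr0.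
- by rewrite /zip_inner /= -!/(zip_inner _ _) IH mulrDr scalerAr.
Qed.

Lemma zip_inner_conj ts us : (zip_inner ts us)^* = zip_inner us ts.
Proof.
elim: ts us => [|t ts IH] [|u us]; rewrite /zip_inner /= ?conjC0 ?conjC1//.
by rewrite rmorphM /= -flin_inner_conj -!/(zip_inner _ _) IH.
Qed.

Definition cyc_zip (ts us : seq F) : C :=
  split_sum (fun us1 u us2 => zip_inner ts (u :: us2 ++ us1)) us.

Lemma cyc_zip_multilinearl us : multilinear ((cyc_zip^~ us) : seq F -> C^o).
Proof.
move=> w1 w2 a t t'; rewrite /cyc_zip scaler_split_sum -split_sumD.
by apply: eq_split_sum => u1 u u2; rewrite zip_inner_multilinear.
Qed.

Lemma cyc_zip_multilinearr ts :
  multilinear ((fun us => (cyc_zip ts us)^*) : seq F -> C^o).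
Proof.
have conj_split (G : seq F -> F -> seq F -> C) us : (split_sum G us)^* =
    split_sum (fun u1 u u2 => (G u1 u u2)^*) us.
  by elim: us G => [|u us IH] G /=; rewrite ?conjC0// rmorphD /= IH.
have -> : (fun us => (cyc_zip ts us)^*) =
    split_sum (fun u1 u u2 => zip_inner (u :: u2 ++ u1) ts).
  apply/funext => us; rewrite /cyc_zip conj_split; apply: eq_split_sum => u1 u u2.
  exact: zip_inner_conj.
apply: rotation_sum_multilinear (zip_inner_multilinear ts).
Qed.

Lemma bigcat_multilinear : multilinear (@bigcat R D).
Proof.
move=> w1; elim: w1 => [|x w1 IH] w2 a t t' /=; first exact: fcat_linearl.
by rewrite /bigcat /= -!/(bigcat _) IH fcat_linearr.
Qed.

Lemma runs_tens (e : I -> D) s ts : matched (run_tens e) s ts ->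
  exists2 ws, runs s ws & ts = map (tev e) ws.
Proof.
elim: s ts => [|i s IH] [|t ts]//=; first by exists [::].
by move=> [[w wi ->] /IH[ws mw ->]]; exists (w :: ws).
Qed.

Lemma bigcat_tev (e : I -> D) ws : bigcat (map (tev e) ws) = tev e (flatten ws).
Proof.
elim: ws => //= w ws IH; rewrite /bigcat /= -/(bigcat _) IH.
by rewrite fcat_tens create_tens -map_cat.
Qed.

Lemma cyc_inner_ext s s' (g : seq F -> seq F -> C) :
  (forall us, multilinear ((g^~ us) : seq F -> C^o)) ->
  (forall ts, multilinear ((fun us => (g ts us)^*) : seq F -> C^o)) ->
  (forall ws vs, runs s ws -> runs s' vs ->
     fcyc_inner psi (cmap (tev d (flatten ws))) (cmap (tev dstar (flatten vs))) =
     g (map (tev d) ws) (map (tev dstar) vs)) ->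
  forall ts us,
  matched (fun i => lspan (run_tens d i)) s ts ->
  matched (fun i => lspan (run_tens dstar i)) s' us ->
  fcyc_inner psi (cmap (bigcat ts)) (cmap (bigcat us)) = g ts us.
Proof.
move=> gl gr gE ts us mts mus.
have bm := bigcat_multilinear.
apply: (multilinear_ext (f := fun ts => fcyc_inner psi (cmap (bigcat ts)) (cmap (bigcat us)) : C^o)
  (g := (g^~ us) : seq F -> C^o) _ _ _ mts) => [w1 w2 a t t'|//|{mts}ts mts].
  by rewrite bm cmap_linear fcyc_inner_linear.
apply: (can_inj conjCK).
apply: (multilinear_ext (f := fun us => (fcyc_inner psi (cmap (bigcat ts)) (cmap (bigcat us)))^* : C^o)
  (g := fun us => (g ts us)^* : C^o) _ _ _ mus) => [w1 w2 a t t'|//|{mus}us mus].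
  by rewrite bm cmap_linear fcyc_inner_antilinear rmorphD rmorphM /= conjCK.
have [ws mw ->] := runs_tens mts; have [vs mv ->] := runs_tens mus.
by rewrite !bigcat_tev gE.
Qed.

(** What second order freeness asserts, for the vectors a_k Omega and
    b_k^* Omega, with the sum over k written as a sum over rotations. *)
Lemma cyc_inner_bigcat s s' ts us : (1 < size s)%N -> (1 < size s')%N ->
  cycle alt s -> cycle alt s' ->
  matched (fun i => lspan (run_tens d i)) s ts ->
  matched (fun i => lspan (run_tens dstar i)) s' us ->
  fcyc_inner psi (cmap (bigcat ts)) (cmap (bigcat us)) = cyc_zip ts us.
Proof.
move=> s2 s2' cs cs' mts mus; apply: cyc_inner_ext mts mus => [||ws vs mw mv].
- exact: cyc_zip_multilinearl.
- exact: cyc_zip_multilinearr.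
rewrite (cmap_alternating psi orth s2 cs mw) (cmap_alternating psi orth_star s2' cs' mv).
rewrite fcyc_inner_cyc (cyc_pairing s2 s2' cs cs' mw mv) /cyc_zip split_sum_map.
apply: eq_split_sum => us1 x us2; rewrite -map_cat -map_cons.
elim: ws (x :: _) {mw} => [|w ws IH] [|v zs]//=.
by rewrite /zip_inner /= flin_inner_tens -/(pairing _ _) IH.
Qed.

Lemma cyc_pairing_colour w v :
  cyc_word_inner psi (map ev w) (map evS v) != 0 -> perm_eq (map fst w) (map fst v).
Proof.
rewrite /cyc_word_inner; apply: contraNT => wv; apply/eqP/big1 => k _.
apply/eqP; apply: contraNT wv; rewrite -map_rot => /pairing_colour ->.
by rewrite map_rot perm_rot.
Qed.

Lemma lspan_inner0 (S S' : set (fcyc D)) x y :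
  (forall x' y', S x' -> S' y' -> fcyc_inner psi x' y' = 0) ->
  lspan S x -> lspan S' y -> fcyc_inner psi x y = 0.
Proof.
have l0 a (z z' : C^o) : 0 = a *: 0 + 0 :> C^o by rewrite scaler0 addr0.
move=> SS Sx Sy.
apply: (lspan_eq (f := fun x => fcyc_inner psi x y : C^o) (g := fun=> 0) _ _ _ Sx) => [||x' Sx'].
- exact: fcyc_inner_linear.
- by move=> a z z'; rewrite scaler0 addr0.
apply: (can_inj conjCK); rewrite conjC0.
apply: (lspan_eq (f := fun y => (fcyc_inner psi x' y)^* : C^o) (g := fun=> 0) _ _ _ Sy) => [||y' Sy'].
- by move=> a z z'; rewrite fcyc_inner_antilinear rmorphD rmorphM /= conjCK.
- by move=> a z z'; rewrite scaler0 addr0.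
- by rewrite SS// conjC0.
Qed.

Lemma cyc_inner_mono0 i j t u : i != j ->
  lspan (mono_tens d i) t -> lspan (mono_tens dstar j) u ->
  fcyc_inner psi (cmap t) (cmap u) = 0.
Proof.
move=> ij ti uj.
apply: lspan_inner0 (cmap_mono psi ti) (cmap_mono psi uj).
move=> _ _ [w /andP[w0 wi] ->] [v /andP[v0 vj] ->]; rewrite fcyc_inner_cyc.
apply/eqP; apply: contraNT ij => /cyc_pairing_colour /perm_mem.
rewrite (map_fst_mono wi) (map_fst_mono vj) => /(_ i).
by rewrite !mem_nseq eqxx !lt0n !size_eq0 w0 v0 /= => /esym.
Qed.

Lemma runs_mem s ws j : runs s ws -> j \in s -> j \in map fst (flatten ws).
Proof.
elim: s ws => [|i s IH] [|w ws]//= [/andP[w0 wi] mw].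
rewrite inE map_cat mem_cat => /orP[/eqP ->|/(IH _ mw) ->]; last by rewrite orbT.
by rewrite (map_fst_mono wi) mem_nseq eqxx andbT lt0n size_eq0 w0.
Qed.

Lemma alternating_not_mono i s ws w : (1 < size s)%N -> cycle alt s -> runs s ws ->
  mono i w -> ~ perm_eq (map fst w) (map fst (flatten ws)).
Proof.
case: s => [|j [|k s]]//= _ /andP[jk _] mw wi /perm_mem pw.
have only (m : I) : m \in [:: j, k & s] -> m = i.
  move=> /(runs_mem mw); rewrite -pw (map_fst_mono wi) mem_nseq.
  by move=> /andP[_ /eqP].
have ji : j = i by apply: only; rewrite inE eqxx.
have ki : k = i by apply: only; rewrite !inE eqxx orbT.
by rewrite ji ki eqxx in jk.
Qed.

Lemma cyc_inner_mono_alternating i s t us : (1 < size s)%N -> cycle alt s ->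
  lspan (run_tens d i) t -> matched (fun i => lspan (run_tens dstar i)) s us ->
  fcyc_inner psi (cmap t) (cmap (bigcat us)) = 0.
Proof.
move=> s2 cs ti mus; rewrite -[t]fcat_vacuum -[fcat t _]/(bigcat [:: t]).
have z0 : multilinear ((fun=> 0) : seq F -> C^o).
  by move=> w1 w2 a x y; rewrite scaler0 addr0.
apply: (cyc_inner_ext (s := [:: i]) (g := fun _ _ => 0)) mus => //.
  by move=> ts; rewrite conjC0.
move=> [|w [|w' ws]] vs; [by []| |by case] => -[/andP[_ wi] _] mv.
rewrite (_ : flatten [:: w] = w); last exact: cats0.
rewrite (cmap_alternating psi orth_star s2 cs mv).
apply: (lspan_inner0 _ (cmap_mono_tens psi d wi) (lspan_in (erefl : [set cyc (map evS (flatten vs))] _))).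
move=> _ _ [w' /andP[_ w'i] ->] ->; rewrite fcyc_inner_cyc.
apply/eqP; case: eqP => // /eqP /cyc_pairing_colour.
by move/(alternating_not_mono s2 cs mv w'i).
Qed.

Lemma cyc_inner_alternating_mono i s ts u : (1 < size s)%N -> cycle alt s ->
  matched (fun i => lspan (run_tens d i)) s ts -> lspan (run_tens dstar i) u ->
  fcyc_inner psi (cmap (bigcat ts)) (cmap u) = 0.
Proof.
move=> s2 cs mts ui; rewrite -[u]fcat_vacuum -[fcat u _]/(bigcat [:: u]).
have z0 : multilinear ((fun=> 0) : seq F -> C^o).
  by move=> w1 w2 a x y; rewrite scaler0 addr0.
apply: (cyc_inner_ext (s' := [:: i]) (g := fun _ _ => 0)) mts _ => //.
  by move=> us; rewrite conjC0.
move=> vs [|w [|w' ws]] mv; [by []| |by case] => -[/andP[_ wi] _].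
rewrite (_ : flatten [:: w] = w); last exact: cats0.
rewrite (cmap_alternating psi orth s2 cs mv).
apply: (lspan_inner0 _ (lspan_in (erefl : [set cyc (map ev (flatten vs))] _)) (cmap_mono_tens psi dstar wi)).
move=> _ _ -> [w' /andP[_ w'i] ->]; rewrite fcyc_inner_cyc.
apply/eqP; case: eqP => // /eqP /cyc_pairing_colour; rewrite perm_sym.
by move/(alternating_not_mono s2 cs mv w'i).
Qed.
Local Notation gen i := (subalg_gen [set poisson psi (d i)]).
Local Notation genS i := (subalg_gen [set poisson psi (dstar i)]).

Lemma gen_star i (a : A) : gen i a -> genS i (star a).
Proof.
elim=> [_ ->||b c _ IHb _ IHc|k b _ IHb|b c _ IHb _ IHc].
- by rewrite star_poisson; exact: subalg_gen_in.
- have -> : star (1 : A) = 1 by exact/fock_starE/adjoint1.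
  exact: subalg_gen1.
- by rewrite starD; exact: subalg_genD.
- by rewrite starZ; exact: subalg_genZ.
- by rewrite starM; exact: subalg_genM.
Qed.

Lemma fock_star_adjoint (b : A) (s t : F) :
  flin_inner psi (b s) t = flin_inner psi s ((star b : A) t).
Proof.
have lf : linear (fun b : A => flin_inner psi (b s) t : C^o).
  by move=> k x y; rewrite fock_algD fock_algZ flin_inner_linear.
have lg : linear (fun b : A => flin_inner psi s ((star b : A) t) : C^o).
  move=> k x y; rewrite starD starZ fock_algD fock_algZ flin_inner_antilinear.
  by rewrite conjCK.
apply: (fock_alg_ext lf lg) => w.
have -> : star (pword psi w) = pword psi (word_star w).
  apply: fock_starE; apply/adjoint_relP; exists [:: (1, w)].
  by rewrite /fcomb_star /= conjC1 !fcomb_eval1.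
by rewrite !pword_act pact_adjoint.
Qed.

Lemma fock_phi_inner (a b : A) :
  flin_inner psi (a vacuum) ((star b : A) vacuum) = phi (a * b).
Proof.
rewrite -fock_star_adjoint (so_phi_tracial (fock_second_order_space psi)).
by rewrite /fock_phi fock_algM.
Qed.

Lemma fock_phi_star (a : A) : phi (star a) = (phi a)^*.
Proof. by rewrite /fock_phi flin_inner_conj -fock_star_adjoint. Qed.

Lemma prod_star (as_ : seq A) :
  star (\prod_(a <- as_) a) = \prod_(a <- rev (map star as_)) (a : A).
Proof.
elim: as_ => [|a as_ IH]; first by rewrite !big_nil; exact/fock_starE/adjoint1.
by rewrite big_cons starM IH /= rev_cons big_rcons.
Qed.

Section Families.
Variables (n : nat) (a : 'I_n.+1 -> A).
Hypothesis ca : centered phi a.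
Let as_ := [seq a k | k <- enum 'I_n.+1].

Lemma alternating_seq : Defs.alternating (fun i => gen i) a -> exists2 s, sorted alt s &
  size s = n.+1 /\ matched (fun i a => gen i a /\ phi a = 0) s as_.
Proof.
move=> [i [Bi ai]]; exists [seq i k | k <- enum 'I_n.+1]; last first.
  rewrite size_map size_enum_ord; split=> //.
  by apply: matched_map => k; split; [exact: Bi|exact: ca].
apply/(sortedP (i ord0)) => k; rewrite size_map size_enum_ord => kn.
have kn' : (k < n.+1)%N by exact: ltnW.
by rewrite !nth_map_enum//; apply: ai; rewrite !inordK.
Qed.

Lemma cyclically_alternating_seq : cyclically_alternating (fun i => gen i) a ->
  exists s, [/\ sorted alt s, (0 < n)%N -> cycle alt s, size s = n.+1 &
    matched (fun i a => gen i a /\ phi a = 0) s as_].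
Proof.
move=> [i [Bi ai]].
have sz : size [seq i k | k <- enum 'I_n.+1] = n.+1 by rewrite size_map size_enum_ord.
have m : matched (fun i a => gen i a /\ phi a = 0) [seq i k | k <- enum 'I_n.+1] as_.
  by apply: matched_map => k; split; [exact: Bi|exact: ca].
have [n0|n0] := posnP n.
  exists [seq i k | k <- enum 'I_n.+1]; split=> //.
  by move: (map _ _) sz {m} => l; rewrite n0; case: l => [|? [|? ?]].
have cs : cycle alt [seq i k | k <- enum 'I_n.+1].
  have nthE k : (k < n.+1)%N -> nth (i ord0) (map i (enum 'I_n.+1)) k = i (inord k).
    exact: nth_map_enum.
  case sE : (map i (enum 'I_n.+1)) sz nthE => [|x s] // sz nthE /=.
  apply/(pathP (i ord0)) => k; rewrite size_rcons -[(size s).+1]/(size (x :: s)) sz => kn.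
  rewrite -rcons_cons nth_rcons sz kn nthE//.
  have -> : nth (i ord0) (rcons s x) k = i (ordS (inord k)).
    rewrite nth_rcons; move: sz => [sz]; rewrite sz.
    have [kn'|] := ltnP k n.
      rewrite -[nth _ s k]/(nth (i ord0) (x :: s) k.+1) nthE//; congr i.
      by apply/val_inj; rewrite /= !inordK// modn_small.
    move=> nk; have kE : k = n by apply/eqP; rewrite eqn_leq nk -ltnS kn.
    rewrite [k == n](introT eqP kE).
    have -> : x = i (inord 0) by rewrite -(nthE 0%N).
    congr i; apply/val_inj; rewrite /= !inordK//; first by rewrite kE modnn.
  exact: ai.
exists (map i (enum 'I_n.+1)); split=> //.
by case: map cs => //= x s; rewrite rcons_path => /andP[].
Qed.

Lemma prod_enum : \prod_(k < n.+1) a k = \prod_(a <- as_) a.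
Proof. by rewrite /as_ [RHS]big_map enumT [index_enum _]unlock. Qed.

End Families.

Lemma alt_sym : symmetric (fun i j : I => i != j).
Proof. by move=> i j; rewrite eq_sym. Qed.

Lemma matched_star s (as_ : seq A) :
  matched (fun i a => gen i a /\ phi a = 0) s as_ ->
  matched (fun i a => genS i a /\ phi a = 0) (rev s) (rev (map star as_)).
Proof.
move=> m; apply: matched_rev; apply: matched_sub m => i a [ga a0].
by split; [exact: gen_star|rewrite fock_phi_star a0 conjC0].
Qed.

Lemma zip_prod_size (X Y : Type) (f : X -> Y -> C) (xs : seq X) (ys : seq Y) :
  size xs != size ys -> zip_prod f xs ys = 0.
Proof.
elim: xs ys => [|x xs IH] [|y ys] //= sxy.
by rewrite IH ?mulr0.
Qed.

Lemma zip_prod_map (X Y Z : Type) (f : X -> Y -> C) (g : Z -> X) (h : Z -> Y) (l : seq Z) :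
  zip_prod f (map g l) (map h l) = \prod_(z <- l) f (g z) (h z).
Proof. by elim: l => [|z l IH] /=; rewrite ?big_nil// big_cons IH. Qed.

Lemma bigcat_single (e : I -> D) s ts : size s = 1%N ->
  matched (fun i => lspan (run_tens e i)) s ts ->
  exists i, lspan (run_tens e i) (bigcat ts).
Proof.
case: s ts => [|i [|j s]] [|t [|u ts]] // _ [ti m]; last by case: m.
by exists i; rewrite [bigcat _]fcat_vacuum.
Qed.

(** A centered element of A_i maps the vacuum to a combination of tensors of
    positive powers of d_i.  As d_i d_j = 0, an alternating product of such
    elements maps it to the tensor product of these vectors, which has no
    vacuum component; on a cyclically alternating product, c merely makes that
    tensor cyclic, and two cyclic tensors pair run by run. *)
Theorem fock_free : free_second_order phi rho (fun i => gen i).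
Proof.
have factor n (a : 'I_n.+1 -> A) s : sorted alt s -> size s = n.+1 ->
    matched (fun i a => gen i a /\ phi a = 0) s [seq a k | k <- enum 'I_n.+1] ->
    matched (fun i => lspan (run_tens d i)) s [seq a k vacuum | k <- enum 'I_n.+1] /\
    (\prod_(k < n.+1) a k) vacuum = bigcat [seq a k vacuum | k <- enum 'I_n.+1].
  move=> ss _ /(prod_bigcat orth ss); rewrite -map_comp => -[m E].
  by rewrite prod_enum.
have factorS n (b : 'I_n.+1 -> A) s : sorted alt s -> size s = n.+1 ->
    matched (fun i a => gen i a /\ phi a = 0) s [seq b k | k <- enum 'I_n.+1] ->
    let us := [seq (star (b (rev_ord k)) : A) vacuum | k <- enum 'I_n.+1] in
    matched (fun i => lspan (run_tens dstar i)) (rev s) us /\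
    (star (\prod_(k < n.+1) b k) : A) vacuum = bigcat us.
  move=> ss sz m us; have srev : sorted alt (rev s).
    by rewrite rev_sorted (eq_sorted (e' := alt)) // => i j; exact: alt_sym.
  have := prod_bigcat orth_star srev (matched_star m).
  rewrite -prod_star -prod_enum.
  suff -> : [seq (a : A) vacuum | a <- rev (map star [seq b k | k <- enum 'I_n.+1])] = us by [].
  by rewrite -[map star _]map_comp rev_map_enum -map_comp.
have vgen i (a : A) : gen i a -> lspan (mono_tens d i) (a vacuum).
  by move=> ga; apply: gen_mono => //; apply: lspan_in; exists [::].
have vgenS i (a : A) : genS i a -> lspan (mono_tens dstar i) (a vacuum).
  by move=> ga; apply: gen_mono => //; apply: lspan_in; exists [::].
split=> [n a ca aa|n m a b ca aa cb ab nm|i j a b ij ga gb|n a b n0 ca aa cb ab].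
- have [s ss [sz m]] := alternating_seq ca aa.
  have [mr E] := factor n a s ss sz m.
  rewrite /fock_phi E; apply: vac_bigcat mr.
  by rewrite -size_eq0 sz.
- have [s [ss cs sz ms]] := cyclically_alternating_seq ca aa.
  have [s' [ss' cs' sz' ms']] := cyclically_alternating_seq cb ab.
  have [mr E] := factor n a s ss sz ms.
  have [mr' E'] := factorS m b s' ss' sz' ms'.
  rewrite /fock_rho E E'.
  have [n0|n0] := posnP n.
    have m0 : (0 < m)%N by rewrite lt0n -n0 eq_sym.
    rewrite n0 in sz; have [i ti] := bigcat_single sz mr.
    apply: (cyc_inner_mono_alternating _ _ ti mr'); first by rewrite size_rev sz'.
    by rewrite rev_cycle (eq_cycle (e' := alt)) ?cs' // => j k; exact: alt_sym.
  have cS : (0 < m)%N -> cycle alt (rev s').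
    by rewrite rev_cycle (eq_cycle (e' := alt)) // => j k; exact: alt_sym.
  have [m0|m0] := posnP m.
    rewrite m0 -(size_rev s') in sz'; have [i ui] := bigcat_single sz' mr'.
    by apply: (cyc_inner_alternating_mono _ _ mr ui); rewrite ?sz// cs.
  rewrite (cyc_inner_bigcat _ _ (cs n0) (cS m0) mr mr') ?size_rev ?sz ?sz'//.
  rewrite /cyc_zip -big_rot big1// => k _; rewrite /zip_inner.
  apply: zip_prod_size.
  by rewrite size_rot (size_map _ (enum 'I_n.+1)) (size_map _ (enum 'I_m.+1)) !size_enum_ord eqSS.
- rewrite /fock_rho; apply: (cyc_inner_mono0 ij); first exact: vgen.
  by apply: vgenS; exact: gen_star.
have [s [ss cs sz ms]] := cyclically_alternating_seq ca aa.
have [s' [ss' cs' sz' ms']] := cyclically_alternating_seq cb ab.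
have [mr E] := factor n a s ss sz ms.
have [mr' E'] := factorS n b s' ss' sz' ms'.
have cS : cycle alt (rev s').
  by rewrite rev_cycle (eq_cycle (e' := alt)) ?cs' // => j k; exact: alt_sym.
rewrite /fock_rho E E' (cyc_inner_bigcat _ _ (cs n0) cS mr mr') ?size_rev ?sz ?sz'//.
rewrite /cyc_zip -big_rot -(big_mkord xpredT (fun k => zip_inner _ (rot k _))).
rewrite size_map size_enum_ord big_mkord (reindex_inj (@oppr_inj 'I_n.+1)) /=.
apply: eq_bigr => k _; rewrite (@rot_map_enum _ n _ (- k)) /zip_inner zip_prod_map.
rewrite big_enum; apply: eq_bigr => j _ /=.
by rewrite fock_phi_inner rev_ord_sub.
Qed.

End Pairing.

(** * Moments and cumulants *)

(** ** Functions of lists and their convolution *)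

Section Convolution.
Variables (K : comNzRingType) (W : Type).
Implicit Types (F G H : seq W -> K) (ws : seq W).

(** The sum, over the ways of distributing the entries of a list over two
    lists, of F at the first list times G at the second. *)
Fixpoint conv F G ws : K :=
  if ws is w :: ws' then
    conv (fun vs => F (w :: vs)) G ws' + conv F (fun vs => G (w :: vs)) ws'
  else F [::] * G [::].

Lemma eq_conv_in F F' G G' ws :
  (forall vs, (size vs <= size ws)%N -> F vs = F' vs) ->
  (forall vs, (size vs <= size ws)%N -> G vs = G' vs) ->
  conv F G ws = conv F' G' ws.
Proof.
elim: ws F F' G G' => [|w ws IH] F F' G G' FF' GG' /=; first by rewrite FF'// GG'.
by congr (_ + _); apply: IH => vs vws; (apply: FF' || apply: GG') => //; exact: leqW.
Qed.

Lemma eq_conv F F' G G' ws : F =1 F' -> G =1 G' -> conv F G ws = conv F' G' ws.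
Proof. by move=> FF' GG'; apply: eq_conv_in => vs _. Qed.

Lemma convDl F F' G ws : conv (fun vs => F vs + F' vs) G ws = conv F G ws + conv F' G ws.
Proof.
elim: ws F F' G => [|w ws IH] F F' G /=; first by rewrite mulrDl.
by rewrite !IH addrACA.
Qed.

Lemma convC F G ws : conv F G ws = conv G F ws.
Proof.
elim: ws F G => [|w ws IH] F G /=; first exact: mulrC.
by rewrite addrC; congr (_ + _); exact: IH.
Qed.

Lemma convDr F G G' ws : conv F (fun vs => G vs + G' vs) ws = conv F G ws + conv F G' ws.
Proof. by rewrite convC convDl !(convC _ F). Qed.

Lemma convZl k F G ws : conv (fun vs => k * F vs) G ws = k * conv F G ws.
Proof.
by elim: ws F G => [|w ws IH] F G /=; rewrite ?mulrA// !IH mulrDr.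
Qed.

Lemma convZr k F G ws : conv F (fun vs => k * G vs) ws = k * conv F G ws.
Proof. by rewrite convC convZl convC. Qed.

Lemma conv0l G ws : conv (fun=> 0) G ws = 0.
Proof. by elim: ws G => [|w ws IH] G /=; rewrite ?mul0r// !IH addr0. Qed.

Lemma conv_split_suml X (F : seq X -> X -> seq X -> seq W -> K) G (x : seq X) ws :
  conv (fun vs => split_sum (fun a e b => F a e b vs) x) G ws =
  split_sum (fun a e b => conv (F a e b) G ws) x.
Proof.
elim: x F => [|e x IH] F /=; first exact: conv0l.
by rewrite convDl (IH (fun a => F (e :: a))).
Qed.

Lemma convA F G H ws : conv F (conv G H) ws = conv (conv F G) H ws.
Proof.
elim: ws F G H => [|w ws IH] F G H /=; first by rewrite mulrA.
by rewrite IH convDr convDl !IH addrA.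
Qed.

(** A function with value 1 at the empty list is invertible for the
    convolution. *)
Lemma conv_inj m F G : m [::] = 1 ->
  (forall ws, conv F m ws = conv G m ws) -> F =1 G.
Proof.
move=> m1 FG ws; suff gen n F' G' :
    (forall ws, (size ws <= n)%N -> conv F' m ws = conv G' m ws) ->
    forall ws, (size ws <= n)%N -> F' ws = G' ws.
  by apply: (gen (size ws)) => // vs _; exact: FG.
elim: n F' G' {FG ws} => [|n IH] F' G' FG.
  by case=> // _; have := FG [::] isT; rewrite /= m1 !mulr1.
have le_n vs : (size vs <= n)%N -> F' vs = G' vs.
  by apply: IH => us usn; apply: FG; exact: leqW.
case=> [|w ws] wsn; first exact: le_n.
apply: (IH (fun vs => F' (w :: vs)) (fun vs => G' (w :: vs))) => // vs vsn.
have /= := FG (w :: vs) vsn; rewrite (@eq_conv_in F' G' (fun us => m (w :: us)) (fun us => m (w :: us)))//.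
  by move/addIr.
by move=> us usvs; apply: le_n; exact: leq_trans vsn.
Qed.

(** Taking one entry out of the list is a derivation. *)
Definition takeout (Phi : W -> seq W -> K) ws : K :=
  split_sum (fun A x B => Phi x (A ++ B)) ws.

Lemma takeout_conv (Phi : W -> seq W -> K) G ws :
  takeout (fun x => conv (Phi x) G) ws = conv (takeout Phi) G ws.
Proof.
elim: ws Phi G => [|w ws IH] Phi G; first by rewrite /takeout /= mul0r.
rewrite {1}/takeout /= split_sumD.
rewrite -[X in _ + (X + _)]/(takeout (fun x => conv (fun vs => Phi x (w :: vs)) G) ws).
rewrite -[X in _ + (_ + X)]/(takeout (fun x => conv (Phi x) (fun vs => G (w :: vs))) ws).
by rewrite !IH addrA -convDl.
Qed.

End Convolution.

Lemma conv_map (K : comNzRingType) (W W' : Type) (f : W' -> W) (F G : seq W -> K) ws :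
  conv F G (map f ws) = conv (fun vs => F (map f vs)) (fun vs => G (map f vs)) ws.
Proof. by elim: ws F G => //= w ws IH F G; rewrite !IH. Qed.

(** ** The moment-cumulant recursion *)

Section SetCumulant.
Variables (K : comNzRingType) (I : finType) (f : {set I} -> K).
Implicit Types (S V B : {set I}) (s t : {set {set I}}).

Definition moebius n : K := (-1) ^+ n.-1 * (n.-1)`!%:R.

Definition set_cumulant S : K :=
  \sum_(s | finset.partition s S) moebius #|s| * \prod_(V in s) f V.

Let DD S B : B \subset S -> S :\: (S :\: B) = B.
Proof. by move=> BS; rewrite finset.setDDr finset.setDv finset.set0U (finset.setIidPr BS). Qed.

Lemma moebiusS n : moebius n.+2 + moebius n.+1 *+ n.+1 = 0.
Proof.
by rewrite /moebius /= exprS factS natrM -mulr_natr mulN1r mulNr; ring.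
Qed.

(** In the expansion of the right-hand side each partition s of S occurs once
    for V = S, and once for each of its #|s| - 1 blocks that do not contain i,
    namely with that block as the complement of V. *)
Lemma set_moment_cumulant i S : f finset.set0 = 1 -> i \in S ->
  f S = \sum_(V : {set I} | (i \in V) && (V \subset S)) set_cumulant V * f (S :\: V).
Proof.
move=> f0 iS; rewrite (bigD1 S) /=; last by rewrite iS subxx.
rewrite finset.setDv f0 mulr1.
have -> : \sum_(V : {set I} | (i \in V) && (V \subset S) && (V != S))
    set_cumulant V * f (S :\: V) =
  \sum_(p : {set I} * {set {set I}} |
     ((i \in p.1) && (p.1 \subset S) && (p.1 != S)) && finset.partition p.2 p.1)
    moebius #|p.2| * \prod_(V in p.2) f V * f (S :\: p.1).
  rewrite -(pair_big_dep (fun V => (i \in V) && (V \subset S) && (V != S))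
    (fun V s => finset.partition s V)
    (fun V s => moebius #|s| * \prod_(V in s) f V * f (S :\: V))) /=.
  by apply: eq_bigr => V _; rewrite mulr_suml.
rewrite (reindex_onto (fun q : {set {set I}} * {set I} => (S :\: q.2, q.1 :\ q.2))
  (fun p : {set I} * {set {set I}} => (S :\: p.1 |: p.2, S :\: p.1))) /=; last first.
  move=> [V s] /= /andP[/andP[/andP[iV VS] nVS] ps].
  rewrite DD//; congr (_, _); apply: finset.setU1K.
  apply/negP => /(partitionS ps) sub; case/negP: nVS; rewrite finset.eqEsubset VS /=.
  apply/fintype.subsetP => x xS; apply: contraT => xV.
  by have := fintype.subsetP sub x; rewrite !inE xV xS (negbTE xV) => /(_ isT).
pose Q (q : {set {set I}} * {set I}) :=
  finset.partition q.1 S && ((q.2 \in q.1) && (i \notin q.2)).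
rewrite (eq_big Q (fun q => moebius #|q.1|.-1 * \prod_(V in q.1) f V)); first last.
- move=> [s B] /= /andP[/andP[/andP[/andP[iSB _] nSB] ps] /eqP[sE BE]].
  have Bs : B \in s by rewrite -sE BE !inE eqxx.
  by rewrite BE (cardsD1 B s) Bs -mulrA [_ * f B]mulrC -big_setD1.
- move=> [s B]; rewrite /Q /=; apply/idP/idP; last first.
    move=> /andP[ps /andP[Bs iB]]; have BS := partitionS ps Bs.
    rewrite !inE iB iS finset.subsetDl partitionD1// DD// finset.setD1K// eqxx !andbT.
    apply/eqP => /finset.setP SB; have /finset.set0Pn[x xB] := partition_neq0 ps Bs.
    by have := SB x; rewrite !inE xB (fintype.subsetP BS).
  move=> /andP[/andP[/andP[/andP[iSB _] nSB] ps] /eqP[sE BE]].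
  have Bs : B \in s by rewrite -sE BE !inE eqxx.
  have BS : B \subset S by rewrite -BE finset.subsetDl.
  move: iSB; rewrite !inE => /andP[iB _]; rewrite iB Bs !andbT.
  rewrite -(finset.setD1K Bs) -[S](finset.setUidPr BS) -(finset.setID S B).
  rewrite (finset.setIidPr BS) finset.setUA finset.setUid.
  apply: partitionU1 => //; last by apply/pred0P => x; rewrite /= !inE; case: (x \in B).
  by apply: contraNneq nSB => ->; rewrite finset.setD0.
rewrite -(pair_big_dep (fun s => finset.partition s S) (fun s B => (B \in s) && (i \notin B))
  (fun s B => moebius #|s|.-1 * \prod_(V in s) f V)) /= /set_cumulant -big_split /=.
have S0 : S != finset.set0 by apply/finset.set0Pn; exists i.
have blocks s : finset.partition s S ->
    #|[pred B | (B \in s) && (i \notin B)]| = #|s|.-1.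
  move=> ps; have iC : i \in finset.cover s by rewrite (cover_partition ps).
  rewrite (cardsD1 (finset.pblock s i) s) pblock_mem//=.
  apply: eq_card => B; rewrite !inE andbC; case Bs: (B \in s); last by rewrite !andbF.
  rewrite !andbT; congr (~~ _); apply/idP/eqP => [iB|->]; last by rewrite mem_pblock.
  by rewrite (def_pblock (partition_trivIset ps) Bs iB).
have p1 : finset.partition [set S]%SET S.
  by rewrite /finset.partition /finset.cover finset.big_set1 eqxx finset.trivIset1 inE eq_sym S0.
rewrite (bigD1 [set S]%SET) //= finset.big_set1 cards1 /=.
rewrite [X in _ = X + _](_ : _ = f S); last first.
  rewrite big1 ?addr0 => [|B /andP[]]; last by rewrite inE => /eqP ->; rewrite iS.
  by rewrite /moebius /= expr0 !mul1r.
rewrite big1 ?addr0// => s /andP[ps s1].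
rewrite sumr_const blocks// -mulrnAl -mulrDl.
case sE : #|s| => [|[|n]].
- move: (ps); rewrite (cards0_eq sE) => /cover_partition.
  by rewrite /finset.cover finset.big_set0 => SE; rewrite -SE eqxx in S0.
- have /cards1P[B BE] : #|s| == 1%N by rewrite sE.
  move: (ps) s1; rewrite BE => /cover_partition.
  by rewrite /finset.cover finset.big_set1 => ->; rewrite eqxx.
- by rewrite /= moebiusS mul0r.
Qed.

End SetCumulant.

Lemma set_cumulant_imset (K : comNzRingType) (I J : finType) (f : {set I} -> K)
    (h : J -> I) (S : {set J}) : injective h ->
  set_cumulant f (h @: S)%SET = set_cumulant (fun V : {set J} => f (h @: V)%SET) S.
Proof.
move=> hI; have HI : injective (fun V : {set J} => (h @: V)%SET) by exact: imset_inj.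
pose H (V : {set J}) := (h @: V)%SET; pose G (V : {set I}) := (h @^-1: V)%SET.
have GH V : G (H V) = V.
  by apply/finset.setP => x; rewrite inE mem_imset.
rewrite /set_cumulant (reindex_onto (fun s : {set {set J}} => (H @: s)%SET) (fun s : {set {set I}} => (G @: s)%SET)) /=.
  apply: eq_big => [s|s /andP[_ /eqP sE]].
    rewrite imset_partition// -imset_comp andb_idr// => _.
    by rewrite (eq_imset _ (g := id)) ?imset_id//.
  by rewrite card_imset// big_imset //= => V V' _ _; exact: HI.
move=> s ps; rewrite -imset_comp -[RHS]imset_id; apply: eq_in_imset => V Vs /=.
apply/finset.setP => x; apply/imsetP/idP => [[y]|xV]; first by rewrite inE => yV ->.
have /imsetP[y _ xE] : x \in (h @: S)%SET by apply: fintype.subsetP xV; exact: partitionS ps Vs.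
by exists y => //; rewrite inE -xE.
Qed.

(** The convolution of functions of lists as a sum over sets of positions. *)
Lemma conv_subsets (K : comNzRingType) (W : Type) (I : finType) (z : I -> W)
    (F G : seq W -> K) (l : seq I) : uniq l ->
  \sum_(U : {set I} | U \subset l)
    F (map z [seq i <- l | i \in U]) * G (map z [seq i <- l | i \notin U]) =
  conv F G (map z l).
Proof.
elim: l F G => [|x l IH] F G /=.
  move=> _; rewrite (big_pred1 finset.set0)// => U.
  apply/fintype.subsetP/eqP => [U0|-> i]; last by rewrite inE.
  by apply/finset.setP => i; rewrite inE; apply/negP => /U0.
move=> /andP[xl ul]; rewrite (bigID (fun U : {set I} => x \in U)) /=.
have neq i : i \in l -> i != x by apply: contraTneq => ->.
congr (_ + _).
  rewrite -(IH (fun vs => F (z x :: vs)) G)//.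
  rewrite (reindex_onto (fun U : {set I} => x |: U) (fun U : {set I} => U :\ x)) /=; last first.
    by move=> U /andP[_ xU]; rewrite finset.setD1K.
  apply: eq_big => [U|U /andP[/andP[_ _] /eqP xU]].
    rewrite setU11 andbT; apply/andP/idP => [[/fintype.subsetP s1 /eqP s2]|/fintype.subsetP s1].
      apply/fintype.subsetP => i iU; have : i \in x |: U by rewrite !inE iU orbT.
      move=> /s1; rewrite inE => /orP[/eqP ix|//].
      by move: iU; rewrite -s2 ix !inE eqxx.
    split; first by apply/fintype.subsetP => i; rewrite !inE => /orP[->//|/s1 ->]; rewrite orbT.
    by rewrite setU1K//; apply: contra xl => /s1.
  rewrite !inE eqxx /=; congr (F (_ :: map z _) * G (map z _)).
    by apply: eq_in_filter => i /neq ix; rewrite !inE (negbTE ix).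
  by apply: eq_in_filter => i /neq ix; rewrite !inE (negbTE ix).
rewrite -(IH F (fun vs => G (z x :: vs)))//; apply: eq_big => [U|U /andP[_ xU]].
  apply/andP/idP => [[/fintype.subsetP s1 xU]|/fintype.subsetP s1].
    apply/fintype.subsetP => i iU; have := s1 _ iU; rewrite inE => /orP[/eqP ix|//].
    by rewrite ix (negbTE xU) in iU.
  split; last by apply: contra xl => /s1.
  by apply/fintype.subsetP => i /s1; rewrite inE => ->; rewrite orbT.
by rewrite xU (negbTE xU).
Qed.

Section Cumulants.
Variables (R : realType) (disp : measure_display) (T : measurableType disp).
Variable P : probability T R.
Local Notation C := R[i].
Local Notation RV := (T -> C).
Implicit Types (Z : RV) (Zs : seq RV).

Definition moment Zs : C := complex_expectation P (fun t => \prod_(Z <- Zs) Z t).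
Definition list_cumulant Zs : C := cumulant P (in_tuple Zs).

Lemma cumulantE r (Z : r.-tuple RV) : cumulant P Z = list_cumulant Z.
Proof.
case: Z => Z i; have e := eqP i; subst r.
by rewrite /list_cumulant; congr cumulant; exact: val_inj.
Qed.

Lemma complex_expectation1 : complex_expectation P (fun=> 1) = 1.
Proof.
rewrite /complex_expectation /= (_ : (fun=> _) = cst (1 : R))//.
by rewrite expectation_cst (_ : (fun=> _) = cst (0 : R))// expectation_cst.
Qed.

Lemma moment_nil : moment [::] = 1.
Proof.
rewrite /moment -[RHS]complex_expectation1; congr complex_expectation.
by apply/funext => t; rewrite big_nil.
Qed.

Section Positions.
Variables (n : nat) (z : 'I_n.+1 -> RV).
Let f (V : {set 'I_n.+1}) : C := complex_expectation P (fun t => \prod_(i in V) z i t).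

Lemma moment_positions (s : seq 'I_n.+1) : uniq s -> f [set i in s]%SET = moment (map z s).
Proof.
move=> us; rewrite /f /moment; congr complex_expectation; apply/funext => t.
by rewrite big_map big_uniq//; apply: eq_bigl => i; rewrite inE.
Qed.

Lemma cumulant_positions (s : seq 'I_n.+1) : uniq s ->
  set_cumulant f [set i in s]%SET = list_cumulant (map z s).
Proof.
move=> us; pose h (j : 'I_(size (map z s))) := nth ord0 s j.
have js (j : 'I_(size (map z s))) : (j < size s)%N by rewrite -(size_map z).
have hI : injective h.
  by move=> j k /eqP; rewrite nth_uniq// => /eqP/val_inj.
have -> : [set i in s]%SET = (h @: [set: 'I_(size (map z s))])%SET.
  apply/finset.setP => i; rewrite inE; apply/idP/imsetP => [si|[j _ ->]]; last exact: mem_nth.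
  have si' : (index i s < size (map z s))%N by rewrite size_map index_mem.
  by exists (Ordinal si'); rewrite ?inE// /h /= nth_index.
rewrite set_cumulant_imset// /list_cumulant /cumulant /set_cumulant.
apply: eq_bigr => p _; congr (_ * _); apply: eq_bigr => V _.
congr complex_expectation; apply/funext => t.
rewrite big_imset /=; last by move=> j k _ _; exact: hI.
apply: eq_bigr => j _; rewrite (tnth_nth (z ord0)) /=.
by rewrite (nth_map ord0).
Qed.

End Positions.

Lemma moment_cumulant Z Zs :
  moment (Z :: Zs) = conv (fun Ys => list_cumulant (Z :: Ys)) moment Zs.
Proof.
pose n := size Zs; pose z := tnth (in_tuple (Z :: Zs)) : 'I_n.+1 -> RV.
pose l := map (lift ord0) (enum 'I_n).
have ul : uniq l by rewrite map_inj_uniq ?enum_uniq//; exact: lift_inj.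
have u0l : uniq (ord0 :: l).
  by rewrite /= ul andbT; apply/negP => /mapP[i _ /(congr1 val)].
have allE (i : 'I_n.+1) : i \in ord0 :: l.
  rewrite inE; case: (unliftP ord0 i) => [j ->|->]; last by rewrite eqxx.
  by rewrite (mem_map (@lift_inj _ ord0)) mem_enum orbT.
have zl : map z l = Zs.
  rewrite -map_comp -[RHS](map_tnth_enum (in_tuple Zs)); apply: eq_map => i /=.
  by rewrite /z !(tnth_nth Z).
have zE : map z (ord0 :: l) = Z :: Zs by rewrite /= zl.
pose f (V : {set 'I_n.+1}) : C := complex_expectation P (fun t => \prod_(i in V) z i t).
have f0 : f finset.set0 = 1.
  have -> : finset.set0 = [set i in [::]]%SET :> {set 'I_n.+1}.
    by apply/finset.setP => i; rewrite !inE.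
  by rewrite [LHS]moment_positions// moment_nil.
have setE (V : {set 'I_n.+1}) (a : pred 'I_n.+1) : (forall i, (i \in V) = a i) ->
    V = [set i in [seq i <- ord0 :: l | a i]]%SET.
  by move=> Va; apply/finset.setP => i; rewrite inE mem_filter Va allE andbT.
rewrite -zE -moment_positions// -[LHS]/(f _).
have -> : [set i in ord0 :: l]%SET = [set: 'I_n.+1]%SET.
  by apply/finset.setP => i; rewrite [LHS]inE [RHS]inE allE.
rewrite (set_moment_cumulant (i := ord0) f0) ?inE// -zl -conv_subsets//.
rewrite (reindex_onto (fun U : {set 'I_n.+1} => ord0 |: U) (fun U : {set 'I_n.+1} => U :\ ord0)) /=; last first.
  by move=> U /andP[xU _]; rewrite finset.setD1K.
have l0 i : i \in l -> i != ord0 by move=> il; apply: contraTneq il => ->; case/andP: u0l.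
apply: eq_big => [U|U /andP[_ /eqP U0]].
  rewrite setU11 finset.subsetT /=; apply/eqP/fintype.subsetP => [U0 i iU|Ul].
    have := allE i; rewrite inE => /orP[/eqP i0|//].
    by move: iU; rewrite -U0 i0 !inE eqxx.
  by rewrite finset.setU1K//; apply/negP => /Ul /l0; rewrite eqxx.
have z0 : z ord0 = Z by case: zE.
congr (_ * _).
  rewrite (setE (ord0 |: U) (fun i => i \in ord0 |: U))// [LHS]cumulant_positions ?filter_uniq//.
  rewrite /= !inE eqxx /= z0; congr (list_cumulant (_ :: map z _)).
  by apply: eq_in_filter => i /l0 i0; rewrite !inE (negbTE i0).
rewrite (setE ([set: _] :\: (ord0 |: U)) (fun i => i \notin ord0 |: U)); last by move=> i; rewrite !inE andbT.
rewrite [LHS]moment_positions ?filter_uniq// /= !inE eqxx /=; congr (moment (map z _)).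
by apply: eq_in_filter => i /l0 i0; rewrite !inE (negbTE i0).
Qed.

End Cumulants.

(** * Integration against image measures and Gaussian moments *)

Section Factor.
Context d1 d2 (S : measurableType d1) (Y : measurableType d2) (R : realType).
Variables (nu : {measure set S -> \bar R}) (mu : {measure set Y -> \bar R}).
Variables (g : S -> Y) (H : S -> R) (c : R).
Hypotheses (mg : measurable_fun setT g) (mH : measurable_fun setT H).
Hypotheses (H0 : forall x, 0 <= H x) (c0 : 0 <= c).
Hypothesis gH : forall B, measurable B ->
  (\int[nu]_x (\1_B (g x) * H x)%:E = c%:E * mu B)%E.
Import HBNNSimple.
Local Open Scope ereal_scope.

Let mfg (f : Y -> R) : measurable_fun setT f ->
  measurable_fun setT (fun x => (f (g x) * H x)%:E).
Proof.
move=> mf; apply/measurable_EFinP; apply: measurable_funM => //.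
exact: measurableT_comp mf mg.
Qed.

(** The identity passes from indicators to simple functions by linearity, and
    from those to nonnegative functions by monotone convergence. *)
Lemma ge0_integral_factor (f : Y -> R) : (forall y, (0 <= f y)%R) ->
  measurable_fun setT f ->
  \int[nu]_x (f (g x) * H x)%:E = c%:E * \int[mu]_y (f y)%:E.
Proof.
move=> f0 mf.
have mf' : measurable_fun setT (EFin \o f) by exact/measurable_EFinP.
pose h := nnsfun_approx measurableT mf'.
have hf y : (EFin \o h n) y @[n --> \oo] --> (f y)%:E.
  exact: (cvg_nnsfun_approx measurableT mf' (fun x _ => f0 x)).
have hnd y a b : (a <= b)%N -> (h a y <= h b y)%R.
  by move=> ab; exact/lefP/nd_nnsfun_approx.
have -> : \int[mu]_y (f y)%:E = lim (\int[mu]_y (h n y)%:E @[n --> \oo]).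
  have fE y : (f y)%:E = lim ((EFin \o h n) y @[n --> \oo]).
    exact/esym/cvg_lim.
  under eq_integral do rewrite fE.
  apply: monotone_convergence => //.
  - by move=> n; exact/measurable_EFinP.
  - by move=> n y _ /=; rewrite lee_fin.
  - by move=> y _ a b ab; rewrite lee_fin; exact: hnd.
have -> : \int[nu]_x (f (g x) * H x)%:E = lim (\int[nu]_x (h n (g x) * H x)%:E @[n --> \oo]).
  have fE x : (f (g x) * H x)%:E = lim ((h n (g x) * H x)%:E @[n --> \oo]).
    apply/esym/cvg_lim => //.
    by have := @cvgeZr _ _ _ _ _ (H x)%:E _ (hf (g x)); apply.
  under eq_integral do rewrite fE.
  apply: monotone_convergence => //.
  - by move=> n; exact: mfg.
  - by move=> n x _; rewrite lee_fin mulr_ge0.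
  - by move=> x _ a b ab; rewrite lee_fin ler_wpM2r//; exact: hnd.
have suf n : \int[nu]_x (h n (g x) * H x)%:E = c%:E * \int[mu]_y (h n y)%:E.
  transitivity (\int[nu]_x (\sum_(y \in range (h n)) (y * (\1_(h n @^-1` [set y]) (g x) * H x))%:E)).
    apply: eq_integral => x _; rewrite [in LHS]fimfunE EFinM -fsumEFin// ge0_mule_fsuml.
      by apply: eq_fsbigr => r _; rewrite -EFinM -mulrA.
    by move=> r; exact: nnfun_muleindic_ge0.
  have m1 r : measurable_fun setT (\1_(h n @^-1` [set r]) : Y -> R).
    exact: measurable_indic.
  rewrite ge0_integral_fsum//; last 2 first.
  - by move=> r; apply/measurable_EFinP/measurable_funM => //; exact/measurable_EFinP/mfg.
  - move=> r x _; rewrite mulrA EFinM mule_ge0 ?lee_fin//.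
    exact: nnfun_muleindic_ge0.
  transitivity (c%:E * \int[mu]_y (\sum_(r \in range (h n)) (r * \1_(h n @^-1` [set r]) y)%:E)); last first.
    by congr (_ * _); apply: eq_integral => y _; rewrite [in RHS]fimfunE fsumEFin.
  rewrite [in RHS]ge0_integral_fsum//; last 2 first.
  - by move=> r; apply/measurable_EFinP/measurable_funM.
  - by move=> r y _; exact: nnfun_muleindic_ge0.
  rewrite ge0_mule_fsumr; last first.
    by move=> r; apply: integral_ge0 => y _; exact: nnfun_muleindic_ge0.
  apply: eq_fsbigr => r; rewrite inE => -[y _ <-].
  under eq_integral do rewrite EFinM.
  under [in RHS]eq_integral do rewrite EFinM.
  rewrite !ge0_integralZl ?lee_fin//; first last.
  - by move=> x _; rewrite lee_fin mulr_ge0.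
  - exact: mfg.
  - exact/measurable_EFinP.
  rewrite gH; last by rewrite -[X in measurable X]setTI; exact: measurable_funP.
  by rewrite integral_indic ?setIT 1?muleCA// -[X in measurable X]setTI; exact: measurable_funP.
under eq_fun do rewrite suf.
rewrite limeMl//.
apply: ereal_nondecreasing_is_cvgn => a b ab; apply: ge0_le_integral => //.
- by move=> y _; rewrite lee_fin.
- exact/measurable_EFinP.
- exact/measurable_EFinP.
- by move=> y _; rewrite lee_fin; exact: hnd.
Qed.

End Factor.

Section NormalMoments.
Variables (R : realType) (s : R).
Hypothesis s0 : s != 0.
Local Notation mu := (@lebesgue_measure R).
Local Notation N := (normal_prob 0 s).
Local Notation pdf := (normal_pdf 0 s).

Lemma ge0_integral_normal (f : R -> R) : (forall x, 0 <= f x) ->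
  measurable_fun setT f ->
  (\int[N]_x (f x)%:E = \int[mu]_x (f x * pdf x)%:E)%E.
Proof.
move=> f0 mf.
rewrite -[LHS]mul1e -(@ge0_integral_factor _ _ _ _ _ mu N id pdf 1)//.
- exact: measurable_normal_pdf.
- by move=> x; exact: normal_pdf_ge0.
move=> B mB; rewrite mul1e /normal_prob [RHS]integral_mkcond.
apply: eq_integral => x _; rewrite patchE indicE.
by case: (x \in B); rewrite ?mul1r ?mul0r.
Qed.

(** Half of the exponent of the density absorbs the power. *)
Lemma exp_pow_bound k : exists c, 0 <= c /\
  forall x : R, x ^+ k.*2 * pdf x <= c * normal_pdf 0 (Num.sqrt 2 * s) x.
Proof.
have r0 : Num.sqrt 2 * s != 0 :> R by rewrite mulf_neq0// sqrtr_eq0 -ltNge.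
pose b : R := (4 * s ^+ 2) ^+ k.
have b0 : 0 <= b by rewrite exprn_ge0// mulr_ge0// sqr_ge0.
exists (k`!%:R * b * normal_peak s / normal_peak (Num.sqrt 2 * s)); split.
  by rewrite divr_ge0 ?normal_peak_ge0// mulr_ge0 ?normal_peak_ge0// mulr_ge0.
move=> x; rewrite !normal_pdfE// [leRHS]mulrA divfK ?gt_eqF ?normal_peak_gt0//.
rewrite mulrCA [leRHS]mulrAC [leRHS]mulrC ler_wpM2l ?normal_peak_ge0//.
rewrite /normal_fun subr0; set a := x ^+ 2 / (4 * s ^+ 2).
have a0 : 0 <= a by rewrite divr_ge0 ?sqr_ge0// mulr_ge0// sqr_ge0.
have -> : - x ^+ 2 / (s ^+ 2 *+ 2) = - a - a by rewrite /a; field.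
have -> : - x ^+ 2 / ((Num.sqrt 2 * s) ^+ 2 *+ 2) = - a.
  by rewrite exprMn sqr_sqrtr// /a; field.
have -> : x ^+ k.*2 = a ^+ k * b.
  by rewrite -exprMn divfK ?mulf_neq0 ?expf_neq0// -exprM mul2n.
rewrite expRD -mulrA mulrCA [leRHS]mulrAC [leRHS]mulrC ler_wpM2l//.
rewrite mulrA ler_wpM2r ?expR_ge0// expRN ler_pdivrMr ?expR_gt0//.
case: k {b b0} => [|k]; first by rewrite expr0 mul1r (le_trans _ (expR_ge1Dx a))// lerDl.
rewrite -ler_pdivrMl ?ltr0n ?fact_gt0// mulrC.
by apply: le_trans (expR_ge1Dxn k a0); rewrite lerDr.
Qed.

Let mf_pow k : measurable_fun setT (fun x : R => x ^+ k).
Proof. exact: measurable_funX. Qed.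

Lemma pow_le_even (x : R) k : `|x ^+ k| <= 1 + x ^+ k.*2.
Proof.
rewrite -muln2 exprM -real_normK ?num_real// -subr_ge0; set y := `|x ^+ k|.
have -> : 1 + y ^+ 2 - y = (y - 1) ^+ 2 + y by ring.
by rewrite addr_ge0 ?sqr_ge0// normr_ge0.
Qed.

Lemma integrable_pow_pdf k : mu.-integrable setT (fun x => (x ^+ k * pdf x)%:E).
Proof.
have [c [c0 cP]] := exp_pow_bound k.
have mp t : measurable_fun setT (normal_pdf 0 t : R -> R) by exact: measurable_normal_pdf.
apply: (@le_integrable _ _ _ mu _ _ _
  ((fun x => (pdf x)%:E) \+ (fun x => c%:E * (normal_pdf 0 (Num.sqrt 2 * s) x)%:E)))%E => //.
- by apply/measurable_EFinP; apply: measurable_funM; [exact: mf_pow|exact: mp].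
- move=> x _; change (`|x ^+ k * pdf x| <= `|pdf x + c * normal_pdf 0 (Num.sqrt 2 * s) x|).
  rewrite [leRHS]ger0_norm; last first.
    by rewrite addr_ge0 ?mulr_ge0 ?normal_pdf_ge0.
  rewrite normrM (ger0_norm (normal_pdf_ge0 _ _ _)).
  apply: (@le_trans _ _ (pdf x + x ^+ k.*2 * pdf x)); last by rewrite lerD2l.
  by rewrite -[X in X + _]mul1r -mulrDl ler_wpM2r ?normal_pdf_ge0// pow_le_even.
- by apply: integrableD => //; [|apply: integrableZl => //]; exact: integrable_normal_pdf.
Qed.

Lemma integrable_pow_normal k : N.-integrable setT (fun x => (x ^+ k)%:E).
Proof.
apply/integrableP; split; first exact/measurable_EFinP.
under eq_integral do rewrite abse_EFin.
rewrite ge0_integral_normal//; last exact: measurableT_comp.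
have /integrableP[_] := integrable_pow_pdf k; congr (_ < _)%E.
apply: eq_integral => x _.
by rewrite abse_EFin normrM (ger0_norm (normal_pdf_ge0 _ _ _)).
Qed.

Lemma integral_pow_normal k :
  (\int[N]_x (x ^+ k)%:E = \int[mu]_x (x ^+ k * pdf x)%:E)%E.
Proof.
pose u := EFin \o (fun x : R => x ^+ k); pose v := EFin \o (fun x : R => x ^+ k * pdf x).
rewrite -[LHS]/(\int[N]_x u x)%E -[RHS]/(\int[mu]_x v x)%E [LHS]integralE [RHS]integralE.
have uv (e : R -> R) : measurable_fun setT e -> (forall x, 0 <= e x) ->
    (\int[N]_x (e x)%:E = \int[mu]_x (e x * pdf x)%:E)%E.
  by move=> me e0; exact: ge0_integral_normal.
congr (_ - _)%E.
  transitivity (\int[N]_x (Num.max (x ^+ k) 0)%:E)%E.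
    by apply: eq_integral => x _; rewrite funeposE /u /= -EFin_max.
  rewrite uv; [|by apply: measurable_maxr|by move=> x; rewrite le_max lexx orbT].
  apply: eq_integral => x _.
  by rewrite funeposE /v /= -EFin_max maxr_pMl ?normal_pdf_ge0// mul0r.
transitivity (\int[N]_x (Num.max (- (x ^+ k)) 0)%:E)%E.
  by apply: eq_integral => x _; rewrite funenegE /u /= -EFin_max.
rewrite uv; [|by apply: measurable_maxr => //; exact: measurableT_comp|
  by move=> x; rewrite le_max lexx orbT].
apply: eq_integral => x _.
by rewrite funenegE /v /= -EFin_max maxr_pMl ?normal_pdf_ge0// mul0r mulNr.
Qed.

Local Notation dpdf k := (fun x : R => k%:R * (x ^+ k.-1 * pdf x) - x ^+ k.+1 * pdf x / s ^+ 2).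

Lemma is_derive_pow_pdf k (x : R) : is_derive x 1 (fun x => x ^+ k * pdf x) (dpdf k x).
Proof.
have dq : is_derive x 1 (fun y : R => (- (s ^+ 2 *+ 2)^-1) *: (y ^+ 2)) (- x / s ^+ 2).
  apply: is_derive_eq; rewrite !scaler1 /GRing.scale /=; field.
  by [].
have de : is_derive x 1 (normal_fun 0 s) (- x / s ^+ 2 * normal_fun 0 s x).
  have -> : normal_fun 0 s = expR \o (fun y : R => (- (s ^+ 2 *+ 2)^-1) *: (y ^+ 2)).
    apply/funext => y; rewrite /normal_fun subr0 /GRing.scale /=; congr expR.
    by field.
  rewrite mulrC; exact: is_derive1_comp.
have dp : is_derive x 1 pdf (- x / s ^+ 2 * pdf x).
  rewrite normal_pdfE//.
  have := @is_deriveZ _ _ _ _ (normal_peak s) _ _ _ de.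
  by rewrite /GRing.scale /= mulrCA.
have dx : is_derive x 1 (fun y : R => y ^+ k) (k%:R * x ^+ k.-1).
  have := @is_deriveX _ _ id k x 1 _ (is_derive_id x 1).
  by rewrite exprfctE /GRing.scale /= mulr1.
apply: (is_derive_eq (is_deriveM dx dp)).
rewrite /GRing.scale /= [x ^+ k.+1]exprS; field.
by [].
Qed.

Lemma pow_pdf_cvg0 k : (n%:R ^+ k * pdf n%:R) @[n --> \oo] --> (0 : R).
Proof.
have [c [c0 cP]] := exp_pow_bound k.+1.
pose M := c * normal_peak (Num.sqrt 2 * s).
rewrite -cvg_shiftS /=.
apply: (@squeeze_cvgr _ _ _ _ (fun=> 0) (fun n => M * n.+1%:R^-1)); last 2 first.
- exact: cvg_cst.
- by rewrite -[X in _ --> X](mulr0 M); apply: cvgM; [exact: cvg_cst|exact: cvg_harmonic].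
apply: nearW => n; rewrite mulr_ge0 ?exprn_ge0 ?normal_pdf_ge0//=.
rewrite ler_pdivlMr ?ltr0n//.
have /le_trans -> // : n.+1%:R ^+ k * pdf n.+1%:R * n.+1%:R <= n.+1%:R ^+ k.+1.*2 * pdf n.+1%:R.
  rewrite mulrAC ler_wpM2r ?normal_pdf_ge0// -exprSr ler_weXn2l ?ler1n//.
  by rewrite -addnn leq_addr.
apply: le_trans (cP _) _; rewrite ler_wpM2l// normal_pdf_ub//.
by rewrite mulf_neq0// sqrtr_eq0 -ltNge.
Qed.

Lemma integrable_dpdf k : mu.-integrable setT (fun x => (dpdf k x)%:E).
Proof.
under eq_fun do rewrite EFinB EFinM [X in (_ - X)%E]EFinM.
by apply: integrableB => //; [apply: integrableZl|apply: integrableZr] => //;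
  exact: integrable_pow_pdf.
Qed.

(** The integral over [- n, n] is the difference of the boundary values of
    x^k pdf(x), which vanish in the limit. *)
Lemma integral_dpdf0 k : (\int[mu]_x (dpdf k x)%:E = 0)%E.
Proof.
pose h (x : R) := x ^+ k * pdf x.
have dh x : derivable h x 1 by have [] := is_derive_pow_pdf k x.
have hE x : (h^`()%classic) x = dpdf k x.
  by rewrite derive1E; exact: (@derive_val _ _ _ _ _ _ _ (is_derive_pow_pdf k x)).
have ch : continuous h by move=> x; exact/differentiable_continuous/derivable1_diffP.
have cd : continuous (dpdf k).
  have cp m : continuous (fun x : R => x ^+ m * pdf x).
    by move=> x; apply: differentiable_continuous; apply/derivable1_diffP; have [] := is_derive_pow_pdf m x.
  move=> x; apply: cvgB; apply: cvgM; try exact: cvg_cst; exact: cp.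
pose F (n : nat) (x : R) := ((dpdf k x) * \1_(`[- n.+1%:R, n.+1%:R] : set R) x)%:E.
have md : measurable_fun setT (dpdf k) by exact: continuous_measurable_fun.
have FE n : (\int[mu]_x F n x = (h n.+1%:R - h (- n.+1%:R))%:E)%E.
  rewrite EFinB -(@continuous_FTC2 _ (dpdf k) h)//.
  - rewrite [RHS]integral_mkcond; apply: eq_integral => x _.
    rewrite patchE /F indicE; case: (x \in _); by rewrite ?mulr1 ?mulr0.
  - by rewrite -subr_gt0 opprK addr_gt0.
  - exact: continuous_subspaceT.
  - by split=> [x _||] //; [apply: cvg_at_right_filter|apply: cvg_at_left_filter]; exact: ch.
have h_opp x : `|h (- x)| = `|h x|.
  rewrite /h; have -> : pdf (- x) = pdf x by rewrite !normal_pdfE// /normal_fun !subr0 sqrrN.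
  by rewrite !normrM !normrX normrN.
have h0 : (h n.+1%:R - h (- n.+1%:R)) @[n --> \oo] --> (0 : R).
  have := pow_pdf_cvg0 k; rewrite -cvg_shiftS /= => hc.
  rewrite -[X in _ --> X]subr0; apply: cvgB => //.
  apply: norm_cvg0; under eq_fun do rewrite h_opp.
  exact/norm_cvg0P.
have mF n : measurable_fun setT (F n).
  by apply/measurable_EFinP; apply: measurable_funM => //; exact: measurable_indic.
have Fcvg : {ae mu, forall x, setT x -> F n x @[n --> \oo] --> (dpdf k x)%:E}.
  apply: aeW => x _; apply: cvg_near_cst; near=> n; congr EFin.
  rewrite indicE mem_set ?mulr1//= in_itv /= -ler_norml.
  apply: (@le_trans _ _ n%:R); last by rewrite ler_nat.
  near: n; exact: nbhs_infty_ger.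
have Fdom : {ae mu, forall x n, setT x -> (`|F n x| <= `|(dpdf k x)%:E|)%E}.
  apply: aeW => x n _; rewrite !abse_EFin lee_fin normrM ler_piMr//.
  by rewrite indicE; case: (_ \in _); rewrite ?normr1 ?normr0.
have iF := integrable_dpdf k.
have [_ _ cv] := @dominated_convergence _ _ _ mu setT measurableT F _ _
  mF (measurable_int _ iF) Fcvg (integrable_abse iF) Fdom.
apply: (@cvg_unique _ (@ereal_hausdorff R) _ _ _ _ cv).
have eF : (fun n => \int[mu]_x F n x)%E = (fun n => (h n.+1%:R - h (- n.+1%:R))%:E).
  exact/funext.
by rewrite /= eF; apply: cvg_EFin => //; exact: nearW.
Unshelve. all: by end_near. Qed.

(** The two sides differ by the integral of the derivative of x^k pdf(x). *)
Lemma stein k :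
  (\int[N]_x (x ^+ k.+1)%:E = (s ^+ 2 * k%:R)%:E * \int[N]_x (x ^+ k.-1)%:E)%E.
Proof.
rewrite !integral_pow_normal.
have i1 := integrable_pow_pdf k.+1; have i0 := integrable_pow_pdf k.-1.
have := integral_dpdf0 k.
under eq_integral do rewrite EFinB EFinM [X in (_ - X)%E]EFinM.
rewrite integralB//; [|exact: integrableZl|exact: integrableZr].
rewrite integralZl// integralZr//.
rewrite -(fineK (integrable_fin_num measurableT i1)) -(fineK (integrable_fin_num measurableT i0)).
set a := fine _; set b := fine _; rewrite -!EFinM -EFinB => -[] /eqP.
rewrite subr_eq0 => /eqP e; congr EFin; rewrite -mulrA e.
by field.
Qed.

End NormalMoments.

(** * Moments of independent variables *)

Section IndependentProducts.
Context d1 d2 (T : measurableType d1) (Y : measurableType d2) (R : realType).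
Variables (P : probability T R) (mu : probability Y R).
Variables (I : finType) (g : I -> T -> Y).
Hypothesis mg : forall i, measurable_fun setT (g i).
Hypothesis indep : forall B : I -> set Y, (forall i, measurable (B i)) ->
  P [set t | forall i, B i (g i t)] = (\prod_i mu (B i))%E.

Local Notation int f := (\int[mu]_y (f y)%:E)%E.

Let set_fun (f : I -> Y -> R) (j : I) (h : Y -> R) (i : I) := if i == j then h else f i.

Let prod_set_fun f j h (u : (Y -> R) -> I -> R) :
  \prod_i u (set_fun f j h i) i = u h j * \prod_(i | i != j) u (f i) i.
Proof.
rewrite (bigD1 j)//= /set_fun eqxx; congr (_ * _).
by apply: eq_bigr => i /negbTE ->.
Qed.

(** For indicators this is independence; indicators are replaced by the f_i one
    coordinate at a time. *)
Lemma ge0_integral_prod (f : I -> Y -> R) :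
  (forall i y, 0 <= f i y) -> (forall i, mu.-integrable setT (EFin \o f i)) ->
  (\int[P]_t (\prod_i f i (g i t))%:E = (\prod_i fine (int (f i)))%:E)%E.
Proof.
suff main (s : seq I) : forall f : I -> Y -> R,
    (forall i y, 0 <= f i y) -> (forall i, mu.-integrable setT (EFin \o f i)) ->
    (forall i, i \notin s -> exists2 B, measurable B & f i = \1_B) ->
    (\int[P]_t (\prod_i f i (g i t))%:E = (\prod_i fine (int (f i)))%:E)%E.
  by move=> f0 fi; apply: (main (enum I)) => // i; rewrite mem_enum.
elim: s => [|j s IHs] {}f f0 fi fs.
  have [B BP] : {B : I -> set Y & forall i, measurable (B i) /\ f i = \1_(B i)}.
    apply: (@choice _ _ (fun i B => measurable B /\ f i = \1_B)) => i.
    by have [//|B mB fB] := fs i; exists B.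
  have mB i : measurable (B i) by have [] := BP i.
  have mBg i : measurable (g i @^-1` B i) by rewrite -[X in measurable X]setTI; exact: mg.
  transitivity (P [set t | forall i, B i (g i t)]).
    have -> : [set t | forall i, B i (g i t)] = \bigcap_(i in [set: I]) (g i @^-1` B i).
      by apply/seteqP; split=> [t tB i _|t tB i]; exact: tB.
    set A := \bigcap_(i in _) _; have mA : measurable A by exact: fin_bigcap_measurable.
    rewrite -[A]setIT -integral_indic//.
    apply: eq_integral => t _; congr EFin; rewrite indicE.
    have [tB|tB] := boolP (t \in _).
      by rewrite big1// => i _; rewrite (BP i).2 indicE mem_set//; move/set_mem: tB; apply.
    have [i iB] : exists i, ~ B i (g i t).
      move/negP: tB => tB; apply/existsNP => tB'.
      by apply: tB; apply/mem_set => i _; exact: tB'.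
    by rewrite (bigD1 i)//= (BP i).2 indicE memNset// mul0r.
  rewrite indep// (big_morph EFin (@EFinM R) erefl); apply: eq_bigr => i _.
  have -> : int (f i) = mu (B i) by rewrite (BP i).2 integral_indic// setIT.
  by rewrite fineK// fin_num_measure.
pose H t := \prod_(i | i != j) f i (g i t).
pose c := \prod_(i | i != j) fine (int (f i)).
have mf i : measurable_fun setT (f i) by apply/measurable_EFinP; exact: measurable_int (fi i).
have mH : measurable_fun setT H.
  rewrite /H; under eq_fun do rewrite -big_filter.
  by apply: measurable_prod => i _; exact: measurableT_comp.
transitivity (\int[P]_t (f j (g j t) * H t)%:E)%E.
  by apply: eq_integral => t _; rewrite (bigD1 j).
rewrite (@ge0_integral_factor _ _ _ _ _ P mu (g j) H c)//.
- rewrite (bigD1 j)//= mulrC EFinM fineK//.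
  exact: integrable_fin_num (fi j).
- by move=> t; apply: prodr_ge0.
move=> B mB.
transitivity (\int[P]_t (\prod_i set_fun f j \1_B i (g i t))%:E)%E.
  apply: eq_integral => t _; congr EFin.
  by rewrite (prod_set_fun f j \1_B (fun h i => h (g i t))).
have /IHs -> : forall i y, 0 <= set_fun f j \1_B i y; last first.
- move=> i si; rewrite /set_fun; case: eqP => [_|/eqP ij]; first by exists B.
  by apply: fs; rewrite inE negb_or ij.
- by move=> i; rewrite /set_fun; case: eqP => // _; exact: integrable_indic.
- rewrite (prod_set_fun f j \1_B (fun h i => fine (int h))) EFinM muleC.
  by rewrite fineK ?integral_indic ?setIT// ?fin_num_measure.
- by move=> i y; rewrite /set_fun; case: eqP.
Qed.
(** By splitting the f_i into positive and negative parts, one coordinate at a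
    time. *)
Lemma integral_prod (f : I -> Y -> R) :
  (forall i, mu.-integrable setT (EFin \o f i)) ->
  P.-integrable setT (fun t => (\prod_i f i (g i t))%:E) /\
  (\int[P]_t (\prod_i f i (g i t))%:E = (\prod_i fine (int (f i)))%:E)%E.
Proof.
suff main (s : seq I) : forall f : I -> Y -> R,
    (forall i, mu.-integrable setT (EFin \o f i)) ->
    (forall i, i \notin s -> forall y, 0 <= f i y) ->
    P.-integrable setT (fun t => (\prod_i f i (g i t))%:E) /\
    (\int[P]_t (\prod_i f i (g i t))%:E = (\prod_i fine (int (f i)))%:E)%E.
  by move=> fi; apply: (main (enum I)) => // i; rewrite mem_enum.
elim: s => [|j s IHs] {}f fi fs.
  have f0 i y : 0 <= f i y by exact: fs.
  have fE := ge0_integral_prod f0 fi; split => //.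
  apply/integrableP; split.
    apply/measurable_EFinP/measurable_prod => i _; apply: measurableT_comp => //.
    by apply/measurable_EFinP; exact: measurable_int (fi i).
  under eq_integral => t _ do rewrite gee0_abs ?lee_fin ?prodr_ge0//.
  by rewrite fE ltry.
pose p : Y -> R := (f j)^\+; pose q : Y -> R := (f j)^\-.
have pq y : f j y = p y - q y by rewrite -[in LHS](funrposBneg (f j)).
have ip : mu.-integrable setT (EFin \o p) by exact: integrable_funrpos.
have iq : mu.-integrable setT (EFin \o q) by exact: integrable_funrneg.
have good h : (forall y, 0 <= h y) -> mu.-integrable setT (EFin \o h) ->
    P.-integrable setT (fun t => (\prod_i set_fun f j h i (g i t))%:E) /\
    (\int[P]_t (\prod_i set_fun f j h i (g i t))%:E =
     (fine (int h) * \prod_(i | i != j) fine (int (f i)))%:E)%E.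
  move=> h0 hi; rewrite -(prod_set_fun f j h (fun h i => fine (int h))); apply: IHs.
    by move=> i; rewrite /set_fun; case: eqP.
  move=> i si; rewrite /set_fun; case: eqP => [_|/eqP ij] //.
  by apply: fs; rewrite inE negb_or ij.
have [pi pE] := good p (funrpos_ge0 _) ip; have [qi qE] := good q (funrneg_ge0 _) iq.
have fE t : (\prod_i f i (g i t))%:E = ((\prod_i set_fun f j p i (g i t))%:E -
    (\prod_i set_fun f j q i (g i t))%:E)%E.
  rewrite -EFinB (prod_set_fun f j p (fun h i => h (g i t))).
  rewrite (prod_set_fun f j q (fun h i => h (g i t))).
  by rewrite -mulrBl -pq (bigD1 j).
under eq_fun do rewrite fE.
split; first exact: integrableB.
rewrite integralB// pE qE -EFinB -mulrBl [in RHS](bigD1 j)//=; congr (EFin (_ * _)).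
rewrite -fineB; [|exact: integrable_fin_num ip|exact: integrable_fin_num iq].
by rewrite -integralB//; congr fine; apply: eq_integral => y _; rewrite /= -EFinB -pq.
Qed.

End IndependentProducts.

Section GaussianEntries.
Context (R : realType) d (T : measurableType d) (P : probability T R) (N : nat).
Variable X : T -> 'M[R[i]]_N.+1.
Hypothesis gX : gaussian_random_matrix P X.

Local Notation index := ('I_N.+1 * 'I_N.+1 * bool)%type.

Definition real_entry (a : index) (t : T) : R :=
  if a.2 then complex.Im (X t a.1.1 a.1.2) else complex.Re (X t a.1.1 a.1.2).

Definition entry_sd : R := Num.sqrt (N.+1%:R^-1 / 2).

Local Notation NP := (normal_prob 0 entry_sd).

Lemma entry_sd_neq0 : entry_sd != 0.
Proof. by rewrite sqrtr_eq0 -ltNge divr_gt0 ?invr_gt0. Qed.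

Lemma entry_sd2 : entry_sd ^+ 2 = N.+1%:R^-1 / 2.
Proof. by rewrite sqr_sqrtr// divr_ge0 ?invr_ge0. Qed.

Lemma measurable_real_entry a : measurable_fun setT (real_entry a).
Proof.
case: a => [[i j] b]; have [m _] := gX.1 i j; case: b.
  exact: (measurableT_comp measurable_snd m).
exact: (measurableT_comp measurable_fst m).
Qed.

Lemma real_entry_independent (B : index -> set R) : (forall a, measurable (B a)) ->
  P [set t | forall a, B a (real_entry a t)] = (\prod_a NP (B a))%E.
Proof.
move=> mB; pose B' (ij : 'I_N.+1 * 'I_N.+1) := B (ij, false) `*` B (ij, true).
transitivity (P [set t | forall ij, B' ij (re_im (fun t => X t ij.1 ij.2) t)]).
  congr (P _); apply/seteqP; split=> t /= tB.
    by move=> ij; split; [exact: (tB (ij, false))|exact: (tB (ij, true))].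
  by case=> ij [|]; have [] := tB ij.
rewrite (gX.2 B'); last by move=> ij; exact: measurableX.
rewrite [RHS](eq_bigr (fun a => NP (B (a.1, a.2)))); last by case.
rewrite -(pair_bigA _ (fun ij b => NP (B (ij, b)))) /=.
apply: eq_bigr => -[i j] _; rewrite big_bool /=.
have [_ ->] := gX.1 i j; last exact: measurableX.
have e := product_measure1E (normal_prob 0 entry_sd) (normal_prob 0 entry_sd) (mB (i, j, false)) (mB (i, j, true)).
by rewrite -/entry_sd [LHS]e muleC.
Qed.

Lemma moment_real_entry (k : index -> nat) :
  P.-integrable setT (fun t => (\prod_a real_entry a t ^+ k a)%:E) /\
  (\int[P]_t (\prod_a real_entry a t ^+ k a)%:E =
   (\prod_a fine (\int[NP]_x (x ^+ k a)%:E))%:E)%E.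
Proof.
apply: (@integral_prod _ _ _ _ _ P NP _ real_entry _ _ (fun a x => x ^+ k a)).
- exact: measurable_real_entry.
- exact: real_entry_independent.
- by move=> a; apply: integrable_pow_normal; exact: entry_sd_neq0.
Qed.

End GaussianEntries.

(** * Linearity of the complex expectation *)

Section ComplexExpectation.
Context (R : realType) d (T : measurableType d) (P : probability T R).
Local Notation C := R[i].
Local Notation E := (complex_expectation P).
Implicit Types Z : T -> C.

Definition complex_integrable Z : Prop :=
  P.-integrable setT (fun t => (complex.Re (Z t))%:E) /\
  P.-integrable setT (fun t => (complex.Im (Z t))%:E).

Let eE (f : T -> R) : ('E_P[f] = \int[P]_t (f t)%:E)%E.
Proof. by rewrite unlock. Qed.

Let eD (f g : T -> R) : P.-integrable setT (EFin \o f) -> P.-integrable setT (EFin \o g) ->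
  fine 'E_P[fun t => f t + g t] = fine 'E_P[f] + fine 'E_P[g].
Proof.
move=> fi gi; rewrite !eE -fineD; [|exact: integrable_fin_num fi|exact: integrable_fin_num gi].
by rewrite -integralD.
Qed.

Let eZ k (f : T -> R) : P.-integrable setT (EFin \o f) ->
  fine 'E_P[fun t => k * f t] = k * fine 'E_P[f].
Proof.
move=> fi; rewrite !eE; under eq_integral do rewrite EFinM.
by rewrite integralZl// fineM//; exact: integrable_fin_num fi.
Qed.

Let iZ k (f : T -> R) : P.-integrable setT (EFin \o f) ->
  P.-integrable setT (EFin \o (fun t => k * f t)).
Proof. exact: (@integrableZl _ _ _ P _ measurableT k (EFin \o f)). Qed.

Let iD (f g : T -> R) : P.-integrable setT (EFin \o f) -> P.-integrable setT (EFin \o g) ->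
  P.-integrable setT (EFin \o (fun t => f t + g t)).
Proof. exact: (@integrableD _ _ _ P _ measurableT (EFin \o f) (EFin \o g)). Qed.

Lemma complex_integrableD Z Z' : complex_integrable Z -> complex_integrable Z' ->
  complex_integrable (fun t => Z t + Z' t).
Proof.
move=> [rZ iZ0] [rZ' iZ'0]; split.
  by under eq_fun do rewrite raddfD; exact: iD.
by under eq_fun do rewrite raddfD; exact: iD.
Qed.

Lemma complex_expectationD Z Z' : complex_integrable Z -> complex_integrable Z' ->
  E (fun t => Z t + Z' t) = E Z + E Z'.
Proof.
move=> [rZ iZ0] [rZ' iZ'0]; apply/eqP; rewrite eq_complex /=; apply/andP; split; apply/eqP.
  by under eq_fun do rewrite raddfD; exact: eD.
by under eq_fun do rewrite raddfD; exact: eD.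
Qed.

Let ReM (k z : C) : complex.Re (k * z) =
  complex.Re k * complex.Re z + (- complex.Im k) * complex.Im z.
Proof. by case: k z => a b [x y] /=; rewrite mulNr. Qed.

Let ImM (k z : C) : complex.Im (k * z) =
  complex.Re k * complex.Im z + complex.Im k * complex.Re z.
Proof. by case: k z => a b [x y] /=. Qed.

Lemma complex_integrableZ k Z : complex_integrable Z -> complex_integrable (fun t => k * Z t).
Proof.
move=> [rZ jZ]; split.
  by under eq_fun do rewrite ReM; apply: iD; exact: iZ.
by under eq_fun do rewrite ImM; apply: iD; exact: iZ.
Qed.

Lemma complex_expectationZ k Z : complex_integrable Z -> E (fun t => k * Z t) = k * E Z.
Proof.
move=> [rZ jZ]; apply/eqP; rewrite eq_complex ReM ImM /=; apply/andP; split; apply/eqP.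
  by under eq_fun do rewrite ReM; rewrite eD ?eZ//; exact: iZ.
by under eq_fun do rewrite ImM; rewrite eD ?eZ//; exact: iZ.
Qed.

Lemma complex_integrable0 : complex_integrable (fun=> 0).
Proof. by split; exact: integrable0. Qed.

Lemma complex_expectation0 : E (fun=> 0) = 0.
Proof.
rewrite -[RHS](mul0r (E (fun=> 0))) -(complex_expectationZ 0 complex_integrable0).
by congr complex_expectation; apply/funext => t; rewrite mul0r.
Qed.

Lemma complex_expectation_sum X (s : seq X) (Z : X -> T -> C) :
  (forall x, complex_integrable (Z x)) ->
  complex_integrable (fun t => \sum_(x <- s) Z x t) /\
  E (fun t => \sum_(x <- s) Z x t) = \sum_(x <- s) E (Z x).
Proof.
move=> iZ'; elim: s => [|x s [IHi IHE]].
  have -> : (fun t => \sum_(x <- [::]) Z x t) = fun=> 0.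
    by apply/funext => t; rewrite big_nil.
  by rewrite big_nil complex_expectation0; split=> //; exact: complex_integrable0.
have -> : (fun t => \sum_(x <- x :: s) Z x t) = fun t => Z x t + \sum_(x <- s) Z x t.
  by apply/funext => t; rewrite big_cons.
by rewrite big_cons complex_expectationD// IHE; split=> //; exact: complex_integrableD.
Qed.

Lemma complex_expectation_split_sum X (F : seq X -> X -> seq X -> T -> C) w :
  (forall u x v, complex_integrable (F u x v)) ->
  complex_integrable (fun t => split_sum (fun u x v => F u x v t) w) /\
  E (fun t => split_sum (fun u x v => F u x v t) w) = split_sum (fun u x v => E (F u x v)) w.
Proof.
elim: w F => [|x w IH] F iF /=.
  by rewrite complex_expectation0; split=> //; exact: complex_integrable0.
have [iH eH] := IH (fun u => F (x :: u)) (fun u => iF (x :: u)).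
by rewrite complex_expectationD// eH; split=> //; exact: complex_integrableD.
Qed.

Lemma complex_expectation_real (f : T -> R) :
  P.-integrable setT (fun t => (f t)%:E) ->
  complex_integrable (fun t => (f t)%:C%C) /\
  E (fun t => (f t)%:C%C) = (fine (\int[P]_t (f t)%:E)%E)%:C%C.
Proof.
move=> fi; split; first by split=> //=; exact: integrable0.
rewrite /complex_expectation /= eE (_ : (fun=> 0) = cst (0 : R))//.
by rewrite expectation_cst.
Qed.

End ComplexExpectation.

(** * Gaussian integration by parts *)

Section GaussianWords.
Context (R : realType) d (T : measurableType d) (P : probability T R) (N : nat).
Variable X : T -> 'M[R[i]]_N.+1.
Hypothesis gX : gaussian_random_matrix P X.
Local Notation C := R[i].
Local Notation E := (complex_expectation P).
Local Notation index := ('I_N.+1 * 'I_N.+1 * bool)%type.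
Local Notation NP := (normal_prob 0 (entry_sd R N)).
Local Notation g := (real_entry X).

Let m k : R := fine (\int[NP]_x (x ^+ k)%:E)%E.

Let mS k : m k.+1 = entry_sd R N ^+ 2 * k%:R * m k.-1.
Proof.
rewrite /m stein ?entry_sd_neq0// fineM//.
exact: integrable_fin_num (integrable_pow_normal (entry_sd_neq0 R N) _).
Qed.

Let M (w : seq index) : R := \prod_a m (count_mem a w).

Lemma prod_count (F : index -> R) (w : seq index) :
  \prod_(a <- w) F a = \prod_a F a ^+ count_mem a w.
Proof.
elim: w => [|b w IH]; first by rewrite big_nil big1.
rewrite big_cons IH /=; under [RHS]eq_bigr do rewrite exprD.
rewrite [in RHS]big_split /=; congr (_ * _).
rewrite (bigD1 b)//= eqxx expr1 big1 ?mulr1// => a.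
by rewrite eq_sym => /negbTE ->.
Qed.

Let word_moment (w : seq index) :
  complex_integrable P (fun t => (\prod_(a <- w) g a t)%:C%C) /\
  E (fun t => (\prod_(a <- w) g a t)%:C%C) = (M w)%:C%C.
Proof.
have [i e] := moment_real_entry gX (fun a => count_mem a w).
have -> : (fun t => (\prod_(a <- w) g a t)%:C%C) =
    (fun t => (\prod_a g a t ^+ count_mem a w)%:C%C) :> (T -> C).
  by apply/funext => t; rewrite prod_count.
by have [ii ->] := complex_expectation_real i; rewrite e.
Qed.

(** Stein's identity for one variable, with the letter a removed at each of its
    occurrences in w. *)
Let MS a w : M (a :: w) =
  entry_sd R N ^+ 2 * split_sum (fun u b v => (a == b)%:R * M (u ++ v)) w.
Proof.
pose c := \prod_(b | b != a) m (count_mem b w); pose k := count_mem a w.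
have -> : M (a :: w) = m k.+1 * c.
  rewrite /M (bigD1 a)//= eqxx; congr (_ * _); apply: eq_bigr => b.
  by rewrite eq_sym => /negbTE ->.
rewrite mS -2![LHS]mulrA; congr (_ * _).
have -> : k%:R = split_sum (fun _ b _ => (a == b)%:R : R) w.
  rewrite /k; elim: (w) => //= b w' <-; rewrite natrD; congr (_%:R + _).
  by rewrite eq_sym.
rewrite mulr_split_suml; apply: eq_split_sum_in => u b v wE.
case: eqVneq wE => [<-{b} wE|_ _]; last by rewrite !mul0r.
rewrite !mul1r /M (bigD1 a)//= /k wE !count_cat /= eqxx addnCA /=.
congr (_ * _); apply: eq_bigr => b ba.
by rewrite wE !count_cat /= eq_sym (negbTE ba).
Qed.

(** The entries and their conjugates are linear forms in the real entries.
    Integration by parts extends from real entries to linear forms by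
    expanding one form at a time; [mixed] is an intermediate stage. *)
Let form (c : index -> C) (t : T) : C := \sum_a c a * (g a t)%:C%C.

Let mixed (s : seq index) (w : seq (index -> C)) (t : T) : C :=
  (\prod_(a <- s) g a t)%:C%C * \prod_(c <- w) form c t.

Let mixed_cons s c w : mixed s (c :: w) = fun t => \sum_a c a * mixed (a :: s) w t.
Proof.
apply/funext => t; rewrite /mixed big_cons mulrCA /form mulr_suml.
apply: eq_bigr => a _.
by rewrite big_cons rmorphM -!mulrA.
Qed.

Let mixed_integrable s w : complex_integrable P (mixed s w).
Proof.
elim: w s => [|c w IH] s.
  have -> : mixed s [::] = (fun t => (\prod_(a <- s) g a t)%:C%C).
    by apply/funext => t; rewrite /mixed big_nil mulr1.
  exact: (word_moment s).1.
rewrite mixed_cons.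
by have [] := complex_expectation_sum (index_enum _) (fun a => complex_integrableZ (c a) (IH (a :: s))).
Qed.

Let E_mixed_cons s c w : E (mixed s (c :: w)) = \sum_a c a * E (mixed (a :: s) w).
Proof.
have [_] := complex_expectation_sum (index_enum _) (fun a => complex_integrableZ (c a) (mixed_integrable (a :: s) w)).
rewrite mixed_cons => ->; apply: eq_bigr => a _.
by rewrite complex_expectationZ.
Qed.

Let v2 : C := (entry_sd R N ^+ 2)%:C%C.

Let mixed_parts a s w : E (mixed (a :: s) w) =
  v2 * (split_sum (fun u b v => (a == b)%:R * E (mixed (u ++ v) w)) s +
        split_sum (fun u c v => c a * E (mixed s (u ++ v))) w).
Proof.
elim: w a s => [|c w IH] a s.
  have mE z : E (mixed z [::]) = (M z)%:C%C.
    rewrite -(word_moment z).2; congr complex_expectation.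
    by apply/funext => t; rewrite /mixed big_nil mulr1.
  rewrite mE MS rmorphM; congr (_ * _); rewrite addr0 (raddf_split_sum (real_complex R)).
  apply: eq_split_sum => u b v; rewrite /= rmorphM mE; congr (_ * _).
  by rewrite rmorph_nat.
rewrite E_mixed_cons.
under eq_bigr => b _.
  rewrite (_ : mixed [:: b, a & s] w = mixed [:: a, b & s] w); last first.
    by apply/funext => t; rewrite /mixed !big_cons mulrCA.
  rewrite IH /= mulrCA; over.
rewrite -mulr_sumr; congr (_ * _).
under eq_bigr do rewrite mulrDr mulrDr.
rewrite !big_split /=.
have -> : \sum_b c b * ((a == b)%:R * E (mixed s w)) = c a * E (mixed s w).
  rewrite (bigD1 a)//= eqxx mul1r big1 ?addr0// => b.
  by rewrite eq_sym => /negbTE ->; rewrite mul0r mulr0.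
rewrite -[LHS]addrA [LHS]addrCA; congr (_ + _); last congr (_ + _).
  under [RHS]eq_split_sum => u b v do rewrite E_mixed_cons mulr_sumr.
  rewrite -sum_split_sum; apply: eq_bigr => b _; rewrite mulr_split_sumr.
  by apply: eq_split_sum => u y v; rewrite mulrCA.
under [RHS]eq_split_sum => u c' v do rewrite E_mixed_cons mulr_sumr.
rewrite -sum_split_sum; apply: eq_bigr => b _; rewrite mulr_split_sumr.
by apply: eq_split_sum => u y v; rewrite mulrCA.
Qed.

Lemma form_parts c w : E (mixed [::] (c :: w)) =
  split_sum (fun u c' v => (v2 * \sum_a c a * c' a) * E (mixed [::] (u ++ v))) w.
Proof.
rewrite E_mixed_cons.
under eq_bigr do rewrite mixed_parts /= add0r mulrCA mulr_split_sumr.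
rewrite -mulr_sumr sum_split_sum mulr_split_sumr; apply: eq_split_sum => u c' v.
by rewrite -mulrA mulr_suml; congr (_ * _); apply: eq_bigr => a _; rewrite mulrA.
Qed.

Definition entry (l : index) (t : T) : C :=
  if l.2 then (X t l.1.1 l.1.2)^* else X t l.1.1 l.1.2.

Definition entry_word (w : seq index) (t : T) : C := \prod_(l <- w) entry l t.

Let coefs (l a : index) : C :=
  (a.1 == l.1)%:R * (if a.2 then (if l.2 then - 'i%C else 'i%C) else 1).

Let form_entry l t : form (coefs l) t = entry l t.
Proof.
rewrite /form (eq_bigr (fun a => coefs l (a.1, a.2) * (g (a.1, a.2) t)%:C%C)); last by case.
rewrite -(pair_bigA _ (fun ij b => coefs l (ij, b) * (g (ij, b) t)%:C%C)) /=.
rewrite (bigD1 l.1)//= [X in _ + X]big1 => [|ij /negbTE ij0]; last first.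
  by rewrite big_bool /coefs /= ij0 !mul0r addr0.
rewrite addr0 big_bool /coefs /= eqxx !mul1r /entry /real_entry /=.
case: (X t _ _) => x y; case: l.2; apply/eqP; rewrite eq_complex /=; simpc.
  by [].
by [].
Qed.

(** Circular symmetry: an entry is correlated with its conjugate, but not with
    itself. *)
Let entry_cov ij l : v2 * \sum_a coefs (ij, true) a * coefs l a =
  N.+1%:R^-1 * (l == (ij, false))%:R.
Proof.
rewrite (eq_bigr (fun a => coefs (ij, true) (a.1, a.2) * coefs l (a.1, a.2))); last by case.
rewrite -(pair_bigA _ (fun ij' b => coefs (ij, true) (ij', b) * coefs l (ij', b))) /=.
rewrite (bigD1 ij)//= [X in _ + X]big1 => [|ij' /negbTE ij0]; last first.
  by rewrite big_bool /coefs /= ij0 !mul0r addr0.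
rewrite addr0 big_bool /coefs /= eqxx !mul1r.
case: l => ij' b; rewrite xpair_eqE eq_sym /=.
case: eqVneq => _ /=; last by rewrite !mul0r mulr0 addr0 !mulr0.
rewrite !mul1r /v2 entry_sd2 rmorphM !fmorphV !rmorph_nat /= -mulrA; congr (_ * _).
case: b => /=; first by rewrite mulrNN -expr2 sqr_i addNr mulr0.
by rewrite mulNr -expr2 sqr_i opprK mulVf// pnatr_eq0.
Qed.

Lemma entry_word_integrable w : complex_integrable P (entry_word w).
Proof.
have -> : entry_word w = mixed [::] (map coefs w).
  apply/funext => t; rewrite /mixed big_nil mul1r big_map.
  by apply: eq_bigr => l _; rewrite form_entry.
exact: mixed_integrable.
Qed.

Lemma entry_word_parts ij w : E (entry_word ((ij, true) :: w)) =
  N.+1%:R^-1 * split_sum (fun u l v => (l == (ij, false))%:R * E (entry_word (u ++ v))) w.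
Proof.
have mE z : entry_word z = mixed [::] (map coefs z).
  apply/funext => t; rewrite /mixed big_nil mul1r big_map.
  by apply: eq_bigr => l _; rewrite form_entry.
rewrite mE [map _ _]/= form_parts split_sum_map mulr_split_sumr.
apply: eq_split_sum => u l v; rewrite entry_cov mulrA; congr (_ * E _).
by rewrite mE map_cat.
Qed.

Definition entry_poly (q : fcomb C index) (t : T) : C :=
  \sum_(s <- q) s.1 * entry_word s.2 t.

(** F is a polynomial in the entries and their conjugates, and F' is its formal
    derivative with respect to the entry ij, the conjugate of an entry being
    an independent variable. *)
Definition entry_derivative (ij : 'I_N.+1 * 'I_N.+1) (F F' : T -> C) : Prop :=
  exists2 q : fcomb C index, F =1 entry_poly q & F' =1 fun t =>
    \sum_(s <- q) s.1 *
      split_sum (fun u l v => (l == (ij, false))%:R * entry_word (u ++ v) t) s.2.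

Lemma derivative_const ij c : entry_derivative ij (fun=> c) (fun=> 0).
Proof.
exists [:: (c, [::])] => t; rewrite /entry_poly big_seq1 /=.
  by rewrite /entry_word big_nil mulr1.
by rewrite mulr0.
Qed.

Lemma derivative_entry ij l : entry_derivative ij (entry l) (fun=> (l == (ij, false))%:R).
Proof.
exists [:: (1, [:: l])] => t; rewrite /entry_poly big_seq1 /= mul1r.
  by rewrite /entry_word big_seq1.
by rewrite addr0 /entry_word big_nil mulr1.
Qed.

Lemma derivativeD ij F G F' G' : entry_derivative ij F F' -> entry_derivative ij G G' ->
  entry_derivative ij (fun t => F t + G t) (fun t => F' t + G' t).
Proof.
move=> [p pF pF'] [q qG qG']; exists (p ++ q) => t.
  by rewrite /entry_poly big_cat pF qG.
by rewrite big_cat pF' qG'.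
Qed.

Lemma derivativeM ij F G F' G' : entry_derivative ij F F' -> entry_derivative ij G G' ->
  entry_derivative ij (fun t => F t * G t) (fun t => F' t * G t + F t * G' t).
Proof.
have word_cat u v t : entry_word (u ++ v) t = entry_word u t * entry_word v t.
  by rewrite /entry_word big_cat.
move=> [p pF pF'] [q qG qG'].
exists [seq (s.1 * r.1, s.2 ++ r.2) | s <- p, r <- q] => t.
  rewrite pF qG /entry_poly big_allpairs_dep mulr_suml; apply: eq_bigr => s _.
  rewrite mulr_sumr; apply: eq_bigr => r _ /=.
  by rewrite word_cat mulrACA.
rewrite pF qG pF' qG' /entry_poly big_allpairs_dep !mulr_suml -big_split.
apply: eq_bigr => s _ /=; rewrite !mulr_sumr -big_split; apply: eq_bigr => r _ /=.
rewrite split_sum_cat mulrDr; congr (_ + _).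
  rewrite mulrACA mulr_split_suml; congr (_ * _); apply: eq_split_sum => u l v.
  by rewrite catA [in RHS]word_cat mulrA.
rewrite mulrACA mulr_split_sumr; congr (_ * _); apply: eq_split_sum => u l v.
by rewrite -catA [in RHS]word_cat mulrCA.
Qed.

Lemma entry_polynomial_integrable ij F F' :
  entry_derivative ij F F' -> complex_integrable P F.
Proof.
move=> [q /funext -> _]; have := complex_expectation_sum q (fun s =>
  complex_integrableZ s.1 (entry_word_integrable s.2)).
by case.
Qed.

Let word_derivative ij (w : seq index) t : C :=
  split_sum (fun u l v => (l == (ij, false))%:R * entry_word (u ++ v) t) w.

Let E_word_derivative ij w : complex_integrable P (word_derivative ij w) /\
  E (word_derivative ij w) =
  split_sum (fun u l v => (l == (ij, false))%:R * E (entry_word (u ++ v))) w.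
Proof.
have iF (u : seq index) l v := complex_integrableZ (l == (ij, false))%:R
  (entry_word_integrable (u ++ v)).
have [iD eD] := complex_expectation_split_sum w iF; split=> //.
rewrite [LHS]eD; apply: eq_split_sum => u l v.
by rewrite complex_expectationZ//; exact: entry_word_integrable.
Qed.

Lemma derivative_integrable ij F F' : entry_derivative ij F F' -> complex_integrable P F'.
Proof.
move=> [q _ /funext ->]; have := complex_expectation_sum q (fun s =>
  complex_integrableZ s.1 (E_word_derivative ij s.2).1).
by case.
Qed.

Lemma integration_by_parts ij F F' : entry_derivative ij F F' ->
  E (fun t => (X t ij.1 ij.2)^* * F t) = N.+1%:R^-1 * E F'.
Proof.
move=> [q qF /funext ->].
have -> : (fun t => (X t ij.1 ij.2)^* * F t) =
    fun t => \sum_(s <- q) s.1 * entry_word ((ij, true) :: s.2) t.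
  apply/funext => t; rewrite qF /entry_poly mulr_sumr; apply: eq_bigr => s _.
  by rewrite /entry_word big_cons mulrCA.
have [_ ->] := complex_expectation_sum q (fun s =>
  complex_integrableZ s.1 (entry_word_integrable ((ij, true) :: s.2))).
have [_ ->] := complex_expectation_sum q (fun s =>
  complex_integrableZ s.1 (E_word_derivative ij s.2).1).
rewrite mulr_sumr; apply: eq_bigr => s _.
rewrite complex_expectationZ; last exact: entry_word_integrable.
rewrite entry_word_parts complex_expectationZ; last exact: (E_word_derivative ij s.2).1.
by rewrite mulrCA (E_word_derivative ij s.2).2.
Qed.

End GaussianWords.

(** * The loop equation for traces of products of Wishart matrices *)

Section LoopEquation.
Context (R : realType) d (T : measurableType d) (P : probability T R) (N : nat).
Variable X : T -> 'M[R[i]]_N.+1.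
Hypothesis gX : gaussian_random_matrix P X.
Variables (p : nat) (M : 'I_p -> 'M[R[i]]_N.+1).
Local Notation C := R[i].
Local Notation E := (complex_expectation P).
Local Notation Mat := 'M[C]_N.+1.
Local Notation word := (seq (seq 'I_p)).

Lemma eq_derivative ij (F G F' G' : T -> C) : F =1 G -> F' =1 G' ->
  entry_derivative X ij F F' -> entry_derivative X ij G G'.
Proof. by move=> /funext -> /funext ->. Qed.

Lemma derivative_sum ij K (r : seq K) (F F' : K -> T -> C) :
  (forall k, entry_derivative X ij (F k) (F' k)) ->
  entry_derivative X ij (fun t => \sum_(k <- r) F k t) (fun t => \sum_(k <- r) F' k t).
Proof.
move=> dF; elim: r => [|k r IH].
  by apply: eq_derivative (derivative_const X ij 0) => t; rewrite big_nil.
by apply: eq_derivative (derivativeD (dF k) IH) => t; rewrite big_cons.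
Qed.

Definition mx_derivative ij (A A' : T -> Mat) : Prop :=
  forall a b, entry_derivative X ij (fun t => A t a b) (fun t => A' t a b).

Lemma mx_derivative_const ij (A : Mat) : mx_derivative ij (fun=> A) (fun=> 0).
Proof.
move=> a b; apply: eq_derivative (derivative_const X ij (A a b)) => // t.
by rewrite mxE.
Qed.

Lemma mx_derivative_X ij : mx_derivative ij X (fun=> delta_mx ij.1 ij.2).
Proof.
move=> a b; apply: eq_derivative (derivative_entry X ij (a, b, false)) => // t.
by rewrite mxE !xpair_eqE andbT; case: (ij).
Qed.

Lemma mx_derivative_conjX ij :
  mx_derivative ij (fun t => (map_mx Num.conj (X t))^T) (fun=> 0).
Proof.
move=> a b; apply: eq_derivative (derivative_entry X ij (b, a, true)) => t.
  by rewrite !mxE.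
by rewrite mxE !xpair_eqE andbF.
Qed.

Lemma mx_derivativeM ij A B A' B' : mx_derivative ij A A' -> mx_derivative ij B B' ->
  mx_derivative ij (fun t => A t * B t) (fun t => A' t * B t + A t * B' t).
Proof.
move=> dA dB a b.
have := derivative_sum (index_enum _) (fun k => derivativeM (dA a k) (dB k b)).
apply: eq_derivative => t; first by rewrite mxE.
by rewrite !mxE -big_split.
Qed.

Lemma derivative_trace ij A A' : mx_derivative ij A A' ->
  entry_derivative X ij (fun t => \tr (A t)) (fun t => \tr (A' t)).
Proof. by move=> dA; apply: derivative_sum => a; exact: dA. Qed.

Definition letter_mx (l : seq 'I_p) : Mat := \prod_(i <- l) M i.

Definition wishart (l : seq 'I_p) (t : T) : Mat := compound_wishart X (letter_mx l) t.

Definition wishart_word (w : word) (t : T) : Mat := \prod_(l <- w) wishart l t.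

Definition wishart_trace (w : word) (t : T) : C := \tr (wishart_word w t).

Let Xs t : Mat := (map_mx Num.conj (X t))^T.

Lemma letter_mx_cat k l : letter_mx (k ++ l) = letter_mx k * letter_mx l.
Proof. by rewrite /letter_mx big_cat. Qed.

Lemma wishart_wordE l w t : wishart_word (l :: w) t = wishart l t * wishart_word w t.
Proof. by rewrite /wishart_word big_cons. Qed.

Lemma wishart_word_cat v w t : wishart_word (v ++ w) t = wishart_word v t * wishart_word w t.
Proof. by rewrite /wishart_word big_cat. Qed.

Lemma wishartE l t : wishart l t = Xs t * letter_mx l * X t. Proof. by []. Qed.

Lemma mx_derivative_word ij w : mx_derivative ij (wishart_word w) (fun t =>
  split_sum (fun u l v => wishart_word u t * (Xs t * letter_mx l * delta_mx ij.1 ij.2) *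
    wishart_word v t) w).
Proof.
elim: w => [|l w IH].
  have := mx_derivative_const ij 1; congr mx_derivative.
  by apply/funext => t; rewrite /wishart_word big_nil.
have dl := mx_derivativeM (mx_derivativeM (mx_derivative_conjX ij)
  (mx_derivative_const ij (letter_mx l))) (mx_derivative_X ij).
have := mx_derivativeM dl IH; congr mx_derivative; apply/funext => t.
  by rewrite wishart_wordE.
rewrite /= mul0r mulr0 addr0 mul0r add0r mulr_split_sumr; congr (_ + _).
  by rewrite /wishart_word big_nil mul1r.
by apply: eq_split_sum => u k v; rewrite wishart_wordE !mulrA.
Qed.

Definition trace_product (ws : seq word) (t : T) : C := \prod_(w <- ws) wishart_trace w t.

Lemma derivative_trace_product ij ws :
  entry_derivative X ij (trace_product ws) (fun t =>
    split_sum (fun A x B => split_sum (fun u l v =>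
      \tr (wishart_word u t * (Xs t * letter_mx l * delta_mx ij.1 ij.2) * wishart_word v t)) x *
      trace_product (A ++ B) t) ws).
Proof.
elim: ws => [|w ws IH].
  apply: eq_derivative (derivative_const X ij 1) => t //.
  by rewrite /trace_product big_nil.
have := derivativeM (derivative_trace (mx_derivative_word ij w)) IH.
apply: eq_derivative => t; first by rewrite /trace_product big_cons.
rewrite /= (raddf_split_sum (@mxtrace _ _)) mulr_split_sumr; congr (_ + _).
apply: eq_split_sum => A x B; rewrite mulrCA; congr (_ * _).
by rewrite /trace_product big_cons.
Qed.

Let mul_delta (A B : Mat) a i c d' : (A * delta_mx a i * B) c d' = A c a * B i d'.
Proof.
rewrite -!mulmxE -mulmxA mxE (bigD1 a)//= big1 ?addr0 => [|k ka]; last first.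
  by rewrite mxE big1 ?mulr0// => j _; rewrite mxE (negbTE ka) mul0r.
congr (_ * _); rewrite mxE (bigD1 i)//= big1 ?addr0 => [|j ji].
  by rewrite mxE !eqxx mul1r.
by rewrite mxE (negbTE ji) andbF mul0r.
Qed.

Lemma sum_trace_delta (A B : Mat) :
  \sum_i \sum_a (A * delta_mx a i * B) a i = \tr A * \tr B.
Proof.
rewrite mulrC /mxtrace mulr_suml; apply: eq_bigr => i _.
by rewrite mulr_sumr; apply: eq_bigr => a _; rewrite mul_delta mulrC.
Qed.

Lemma sum_delta_trace (G A B : Mat) :
  \sum_i \sum_a G a i * \tr (A * delta_mx a i * B) = \tr (G * B * A).
Proof.
rewrite -mulrA /mxtrace exchange_big; apply: eq_bigr => a _ /=.
rewrite -mulmxE [RHS]mxE; apply: eq_bigr => i _; congr (_ * _).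
rewrite [RHS]mxE; apply: eq_bigr => c _.
by rewrite mulmxE mul_delta mulrC.
Qed.

Let split_sum_mxE (F : word -> seq 'I_p -> word -> Mat) w a i :
  (split_sum F w) a i = split_sum (fun u l v => F u l v a i) w.
Proof. by elim: w F => [|l w IH] F /=; rewrite mxE// IH. Qed.


Lemma trace_product_integrable ws : complex_integrable P (trace_product ws).
Proof. exact: entry_polynomial_integrable gX _ _ _ (derivative_trace_product (ord0, ord0) ws). Qed.

Definition trace_moment (ws : seq word) : C := E (trace_product ws).

(** Integration by parts with respect to the conjugate of the matrix X that comes
    with the first letter l: the derivative hits the X that follows l, the X of a
    letter of the same trace, which it splits, or the X of a letter of another
    trace, which it merges with the first one. *)
Theorem trace_moment_loop l w ws :
  N.+1%:R * trace_moment ((l :: w) :: ws) =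
  \tr (letter_mx l) * trace_moment (w :: ws) +
  split_sum (fun u k v => trace_moment (((k ++ l) :: u) :: v :: ws)) w +
  split_sum (fun A x B => split_sum (fun a e b =>
    trace_moment (((e ++ l) :: w ++ b ++ a) :: A ++ B)) x) ws.
Proof.
pose G t := letter_mx l * X t * wishart_word w t.
have dG ij : mx_derivative ij G (fun t =>
    letter_mx l * delta_mx ij.1 ij.2 * wishart_word w t + letter_mx l * X t *
    split_sum (fun u k v => wishart_word u t * (Xs t * letter_mx k * delta_mx ij.1 ij.2) *
    wishart_word v t) w).
  have := mx_derivativeM (mx_derivativeM (mx_derivative_const ij (letter_mx l))
    (mx_derivative_X ij)) (mx_derivative_word ij w).
  by congr mx_derivative; apply/funext => t; rewrite mul0r add0r.
have iTP := trace_product_integrable.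
have dF i a := derivativeM (dG (a, i) a i) (derivative_trace_product (a, i) ws).
have TE t : trace_product ((l :: w) :: ws) t =
    \sum_i \sum_a (X t a i)^* * (G t a i * trace_product ws t).
  rewrite /trace_product big_cons /wishart_trace /mxtrace mulr_suml.
  apply: eq_bigr => i _; rewrite wishart_wordE wishartE -!mulrA -mulmxE mxE mulr_suml.
  apply: eq_bigr => a _; rewrite -mulrA; congr (_ * (_ * _)); first by rewrite !mxE.
  by rewrite /G -mulrA.
have E2 (Z : 'I_N.+1 -> 'I_N.+1 -> T -> C) : (forall i a, complex_integrable P (Z i a)) ->
    E (fun t => \sum_i \sum_a Z i a t) = \sum_i \sum_a E (Z i a).
  move=> iZ; have iZi i := complex_expectation_sum (index_enum 'I_N.+1) (iZ i).
  have [_ ->] := complex_expectation_sum (index_enum 'I_N.+1) (fun i => (iZi i).1).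
  by apply: eq_bigr => i _; rewrite (iZi i).2.
rewrite {1}/trace_moment (funext TE) E2 => [|i a]; last first.
  exact: entry_polynomial_integrable gX _ _ _
    (derivativeM (derivative_entry X (a, i) (a, i, true)) (dF i a)).
under eq_bigr => i _ do under eq_bigr => a _ do
  rewrite (integration_by_parts gX (ij := (a, i)) (dF i a)).
under eq_bigr do rewrite -mulr_sumr.
rewrite -mulr_sumr mulrA divff ?pnatr_eq0// mul1r -E2; last first.
  by move=> i a; exact: derivative_integrable gX _ _ _ (dF i a).
transitivity (E (fun t => \tr (letter_mx l) * trace_product (w :: ws) t +
  split_sum (fun u k v => trace_product (((k ++ l) :: u) :: v :: ws) t) w +
  split_sum (fun A x B => split_sum (fun a e b =>
    trace_product (((e ++ l) :: w ++ b ++ a) :: A ++ B) t) x) ws)); last first.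
  have [i1 e1] := complex_expectation_split_sum w
    (fun u k v => iTP (((k ++ l) :: u) :: v :: ws)).
  have iA A x B := complex_expectation_split_sum x
    (fun a e b => iTP (((e ++ l) :: w ++ b ++ a) :: A ++ B)).
  have [i2 e2] := complex_expectation_split_sum ws (fun A x B => (iA A x B).1).
  have i0 := complex_integrableZ (\tr (letter_mx l)) (iTP (w :: ws)).
  rewrite complex_expectationD//; last exact: complex_integrableD.
  rewrite complex_expectationD// complex_expectationZ// e1 e2; congr (_ + _).
  by apply: eq_split_sum => A x B; rewrite (iA A x B).2.
congr complex_expectation; apply/funext => t.
have trG k u : \tr (letter_mx l * X t * u * (Xs t * letter_mx k)) =
    \tr (wishart (k ++ l) t * u).
  by rewrite -mulmxE mxtrace_mulC mulmxE wishartE letter_mx_cat !mulrA.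
under eq_bigr do rewrite big_split /= -mulr_suml.
rewrite big_split /= -mulr_suml; congr (_ + _).
  have -> : \tr (letter_mx l) * trace_product (w :: ws) t =
      \tr (letter_mx l) * wishart_trace w t * trace_product ws t.
    by rewrite /trace_product big_cons mulrA.
  under eq_bigr do under eq_bigr do rewrite mxE mulr_split_sumr split_sum_mxE.
  under eq_bigr do rewrite big_split /=.
  rewrite big_split /= sum_trace_delta mulrDl; congr (_ + _).
  under eq_bigr do rewrite sum_split_sum.
  rewrite sum_split_sum mulr_split_suml; apply: eq_split_sum => u k v.
  under eq_bigr do under eq_bigr do rewrite !mulrA -(mulrA _ (Xs t)).
  rewrite sum_trace_delta trG -wishart_wordE.
  by rewrite /trace_product !big_cons -mulrA.
under eq_bigr do under eq_bigr do rewrite mulr_split_sumr.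
under eq_bigr do rewrite sum_split_sum.
rewrite sum_split_sum; apply: eq_split_sum => A x B.
under eq_bigr do under eq_bigr do rewrite mulrA mulr_split_sumr mulr_split_suml.
under eq_bigr do rewrite sum_split_sum.
rewrite sum_split_sum; apply: eq_split_sum => a e b.
under eq_bigr do under eq_bigr do rewrite !mulrA -(mulrA _ (Xs t)).
under eq_bigr do rewrite -mulr_suml.
rewrite -mulr_suml sum_delta_trace /G /trace_product big_cons; congr (_ * _).
rewrite /wishart_trace wishart_wordE -trG !wishart_word_cat.
by rewrite (mulrA _ (wishart_word b t)) !mulrA.
Qed.

End LoopEquation.

(** * Multilinear extension of cumulants *)

Section MultilinearExtension.
Variables (K : comNzRingType) (W : Type).
Implicit Types (F G : seq W -> K) (q : seq (K * W)) (qs : seq (seq (K * W))).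

(** The multilinear extension of F, a function of lists of basis vectors, to
    lists of formal linear combinations. *)
Fixpoint mext F qs : K :=
  if qs is q :: qs' then \sum_(s <- q) s.1 * mext (fun ws => F (s.2 :: ws)) qs' else F [::].

Lemma eq_mext F G qs : F =1 G -> mext F qs = mext G qs.
Proof. by move=> /funext ->. Qed.

Lemma mextD F G qs : mext (fun ws => F ws + G ws) qs = mext F qs + mext G qs.
Proof.
elim: qs F G => //= q qs IH F G; rewrite -big_split; apply: eq_bigr => s _.
by rewrite IH mulrDr.
Qed.

Lemma mext0 qs : mext (fun=> 0) qs = 0.
Proof. by elim: qs => //= q qs IH; rewrite big1// => s _; rewrite IH mulr0. Qed.

Lemma conv_suml J (r : seq J) (c : J -> K) X (F : J -> seq X -> K) (G : seq X -> K) vs :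
  conv (fun us => \sum_(j <- r) c j * F j us) G vs = \sum_(j <- r) c j * conv (F j) G vs.
Proof.
elim: r => [|j r IH].
  by rewrite big_nil -[RHS](conv0l G vs); apply: eq_conv => // us; rewrite big_nil.
by rewrite big_cons -IH -convZl -convDl; apply: eq_conv => // us; rewrite big_cons.
Qed.

Lemma mext_conv F G qs : mext (conv F G) qs = conv (mext F) (mext G) qs.
Proof.
elim: qs F G => //= q qs IH F G.
rewrite conv_suml [X in _ + X]convC conv_suml -big_split; apply: eq_bigr => s _ /=.
by rewrite mextD !IH mulrDr; congr (_ + _); rewrite convC.
Qed.

End MultilinearExtension.

Section CumulantExtension.
Context (R : realType) d (T : measurableType d) (P : probability T R).
Local Notation C := R[i].
Variables (W : Type) (Z : W -> T -> C).
Hypothesis iZ : forall ws, complex_integrable P (fun t => \prod_(w <- ws) Z w t).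

Definition combination (q : seq (C * W)) (t : T) : C := \sum_(s <- q) s.1 * Z s.2 t.

Let mixed vs qs := [seq Z w | w <- vs] ++ [seq combination q | q <- qs].

Let mixed_cons vs q qs : (fun t => \prod_(F <- mixed vs (q :: qs)) F t) =
  fun t => \sum_(s <- q) s.1 * \prod_(F <- mixed (rcons vs s.2) qs) F t.
Proof.
apply/funext => t; rewrite /mixed big_cat big_cons /= mulrCA mulr_suml.
apply: eq_bigr => s _; rewrite map_rcons cat_rcons big_cat big_cons /=.
by rewrite -mulrA; congr (_ * _); rewrite mulrCA.
Qed.

Let moment_mixed qs vs : complex_integrable P (fun t => \prod_(F <- mixed vs qs) F t) /\
  moment P (mixed vs qs) = mext (fun ws => moment P [seq Z w | w <- vs ++ ws]) qs.
Proof.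
elim: qs vs => [|q qs IH] vs.
  rewrite /mixed !cats0; split=> //=; last by rewrite cats0.
  by under eq_fun do rewrite big_map; exact: iZ.
have := complex_expectation_sum q (fun s => complex_integrableZ s.1 (IH (rcons vs s.2)).1).
rewrite -mixed_cons => -[ii e]; split=> //; rewrite [LHS]e /=; apply: eq_bigr => s _.
rewrite complex_expectationZ; last exact: (IH _).1.
congr (_ * _); rewrite [LHS](IH _).2; apply: eq_mext => ws.
by rewrite cat_rcons.
Qed.

(** The moment-cumulant recursion is multilinear, and the moments cancel. *)
Lemma list_cumulant_combination q qs :
  list_cumulant P [seq combination q | q <- q :: qs] =
  mext (fun ws => list_cumulant P [seq Z w | w <- ws]) (q :: qs).
Proof.
pose m ws := moment P [seq Z w | w <- ws].
pose k ws := list_cumulant P [seq Z w | w <- ws].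
have mE rs : moment P [seq combination q | q <- rs] = mext m rs.
  by have [_ ->] := moment_mixed rs [::].
apply: (@conv_inj _ _ (mext m) (fun rs => list_cumulant P [seq combination q | q <- q :: rs])
  (fun rs => mext k (q :: rs))) => [|rs]; first by rewrite /= /m moment_nil.
rewrite conv_suml.
transitivity (moment P [seq combination q | q <- q :: rs]).
  by rewrite [RHS]moment_cumulant conv_map; apply: eq_conv => // us; rewrite mE.
rewrite mE /=; apply: eq_bigr => s _; congr (_ * _); rewrite -mext_conv.
by apply: eq_mext => ws; rewrite /m /= moment_cumulant conv_map.
Qed.

End CumulantExtension.

(** * Cumulants of traces *)

Section CumulantLoop.
Context (R : realType) d (T : measurableType d) (P : probability T R) (N : nat).
Variable X : T -> 'M[R[i]]_N.+1.
Hypothesis gX : gaussian_random_matrix P X.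
Variables (p : nat) (M : 'I_p -> 'M[R[i]]_N.+1).
Local Notation C := R[i].
Local Notation word := (seq (seq 'I_p)).
Local Notation m := (trace_moment P X M).
Local Notation n := (N.+1%:R : C).

Definition trace_cumulant (ws : seq word) : C :=
  list_cumulant P (map (wishart_trace X M) ws).
Local Notation kappa := trace_cumulant.

Let mE ws : m ws = moment P (map (wishart_trace X M) ws).
Proof.
by congr complex_expectation; apply/funext => t; rewrite big_map.
Qed.

Let m_nil : m [::] = 1. Proof. by rewrite mE moment_nil. Qed.

Let m_cons x ws : m (x :: ws) = conv (fun A => kappa (x :: A)) m ws.
Proof.
rewrite mE moment_cumulant conv_map; by apply: eq_conv => A //; rewrite mE.
Qed.

Let m_cons2 x y ws : m [:: x, y & ws] =
  conv (fun A => kappa [:: x, y & A] +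
    conv (fun B => kappa (x :: B)) (fun B => kappa (y :: B)) A) m ws.
Proof.
rewrite m_cons /= convDl -convA; congr (_ + _).
by apply: eq_conv => A //; exact: m_cons.
Qed.

(** The moments on both sides are convolutions of cumulants with the moments,
    which cancel. *)
Lemma trace_cumulant_loop l w A :
  n * kappa ((l :: w) :: A) =
  \tr (letter_mx M l) * kappa (w :: A) +
  split_sum (fun u k v => kappa [:: (k ++ l) :: u, v & A] +
    conv (fun B => kappa (((k ++ l) :: u) :: B)) (fun B => kappa (v :: B)) A) w +
  takeout (fun x B => split_sum (fun a e b =>
    kappa (((e ++ l) :: w ++ b ++ a) :: B)) x) A.
Proof.
pose F A := \tr (letter_mx M l) * kappa (w :: A) +
  split_sum (fun u k v => kappa [:: (k ++ l) :: u, v & A] +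
    conv (fun B => kappa (((k ++ l) :: u) :: B)) (fun B => kappa (v :: B)) A) w +
  takeout (fun x B => split_sum (fun a e b =>
    kappa (((e ++ l) :: w ++ b ++ a) :: B)) x) A.
apply: (@conv_inj _ _ m (fun A => n * kappa ((l :: w) :: A)) F) => // ws.
rewrite convZl -m_cons trace_moment_loop// /F convDl convDl convZl -m_cons.
congr (_ + _ + _).
  by rewrite conv_split_suml; apply: eq_split_sum => u k v; rewrite m_cons2.
rewrite -takeout_conv; apply: eq_split_sum => B x B'.
by rewrite conv_split_suml; apply: eq_split_sum => a e b; rewrite m_cons.
Qed.

Lemma trace_cumulant_nil A : kappa ([::] :: A) = if A is [::] then n else 0.
Proof.
apply: (@conv_inj _ _ m (fun A => kappa ([::] :: A)) (fun A => if A is [::] then n else 0)) => // ws.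
rewrite -m_cons.
have -> : m ([::] :: ws) = n * m ws.
  rewrite /trace_moment -complex_expectationZ; last exact: trace_product_integrable.
  congr complex_expectation; apply/funext => t.
  by rewrite /trace_product big_cons /wishart_trace /wishart_word big_nil mxtrace1.
elim: ws (m) => [|x ws IH] G //=.
by rewrite conv0l add0r -IH.
Qed.

(** A cumulant of r traces is of order n^(2 - r). *)
Definition scaled_cumulant (ws : seq word) : C := n ^+ size ws * n ^- 2 * kappa ws.
Local Notation lambda := scaled_cumulant.

Let conv_scale (F G : seq word -> C) A :
  conv (fun B => n ^+ size B * F B) (fun B => n ^+ size B * G B) A =
  n ^+ size A * conv F G A.
Proof.
elim: A F G => [|x A IH] F G /=; first by rewrite !expr0 !mul1r.
have e (H : seq word -> C) : (fun B => n ^+ size (x :: B) * H (x :: B)) =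
    fun B => n * (n ^+ size B * H (x :: B)).
  by apply/funext => B; rewrite /= exprS mulrA.
by rewrite (e F) (e G) convZl convZr !IH -mulrDr -mulrDr exprS mulrA.
Qed.

Lemma scaled_cumulant_loop l w A :
  lambda ((l :: w) :: A) = ntr (letter_mx M l) * lambda (w :: A) +
  split_sum (fun u k v => n ^- 2 * lambda [:: (k ++ l) :: u, v & A] +
    conv (fun B => lambda (((k ++ l) :: u) :: B)) (fun B => lambda (v :: B)) A) w +
  takeout (fun x B => split_sum (fun a e b =>
    lambda (((e ++ l) :: w ++ b ++ a) :: B)) x) A.
Proof.
have n0 : n != 0 by rewrite pnatr_eq0.
have lambdaE x : (fun B => lambda (x :: B)) = fun B => n^-1 * (n ^+ size B * kappa (x :: B)).
  apply/funext => B; rewrite /lambda /= exprS; field.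
  by rewrite nat1r n0.
have -> : lambda ((l :: w) :: A) = n ^+ size A * n ^- 2 * (n * kappa ((l :: w) :: A)).
  by rewrite /lambda /= exprSr; ring.
rewrite trace_cumulant_loop !mulrDr; congr (_ + _ + _).
- rewrite /ntr /lambda /= [n ^+ (size A).+1]exprS; move: (n ^+ size A) => k; field.
  by rewrite nat1r n0.
- rewrite mulr_split_sumr; apply: eq_split_sum => u k v.
  rewrite !lambdaE convZl convZr conv_scale /lambda /= [n ^+ (size A).+2]exprS [n ^+ (size A).+1]exprS.
  move: (n ^+ size A) => c; field.
  by rewrite nat1r n0.
- rewrite /takeout mulr_split_sumr; apply: eq_split_sum_in => B x B' ->.
  rewrite mulr_split_sumr; apply: eq_split_sum => a e b.
  by rewrite /lambda /= !size_cat addnS.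
Qed.

Lemma scaled_cumulant_nil A : lambda ([::] :: A) = if A is [::] then 1 else 0.
Proof.
have n0 : n != 0 by rewrite pnatr_eq0.
rewrite /lambda trace_cumulant_nil; case: A => [|x A]; last by rewrite mulr0.
by rewrite /= expr1 mulrAC -expr2 divff// expf_neq0.
Qed.

Lemma trace_cumulantE ws : kappa ws = n ^+ 2 * n ^- size ws * lambda ws.
Proof.
have n0 : n != 0 by rewrite pnatr_eq0.
rewrite /lambda; set k := n ^+ size ws; have k0 : k != 0 by rewrite expf_neq0.
field.
by rewrite nat1r n0.
Qed.

End CumulantLoop.

(** * Limits of the cumulants *)

Section ComplexLimits.
Variable R : realType.
Local Notation C := R[i].
Implicit Types (u v : nat -> C) (l k : C).

Lemma ccvg_cst u l : (forall N, u N = l) -> ccvg u l.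
Proof. by move=> /funext ->; exact: cvg_cst. Qed.

Lemma ccvgD u v l k : ccvg u l -> ccvg v k -> ccvg (fun N => u N + v N) (l + k).
Proof. exact: cvgD. Qed.

Lemma ccvgM u v l k : ccvg u l -> ccvg v k -> ccvg (fun N => u N * v N) (l * k).
Proof. exact: cvgM. Qed.

Lemma ccvg_unique u l k : ccvg u l -> ccvg u k -> l = k.
Proof. exact: (@cvg_unique _ (@norm_hausdorff C C^o)). Qed.

Lemma eq_ccvg u v l : u =1 v -> ccvg u l -> ccvg v l.
Proof. by move=> /funext ->. Qed.

Lemma ccvg_inv : ccvg (fun N => N.+1%:R^-1 : C) 0.
Proof.
apply/cvgr0Pnorm_lt => -[r i]; rewrite ltcE /= => /andP[/eqP-> r0]; near=> N.
have -> : N.+1%:R^-1 = (N.+1%:R^-1)%:C%C :> C by rewrite fmorphV rmorph_nat.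
rewrite ger0_norm ?lecR ?invr_ge0// ltcR.
rewrite -[ltLHS]ger0_norm ?invr_ge0//.
near: N; apply: cvgr0_norm_lt => //; exact: (@cvg_harmonic R).
Unshelve. all: by end_near. Qed.

Lemma ccvg_split_sum Y (F : nat -> seq Y -> Y -> seq Y -> C) G w :
  (forall a y b, w = a ++ y :: b -> ccvg (fun N => F N a y b) (G a y b)) ->
  ccvg (fun N => split_sum (F N) w) (split_sum G w).
Proof.
elim: w F G => [|y w IH] F G FG /=; first by apply: ccvg_cst.
apply: ccvgD; first exact: FG.
by apply: (IH (fun N a => F N (y :: a))) => a z b wE; apply: FG; rewrite wE.
Qed.

End ComplexLimits.

Section CumulantLimits.
Variables (R : realType) (disp : nat -> measure_display).
Variables (T : forall N, measurableType (disp N)) (P : forall N, probability (T N) R).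
Variable X : forall N, T N -> 'M[R[i]]_N.+1.
Arguments X : clear implicits.
Variables (D : starAlgType R) (psi : tracial_state D) (p : nat).
Variables (DN : forall N, 'I_p -> 'M[R[i]]_N.+1) (d : 'I_p -> D).
Hypothesis gX : forall N, gaussian_random_matrix (P N) (X N).
Hypothesis DNd : converges_in_distribution psi DN d.
Local Notation C := R[i].
Local Notation word := (seq (seq 'I_p)).
Local Notation lambda N := (scaled_cumulant (P N) (X N) (DN N)).

Let degree (ws : seq word) : nat := sumn (map size ws).

Let letter (l : seq 'I_p) : D := \prod_(i <- l) d i.

Let letter_cat k l : letter (k ++ l) = letter k * letter l.
Proof. by rewrite /letter big_cat. Qed.

Let ccvg_conv (F G : nat -> seq word -> C) F' G' A :
  (forall B, (degree B <= degree A)%N -> ccvg (fun N => F N B) (F' B)) ->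
  (forall B, (degree B <= degree A)%N -> ccvg (fun N => G N B) (G' B)) ->
  ccvg (fun N => conv (F N) (G N) A) (conv F' G' A).
Proof.
elim: A F G F' G' => [|x A IH] F G F' G' FF GG /=.
  by apply: ccvgM; [exact: FF|exact: GG].
apply: ccvgD; apply: IH => B BA; (apply: FF || apply: GG);
  by rewrite /degree /= ?leq_add2l// (leq_trans BA)// leq_addl.
Qed.

(** In the limit a trace that splits contributes only its two parts in separate
    cumulants: the cumulant of both carries a factor n^-2. *)
Let limit_loop (L : seq word -> C) l w A : C := psi (letter l) * L (w :: A) +
  split_sum (fun u k v =>
    conv (fun B => L (((k ++ l) :: u) :: B)) (fun B => L (v :: B)) A) w +
  takeout (fun x B => split_sum (fun a e b => L (((e ++ l) :: w ++ b ++ a) :: B)) x) A.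

Let scaled_cumulant_step L l w A :
  (forall x B, (degree (x :: B) < degree ((l :: w) :: A))%N ->
    ccvg (fun N => lambda N (x :: B)) (L (x :: B))) ->
  ccvg (fun N => lambda N ((l :: w) :: A)) (limit_loop L l w A).
Proof.
move=> H; apply: (@eq_ccvg _ (fun N => ntr (letter_mx (DN N) l) * lambda N (w :: A) +
  split_sum (fun u k v => N.+1%:R ^- 2 * lambda N [:: (k ++ l) :: u, v & A] +
    conv (fun B => lambda N (((k ++ l) :: u) :: B)) (fun B => lambda N (v :: B)) A) w +
  takeout (fun x B => split_sum (fun a e b =>
    lambda N (((e ++ l) :: w ++ b ++ a) :: B)) x) A)).
  by move=> N; rewrite scaled_cumulant_loop.
apply: ccvgD; first apply: ccvgD.
- apply: ccvgM; first exact: DNd.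
  by apply: H; rewrite /degree.
- apply: ccvg_split_sum => u k v wE.
  rewrite -[X in ccvg _ X]add0r; apply: ccvgD.
    rewrite -(mul0r (L [:: (k ++ l) :: u, v & A])); apply: ccvgM.
      rewrite -(mul0r 0); apply: (@eq_ccvg _ (fun N => N.+1%:R^-1 * N.+1%:R^-1)).
        by move=> N; rewrite -expr2 exprVn.
      by apply: ccvgM; exact: ccvg_inv.
    apply: H; rewrite /degree /= wE size_cat /=; lia.
  apply: ccvg_conv => B; rewrite /degree => BA; apply: H; rewrite /degree /= wE size_cat /=; lia.
- apply: ccvg_split_sum => B x B' AE; apply: ccvg_split_sum => a e b xE.
  apply: H; rewrite /degree /= AE xE !map_cat !sumn_cat /= !size_cat /=; lia.
Qed.

Let limit_cumulant ws : C := lim ((fun N => lambda N ws : C^o) @ \oo).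

Let ccvg_limit ws l : ccvg (fun N => lambda N ws) l ->
  ccvg (fun N => lambda N ws) (limit_cumulant ws).
Proof. by move=> cl; apply/cvg_ex; exists l. Qed.

(** By induction on the number of letters, as the cumulants on the right of the
    loop equation have fewer. *)
Lemma scaled_cumulant_ccvg x A :
  ccvg (fun N => lambda N (x :: A)) (limit_cumulant (x :: A)).
Proof.
have [n] := ubnP (degree (x :: A)); elim: n x A => // n IH [|l w] A wn.
  apply: (ccvg_limit (l := if A is [::] then 1 else 0)).
  by apply: ccvg_cst => N; rewrite scaled_cumulant_nil.
apply: ccvg_limit; apply: scaled_cumulant_step => y B yB; apply: IH.
by rewrite (leq_trans yB).
Qed.

Let limit_cons l w A :
  limit_cumulant ((l :: w) :: A) = limit_loop limit_cumulant l w A.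
Proof.
apply: (ccvg_unique (@scaled_cumulant_ccvg _ A)).
by apply: scaled_cumulant_step => y B _; exact: scaled_cumulant_ccvg.
Qed.

Let limit_nil A : limit_cumulant ([::] :: A) = if A is [::] then 1 else 0.
Proof.
apply: (ccvg_unique (@scaled_cumulant_ccvg _ A)).
by apply: ccvg_cst => N; rewrite scaled_cumulant_nil.
Qed.

(** For one trace the limiting loop equation is the recursion [wphi_cons]. *)
Lemma limit_cumulant1 w : limit_cumulant [:: w] = wphi psi (map letter w).
Proof.
have [n] := ubnP (size w); elim: n w => // n IH [|l w] wn.
  by rewrite limit_nil wphi_nil.
rewrite limit_cons /limit_loop /takeout addr0 wphi_cons split_sum_map IH//.
congr (_ + _); apply: eq_split_sum_in => u k v wE /=.
move: wn; rewrite wE /= size_cat /= => wn.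
rewrite -letter_cat !IH//=; lia.
Qed.

(** For two traces it is the recursion [wrho_cons]: a letter of the first trace
    splits it, a letter of the second one joins the two. *)
Lemma limit_cumulant2 v w : limit_cumulant [:: v; w] = wrho psi (map letter v) (map letter w).
Proof.
have [n] := ubnP (size v); elim: n v => // n IH [|l v] vn.
  by rewrite limit_nil wrho_nil.
rewrite limit_cons /limit_loop /takeout /= addr0 wrho_cons !split_sum_map IH//.
congr (_ + _ + _).
  apply: eq_split_sum_in => u k u' vE /=.
  move: vn; rewrite vE /= size_cat /= => vn.
  rewrite !limit_cumulant1 -letter_cat !IH /=; [|lia|lia].
  by congr (_ + _); rewrite mulrC.
apply: eq_split_sum => a e b; rewrite limit_cumulant1 /= letter_cat.
by rewrite !map_cat.
Qed.

Local Notation PN N i t := (compound_wishart (X N) (DN N i) t).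

Let trace_words (q : ncpoly C p) : seq (C * word) :=
  [seq (s.1, [seq [:: i] | i <- s.2]) | s <- q].

Let trace_nceval N q t : \tr (nceval (fun i => PN N i t) q) =
  combination (wishart_trace (X N) (DN N)) (trace_words q) t.
Proof.
rewrite /combination big_map /nceval /fcomb_eval raddf_sum; apply: eq_bigr => s _ /=.
rewrite mxtraceZ /wishart_trace /wishart_word big_map; congr (_ * \tr _).
by apply: eq_bigr => i _; rewrite /wishart /letter_mx big_seq1.
Qed.

Let cumulant_traces N q qs :
  list_cumulant (P N) [seq (fun t => \tr (nceval (fun i => PN N i t) q)) | q <- q :: qs] =
  mext (trace_cumulant (P N) (X N) (DN N)) [seq trace_words q | q <- q :: qs].
Proof.
have -> : [seq (fun t => \tr (nceval (fun i => PN N i t) q)) | q <- q :: qs] =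
    [seq combination (wishart_trace (X N) (DN N)) r | r <- [seq trace_words q | q <- q :: qs]].
  by rewrite -map_comp; apply: eq_map => r; apply/funext => t; exact: trace_nceval.
by apply: list_cumulant_combination => ws; exact: (trace_product_integrable (gX N)).
Qed.

Let ccvg_mext (F : nat -> seq word -> C) G qs :
  (forall ws, size ws = size qs -> ccvg (fun N => F N ws) (G ws)) ->
  ccvg (fun N => mext (F N) qs) (mext G qs).
Proof.
elim: qs F G => [|q qs IH] F G FG /=; first exact: FG.
elim: (q : seq _) => [|s r IHr].
  by rewrite big_nil; apply: ccvg_cst => N; rewrite big_nil.
rewrite big_cons; under [X in ccvg X]eq_fun do rewrite big_cons.
apply: ccvgD IHr; apply: ccvgM; first by apply: ccvg_cst.
by apply: (IH (fun N ws => F N (s.2 :: ws))) => ws e; apply: FG; rewrite /= e.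
Qed.

Let letter1 (w : seq 'I_p) : [seq letter l | l <- [seq [:: i] | i <- w]] = [seq d i | i <- w].
Proof. by rewrite -map_comp; apply: eq_map => i /=; rewrite /letter big_seq1. Qed.

Let pwordE (w : seq 'I_p) : \prod_(i <- w) poisson psi (d i) = pword psi [seq d i | i <- w].
Proof. by rewrite /pword big_map. Qed.

Let scalar_fcomb (f : fock_alg psi -> C) (F : seq 'I_p -> fock_alg psi) (q : ncpoly C p) :
  scalar f -> f (fcomb_eval F q) = \sum_(s <- q) s.1 * f (F s.2).
Proof.
move=> sf; elim: q => [|s q IH].
  rewrite fcomb_eval_nil big_nil; have := sf (-1) 0 0.
  by rewrite scaler0 addr0 mulN1r addNr.
by rewrite fcomb_eval_cons big_cons sf IH.
Qed.

Local Notation pd := (fun i => poisson psi (d i)).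

Let n_neq0 N : N.+1%:R != 0 :> C. Proof. by rewrite pnatr_eq0. Qed.

Lemma wishart_first_order q :
  ccvg (fun N => cumulant (P N) [tuple (fun t => ntr (nceval (fun i => PN N i t) q))])
       (fock_phi psi (nceval pd q)).
Proof.
have -> : fock_phi psi (nceval pd q) = mext limit_cumulant [:: trace_words q].
  rewrite /= big_map [LHS]scalar_fcomb; last exact: fock_phi_linear.
  apply: eq_bigr => s _.
  by rewrite limit_cumulant1 letter1 pwordE fock_phi_pword.
apply: (@eq_ccvg _ (fun N => mext (lambda N) [:: trace_words q])); last first.
  by apply: ccvg_mext => -[|w []]// _; exact: scaled_cumulant_ccvg.
move=> N; rewrite cumulantE.
have -> : [tuple (fun t => ntr (nceval (fun i => PN N i t) q))] =
    [:: combination (wishart_trace (X N) (DN N))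
          [seq (N.+1%:R^-1 * s.1, s.2) | s <- trace_words q]] :> seq (T N -> C).
  congr [:: _]; apply/funext => t.
  rewrite /ntr trace_nceval /combination mulr_sumr [RHS]big_map.
  by apply: eq_bigr => s _; rewrite mulrA.
have /= -> := list_cumulant_combination (fun ws => trace_product_integrable (gX N) (DN N) ws)
  [seq (N.+1%:R^-1 * s.1, s.2) | s <- trace_words q] [::].
rewrite [RHS]big_map; apply: eq_bigr => s _ /=.
rewrite -[list_cumulant _ _]/(trace_cumulant (P N) (X N) (DN N) [:: s.2]) trace_cumulantE /= expr1.
field.
by rewrite nat1r n_neq0.
Qed.

Lemma wishart_second_order q r :
  ccvg (fun N => cumulant (P N) [tuple (fun t => \tr (nceval (fun i => PN N i t) q));
                                       (fun t => \tr (nceval (fun i => PN N i t) r))])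
       (fock_rho psi (nceval pd q) (nceval pd r)).
Proof.
have -> : fock_rho psi (nceval pd q) (nceval pd r) =
    mext limit_cumulant [:: trace_words q; trace_words r].
  rewrite /= big_map [LHS](@scalar_fcomb (fun a => fock_rho psi a _)); last exact: fock_rho_linearl.
  apply: eq_bigr => s _; rewrite big_map [X in _ * X]scalar_fcomb; last exact: fock_rho_linearr.
  congr (_ * _); apply: eq_bigr => s' _.
  by rewrite limit_cumulant2 !letter1 !pwordE fock_rho_pword.
apply: (@eq_ccvg _ (fun N => mext (lambda N) [:: trace_words q; trace_words r])); last first.
  by apply: ccvg_mext => -[|v [|w []]]// _; exact: scaled_cumulant_ccvg.
move=> N; rewrite cumulantE; have := cumulant_traces N q [:: r] => /= ->.
apply: eq_bigr => s _; congr (_ * _); apply: eq_bigr => s' _; congr (_ * _).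
by rewrite trace_cumulantE divff ?expf_neq0// mul1r.
Qed.

Lemma wishart_higher_order r (q : r.-tuple (ncpoly C p)) : (3 <= r)%N ->
  ccvg (fun N => cumulant (P N)
    (map_tuple (fun q' t => \tr (nceval (fun i => PN N i t) q')) q)) 0.
Proof.
move=> r3; have [k rE] : exists k, r = k.+3 by exists (r - 3)%N; lia.
have [q0 [qs qE]] : exists q0 qs, tval q = q0 :: qs.
  case: (tval q) (size_tuple q) => [|q0 qs] e; last by exists q0, qs.
  by move: r3; rewrite -e.
have inv_pow j : ccvg (fun N => (N.+1%:R^-1) ^+ j : C) (0 ^+ j).
  elim: j => [|j IH]; first by apply: ccvg_cst.
  under [X in ccvg X]eq_fun do rewrite exprS.
  by rewrite exprS; apply: ccvgM IH; exact: ccvg_inv.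
rewrite -(mext0 [seq trace_words q | q <- q0 :: qs]).
apply: (@eq_ccvg _ (fun N => mext (trace_cumulant (P N) (X N) (DN N))
    [seq trace_words q | q <- q0 :: qs])).
  by move=> N; rewrite cumulantE /= qE cumulant_traces.
apply: ccvg_mext => ws wsE.
have sz : size ws = k.+3 by rewrite wsE size_map -qE size_tuple.
apply: (@eq_ccvg _ (fun N => (N.+1%:R^-1) ^+ k.+1 * lambda N ws)).
  move=> N; rewrite trace_cumulantE sz exprVn; congr (_ * _).
  by rewrite (exprD _ 2 k.+1) invfM mulrA divff ?expf_neq0// mul1r.
case: ws sz {wsE} => // w ws _; rewrite -(mul0r (limit_cumulant (w :: ws))).
apply: ccvgM; last exact: scaled_cumulant_ccvg.
by have := inv_pow k.+1; rewrite expr0n.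
Qed.

End CumulantLimits.

Unset Implicit Arguments.

Theorem mainTheorem5 (R : realType)
  (disp : nat -> measure_display)
  (T : forall N, measurableType (disp N))
  (P : forall N, probability (T N) R)
  (X : forall N, T N -> 'M[R[i]]_N.+1)
  (D : starAlgType R) (psi : tracial_state D)
  (p : nat) (DN : forall N, 'I_p -> 'M[R[i]]_N.+1) (d : 'I_p -> D) :
  (forall N, gaussian_random_matrix (P N) (X N)) ->
  converges_in_distribution psi DN d ->
  let PN := fun N (i : 'I_p) => compound_wishart (X N) (DN N i) in
  let pd := fun i : 'I_p => poisson psi (d i) in
  second_order_limit P PN (fock_phi psi) (fock_rho psi) pd /\
  ((forall i j : 'I_p, i != j -> d i * d j = 0) ->
   free_second_order (fock_phi psi) (fock_rho psi)
     (generated_subalgs pd) /\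
   asymptotically_free_second_order P PN).
Proof.
move=> gX DNd PN pd.
have lim : second_order_limit P PN (fock_phi psi) (fock_rho psi) pd.
  split=> [|q|q1 q2|r q r3]; first exact: fock_second_order_space.
  - exact: (wishart_first_order gX DNd).
  - exact: (wishart_second_order gX DNd).
  - exact: (wishart_higher_order gX DNd q r3).
split=> // orth.
have free := fock_free psi orth.
by split=> //; exists (fock_alg psi), (fock_phi psi), (fock_rho psi), pd.
Qed.
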